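(* Let $R$ be a Poisson nilpotent algebra over a field $\mathbb{K}$ of characteristic zero. Then its Poisson prime spectrum $\mathrm{P.Spec}\, R$ is catenary, i.e., for any two Poisson prime ideals $P \subseteq Q$ of $R$, all saturated chains of inclusions of Poisson prime ideals from $P$ to $Q$ have the same length.
   Context: All algebras are unital commutative algebras over a fixed base field $\mathbb{K}$ of characteristic zero. A Poisson algebra is a commutative $\mathbb{K}$-algebra with a $\mathbb{K}$-bilinear Poisson bracket $\{-,-\}$: a Lie bracket which is a derivation in each variable for the associative product. An ideal $I$ of a Poisson algebra $R$ is a Poisson ideal if $\{R,I\}\subseteq I$. For a noetherian Poisson algebra $R$, $\mathrm{P.Spec}\,R$ is the set of ideals of $R$ which are both Poisson ideals and prime ideals (called Poisson prime ideals), ordered by inclusion. A chain in $\mathrm{P.Spec}\,R$ is saturated if no Poisson prime ideal lies strictly between consecutive terms. Poisson polynomial algebras: Let $A$ be a Poisson algebra. A Poisson derivation on $A$ is a $\mathbb{K}$-linear map $\sigma:A\to A$ that is a derivation for both the multiplication and the Poisson bracket. A Poisson $\sigma$-derivation is a $\mathbb{K}$-linear derivation $\delta$ of the associative algebra $A$ with $\delta(\{a,b\})=\{\delta(a),b\}+\{a,\delta(b)\}+\sigma(a)\delta(b)-\delta(a)\sigma(b)$ for all $a,b\in A$. Given such $\sigma,\delta$, the Poisson structure of $A$ extends uniquely to a Poisson structure on $A[x]$ with $\{x,a\}=\sigma(a)x+\delta(a)$ for all $a\in A$; the resulting Poisson algebra is denoted $A[x;\sigma,\delta]_p$. Torus actions: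 $\mathcal{H}$ is an algebraic torus $(\mathbb{K}^* )^r$ over $\mathbb{K}$, with character group $X(\mathcal{H})$. An action of $\mathcal{H}$ on an algebra $R$ by algebra automorphisms is rational if $R$ is spanned by $\mathcal{H}$-eigenvectors (nonzero by convention) whose eigenvalues $\mathcal{H}\to\mathbb{K}^*$ are morphisms of algebraic groups. Then $R=\bigoplus_{\chi\in X(\mathcal{H})}R_\chi$, and $\mathrm{Lie}\,\mathcal{H}$ acts on $R$ by the differential of the $\mathcal{H}$-action: $h\cdot r=(d\chi)(h)\,r$ for $h\in\mathrm{Lie}\,\mathcal{H}$, $r\in R_\chi$, where $d\chi:\mathrm{Lie}\,\mathcal{H}\to\mathbb{K}$ is the differential of $\chi$. Poisson nilpotent algebra (Poisson-CGL extension): an iterated Poisson polynomial algebra $R=\mathbb{K}[x_1]_p[x_2;\sigma_2,\delta_2]_p\cdots[x_N;\sigma_N,\delta_N]_p$, with $R_k:=\mathbb{K}[x_1,\dots,x_k]=\mathbb{K}[x_1]_p[x_2;\sigma_2,\delta_2]_p\cdots[x_k;\sigma_k,\delta_k]_p$ for $0\le k\le N$ (so $R_0=\mathbb{K}$, and $R_1=\mathbb{K}[x_1]_p=\mathbb{K}[x_1;\sigma_1,\delta_1]_p$ with $\sigma_1=\delta_1=0$), equipped with a rational action of an algebraic torus $\mathcal{H}$ by Poisson algebra automorphisms such that: (i) $x_1,\dots,x_N$ are $\mathcal{H}$-eigenvectors; (ii) for every $2\le k\le N$, the map $\delta_k$ on $R_{k-1}$ is locally nilpotent; (iii) for every $1\le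 k\le N$, there exists $h_k\in\mathrm{Lie}\,\mathcal{H}$ such that $(h_k\cdot)|_{R_{k-1}}=\sigma_k$ and the $h_k$-eigenvalue of $x_k$ is nonzero. *)

(* Defs.v *)
From HB Require Import structures.
From mathcomp Require Import all_boot all_order all_algebra.
From mathcomp Require Import mpoly.
From mathcomp Require Import boolp classical_sets.

Set Implicit Arguments.
Unset Strict Implicit.
Unset Printing Implicit Defensive.

Import GRing.Theory.
Local Open Scope ring_scope.

Record poisson_bracket (K : fieldType) (A : comAlgType K)
    (br : A -> A -> A) : Prop := PoissonBracket {
  pb_linear_l : forall b, linear (br^~ b);
  pb_linear_r : forall a, linear (br a);
  pb_alternating : forall a, br a a = 0;
  pb_jacobi : forall a b c,
    br a (br b c) + br b (br c a) + br c (br a b) = 0;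
  pb_leibniz_l : forall a b c, br (a * b) c = br a c * b + a * br b c;
  pb_leibniz_r : forall a b c, br a (b * c) = br a b * c + b * br a c }.

(* The next three notions are relative to a subalgebra S of A: the maps
   sigma, delta are functions on all of A, but only their restrictions to S,
   which must take values in S, are constrained. *)

Record derivation_on (K : fieldType) (A : comAlgType K) (S : {pred A})
    (d : A -> A) : Prop := DerivationOn {
  der_closed : {in S, forall a, d a \in S};
  der_linear : forall c, {in S &, forall a b, d (c *: a + b) = c *: d a + d b};
  der_leibniz : {in S &, forall a b, d (a * b) = d a * b + a * d b} }.

Definition poisson_derivation_on (K : fieldType) (A : comAlgType K)
    (br : A -> A -> A) (S : {pred A}) (sigma : A -> A) : Prop :=
  derivation_on S sigma /\
  {in S &, forall a b, sigma (br a b) = br (sigma a) b + br a (sigma b)}.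

Definition poisson_sigma_derivation_on (K : fieldType) (A : comAlgType K)
    (br : A -> A -> A) (S : {pred A}) (sigma delta : A -> A) : Prop :=
  derivation_on S delta /\
  {in S &, forall a b, delta (br a b) =
     br (delta a) b + br a (delta b) + sigma a * delta b - delta a * sigma b}.

(* When x is an indeterminate over S (so that S[x] is a polynomial ring) and br
   is a Poisson bracket, this says that S is a Poisson subalgebra and that S[x],
   with the bracket br, is S[x; sigma, delta]_p. *)
Record poisson_polynomial_over (K : fieldType) (A : comAlgType K)
    (br : A -> A -> A) (S : {pred A}) (x : A) (sigma delta : A -> A) : Prop :=
  PoissonPolynomialOver {
  pp_closed : {in S &, forall a b, br a b \in S};
  pp_sigma : poisson_derivation_on br S sigma;
  pp_delta : poisson_sigma_derivation_on br S sigma delta;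
  pp_bracket : {in S, forall a, br x a = sigma a * x + delta a} }.

(* K[x_0, ..., x_{k-1}] inside K[x_0, ..., x_{n-1}]. *)
Definition subpoly (K : fieldType) (n k : nat) : {pred {mpoly K[n]}} :=
  fun p => all (fun m : 'X_{1..n} => [forall i : 'I_n, (k <= i)%N ==> (m i == 0%N)])
               (msupp p).

(* K[x_0]_p[x_1; sigma_1, delta_1]_p ... [x_{n-1}; sigma_{n-1}, delta_{n-1}]_p.
   For k = 0 the maps sigma_0, delta_0 are derivations of K over K, hence 0. *)
Definition iterated_poisson_polynomial (K : fieldType) (n : nat)
    (br : {mpoly K[n]} -> {mpoly K[n]} -> {mpoly K[n]})
    (sigma delta : 'I_n -> {mpoly K[n]} -> {mpoly K[n]}) : Prop :=
  poisson_bracket br /\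
  forall k : 'I_n,
    poisson_polynomial_over br (@subpoly K n k) 'X_k (sigma k) (delta k).

Record Kstar (K : fieldType) := MkKstar { Kstar_val : K; _ : Kstar_val != 0 }.

HB.instance Definition _ (K : fieldType) := [isSub for @Kstar_val K].
HB.instance Definition _ (K : fieldType) := [Choice of Kstar K by <:].

Section KstarGroup.
Variable K : fieldType.
Implicit Types x y z : Kstar K.

Fact Kstar_mul_subproof x y : val x * val y != 0.
Proof. by rewrite mulf_neq0 ?(valP x) ?(valP y). Qed.
Fact Kstar_inv_subproof x : (val x)^-1 != 0.
Proof. by rewrite invr_neq0 ?(valP x). Qed.

Definition Kstar_one : Kstar K := MkKstar (oner_neq0 K).
Definition Kstar_mul x y : Kstar K := MkKstar (Kstar_mul_subproof x y).
Definition Kstar_inv x : Kstar K := MkKstar (Kstar_inv_subproof x).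

Fact Kstar_mulA : associative Kstar_mul.
Proof. by move=> x y z; apply: val_inj; rewrite /= mulrA. Qed.
Fact Kstar_mul1 : left_id Kstar_one Kstar_mul.
Proof. by move=> x; apply: val_inj; rewrite /= mul1r. Qed.
Fact Kstar_1mul : right_id Kstar_one Kstar_mul.
Proof. by move=> x; apply: val_inj; rewrite /= mulr1. Qed.
Fact Kstar_mulV : left_inverse Kstar_one Kstar_inv Kstar_mul.
Proof. by move=> x; apply: val_inj; rewrite /= mulVf ?(valP x). Qed.
Fact Kstar_Vmul : right_inverse Kstar_one Kstar_inv Kstar_mul.
Proof. by move=> x; apply: val_inj; rewrite /= mulfV ?(valP x). Qed.

HB.instance Definition _ := isGroup.Build (Kstar K)
  Kstar_mulA Kstar_mul1 Kstar_1mul Kstar_mulV Kstar_Vmul.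
End KstarGroup.

Definition torus (K : fieldType) (r : nat) := {ffun 'I_r -> Kstar K}.

(* The coordinate ring of the torus is the Laurent polynomial ring, whose
   elements are the fractions p / (t_0 ... t_{r-1})^e.  A morphism of algebraic
   groups torus -> K^* is a group morphism given by such a fraction.  As K is
   infinite in what follows, the fraction is determined by the map. *)
Record character (K : fieldType) (r : nat) := Character {
  char_fun :> torus K r -> Kstar K;
  char_num : {mpoly K[r]};
  char_exp : nat;
  char_morph : {morph char_fun : s t / (s * t)%g};
  char_regular : forall t : torus K r,
    val (char_fun t) = char_num.@[fun i => val (t i)]
                       / (\prod_(i < r) val (t i)) ^+ char_exp }.

(* The tangent space of the torus at the identity. *)
Definition Lie (K : fieldType) (r : nat) := {ffun 'I_r -> K}.

(* The differential at the identity, by the quotient rule: the product of the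
   coordinates has value 1 and differential u |-> \sum_i u i there. *)
Definition char_diff (K : fieldType) (r : nat) (chi : character K r)
    (u : Lie K r) : K :=
  \sum_(i < r) ((char_num chi)^`M(i)).@[fun=> 1] * u i
  - (char_num chi).@[fun=> 1] * (char_exp chi)%:R * \sum_(i < r) u i.

Definition eigenvector (K : fieldType) (r : nat) (R : lmodType K)
    (act : torus K r -> R -> R) (chi : torus K r -> Kstar K) (v : R) : Prop :=
  v != 0 /\ forall t, act t v = val (chi t) *: v.

Record action_by_automorphisms (K : fieldType) (r : nat) (R : comAlgType K)
    (act : torus K r -> R -> R) : Prop := ActionByAutomorphisms {
  act_one : forall a, act 1%g a = a;
  act_mul : forall s t a, act (s * t)%g a = act s (act t a);
  act_linear : forall t, linear (act t);
  act_monoid_morphism : forall t, monoid_morphism (act t) }.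

Definition rational_action (K : fieldType) (r : nat) (R : comAlgType K)
    (act : torus K r -> R -> R) : Prop :=
  action_by_automorphisms act /\
  forall a : R, exists s : seq (K * R),
    (forall cv, cv \in s -> exists chi : character K r, eigenvector act chi cv.2)
    /\ a = \sum_(cv <- s) cv.1 *: cv.2.

(* D is the action of u on R obtained by differentiating act. When act is
   rational there is exactly one such D. *)
Definition is_Lie_action (K : fieldType) (r : nat) (R : lmodType K)
    (act : torus K r -> R -> R) (u : Lie K r) (D : R -> R) : Prop :=
  linear D /\
  forall (chi : character K r) (v : R),
    eigenvector act chi v -> D v = char_diff chi u *: v.

Record poisson_nilpotent (K : fieldType) (n r : nat)
    (br : {mpoly K[n]} -> {mpoly K[n]} -> {mpoly K[n]})
    (sigma delta : 'I_n -> {mpoly K[n]} -> {mpoly K[n]})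
    (act : torus K r -> {mpoly K[n]} -> {mpoly K[n]}) : Prop :=
  PoissonNilpotent {
  pn_iterated : iterated_poisson_polynomial br sigma delta;
  pn_rational : rational_action act;
  pn_poisson : forall t a b, act t (br a b) = br (act t a) (act t b);
  pn_eigen : forall k : 'I_n,
    exists chi : torus K r -> Kstar K, eigenvector act chi 'X_k;
  pn_nilpotent : forall k : 'I_n, (0 < k)%N ->
    {in @subpoly K n k, forall a, exists e : nat, iter e (delta k) a = 0};
  pn_Lie : forall k : 'I_n, exists (h : Lie K r) (D : {mpoly K[n]} -> {mpoly K[n]}),
    [/\ is_Lie_action act h D,
        {in @subpoly K n k, D =1 sigma k}
      & exists2 lambda : K, lambda != 0 & D 'X_k = lambda *: 'X_k] }.

Definition poisson_ideal (K : fieldType) (A : comAlgType K)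
    (br : A -> A -> A) (I : set A) : Prop :=
  forall a b, I b -> I (br a b).

(* Properness of prime ideals is part of [idealr_closed]. *)
Definition PSpec (K : fieldType) (A : comAlgType K) (br : A -> A -> A) :
    set (set A) :=
  [set P | [/\ idealr_closed [pred a | a \in P], prime_idealr_closed [pred a | a \in P]
             & poisson_ideal br P]]%classic.

(* The chain c 0 < c 1 < ... < c n, of length n; the values of c beyond n are
   irrelevant. *)
Definition saturated_chain (T : Type) (X : set (set T)) (P Q : set T)
    (n : nat) (c : nat -> set T) : Prop :=
  [/\ c 0%N = P, c n = Q,
      forall i, (i <= n)%N -> X (c i),
      forall i, (i < n)%N -> (c i `<` c i.+1)%classic
    & forall i, (i < n)%N ->
        ~ exists2 I, X I & (c i `<` I)%classic /\ (I `<` c i.+1)%classic].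

Definition catenary (T : Type) (X : set (set T)) : Prop :=
  forall P Q, X P -> X Q -> (P `<=` Q)%classic ->
  forall (m n : nat) (c d : nat -> set T),
    saturated_chain X P Q m c -> saturated_chain X P Q n d -> m = n.

(* Main.v *)
(** The torus action is only used through the Poisson derivations D by which its
    Lie algebra acts: they multiply each variable by a scalar, and for every k
    some D restricts to sigma_k on R_(k-1) with a nonzero eigenvalue on x_k.

    Normal separation: if J < J' are D-stable Poisson primes, then J' contains
    an element outside J which is normal and homogeneous modulo J.  This goes by
    induction on the number of variables.  In B[X], a homogeneous normal u in B
    with delta^d u nonzero and delta^(d+1) u = 0 extends to a normal polynomial
    with leading coefficient u and the rescaled delta^i u as lower coefficients;
    one of u and this polynomial separates.

    For adjacent Poisson primes P < Q this yields u in Q \ P and s outside Q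
    with s {u, R} contained in u R + P.  Hence u R + P becomes a Poisson ideal
    after inverting s, so Q is a minimal prime over it: g Q is nilpotent modulo
    u R + P for some g outside Q.  By Noether normalization of (R / P)[1/g] over
    a polynomial ring A, and since A is completely integrally closed, the
    constant term c of the minimal polynomial of u over A divides a power of
    every element of A lying in Q.  So the variables of A, except one occurring
    in c, stay independent modulo Q, and the transcendence degree drops by
    exactly one from R / P to R / Q. *)

Require Import Defs.
From HB Require Import structures.
From mathcomp Require Import all_boot all_order all_algebra.
From mathcomp Require Import mpoly zify.
From mathcomp Require Import boolp classical_sets.
From Stdlib Require BinNums BinInt BinNat Ring_polynom Ring_theory InitialRing.

Set Implicit Arguments.
Unset Strict Implicit.
Unset Printing Implicit Defensive.

Import Order.TTheory GRing.Theory.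
Local Open Scope ring_scope.

(** * A reflexive tactic for identities in commutative rings *)

(** A Poisson prime need not be stable under the [D], whereas normal separation concerns stable
    primes only. The bridge is the core of a prime, its largest [D]-stable Poisson ideal, which is
    prime again in characteristic zero. When no homogeneous element of Q lies outside P, the cores
    say nothing; an element of Q with fewest homogeneous components is then normal only up to a
    multiplier outside Q, which is where [s] comes from. Homogeneity is carried through the
    induction on the variables because sigma is itself one of the [D]: its eigenvalue on u enters
    the bracket of X with the normal polynomial, and the nonzero eigenvalue on X is what the
    rescaling divides by. The last step stands in for Krull's principal ideal theorem combined with
    the dimension formula for affine domains. The constant term c plays the part of the norm of u:
    unless Q meets A in zero, it meets A in the radical of the principal ideal of c, a hypersurface.
    Characteristic zero enters through binomial coefficients, through the divisions by d and j!, and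
    through a Vandermonde determinant at integer points. *)

Module RingReflection.

Import BinNums BinInt BinNat Ring_polynom Ring_theory InitialRing.

Inductive rexpr : Type :=
  | RVar of positive | RZero | ROne | RAdd of rexpr & rexpr
  | RMul of rexpr & rexpr | ROpp of rexpr | RNat of rexpr & nat
  | RExp of rexpr & nat.

Fixpoint rpexpr (e : rexpr) : PExpr Z :=
  match e with
  | RVar p => @PEX Z p
  | RZero => PEc Z0
  | ROne => PEc (Zpos xH)
  | RAdd e1 e2 => PEadd (rpexpr e1) (rpexpr e2)
  | RMul e1 e2 => PEmul (rpexpr e1) (rpexpr e2)
  | ROpp e1 => PEopp (rpexpr e1)
  | RNat e1 n => PEmul (iter n (PEadd (PEc (Zpos xH))) (PEc Z0)) (rpexpr e1)
  | RExp e1 n => PEpow (rpexpr e1) (bin_of_nat n)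
  end.

Section RingExpr.
Variable A : comPzRingType.

Fixpoint reval (env : seq A) (e : rexpr) : A :=
  match e with
  | RVar p => BinList.nth 0 p env
  | RZero => 0
  | ROne => 1
  | RAdd e1 e2 => reval env e1 + reval env e2
  | RMul e1 e2 => reval env e1 * reval env e2
  | ROpp e1 => - reval env e1
  | RNat e1 n => reval env e1 *+ n
  | RExp e1 n => reval env e1 ^+ n
  end.

Lemma com_ring_theory :
  @ring_theory A 0 1 +%R *%R (fun x y => x - y) -%R eq.
Proof.
split=> //; [exact: add0r | exact: addrC | exact: addrA | exact: mul1r
  | exact: mulrC | exact: mulrA | exact: mulrDl | exact: subrr].
Qed.

Lemma expr_power_theory :
  @power_theory A 1 *%R eq nat nat_of_bin (@GRing.exp A).
Proof.
split=> x [|p] //=; elim: p => //= p IH.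
- by rewrite NatTrec.doubleE exprS -addnn exprD IH.
- by rewrite NatTrec.doubleE -addnn exprD IH.
Qed.

Definition rnorm (e : rexpr) : Pol Z :=
  norm_subst Z0 (Zpos xH) Z.add Z.mul Z.sub Z.opp Zbool.Zeq_bool
    (triv_div Z0 (Zpos xH) Zbool.Zeq_bool) 0 [::] (rpexpr e).

(** The integers map to every commutative ring, so equality of normal forms with integer
    coefficients, a closed boolean computation, implies the identity. *)
Lemma rexpr_correct (env : seq A) (e1 e2 : rexpr) :
  Peq Zbool.Zeq_bool (rnorm e1) (rnorm e2) = true ->
  reval env e1 = reval env e2.
Proof.
have Rsth := Eqsth A; have Reqe := Eq_ext +%R *%R (@GRing.opp A).
have ARth := Rth_ARth Rsth Reqe com_ring_theory.
have morphZ := gen_phiZ_morph Rsth Reqe com_ring_theory.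
have div_th := triv_div_th Rsth Reqe ARth morphZ.
have := ring_correct Rsth Reqe ARth morphZ expr_power_theory div_th
  0 env [::] (rpexpr e1) (rpexpr e2) I.
set ev := PEeval _ _ _ _ _ _ _ _ _.
have evE e : reval env e = ev env (rpexpr e).
  elim: e => //= [a IHa b IHb|a IHa b IHb|a IHa|a IHa n|a IHa n].
  - by rewrite IHa IHb.
  - by rewrite IHa IHb.
  - by rewrite IHa.
  - rewrite IHa; have -> : ev env (iter n (PEadd (PEc (Zpos xH))) (PEc Z0)) = n%:R.
      by elim: n => //= n ->; rewrite mulrS.
    by rewrite mulr_natl.
  - by rewrite IHa bin_of_natK.
by rewrite !evE; apply.
Qed.

End RingExpr.

(* Syntactic comparison of atoms, up to the instances of the ring operations. *)
Ltac same_atom x y :=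
  lazymatch constr:((x, y)) with
  | (?z, ?z) => idtac
  | (@GRing.one _, @GRing.one _) => idtac
  | (@Algebra.zero _, @Algebra.zero _) => idtac
  | (@Algebra.natmul _ ?a ?n, @Algebra.natmul _ ?b ?n) => same_atom a b
  | (@GRing.exp _ ?a ?n, @GRing.exp _ ?b ?n) => same_atom a b
  | (@Algebra.opp _ ?a, @Algebra.opp _ ?b) => same_atom a b
  | (@Algebra.add _ ?a ?c, @Algebra.add _ ?b ?d) =>
    same_atom a b; same_atom c d
  | (@GRing.mul _ ?a ?c, @GRing.mul _ ?b ?d) =>
    same_atom a b; same_atom c d
  | (@polyX _, @polyX _) => unify x y
  | (?f ?a, ?f ?b) => same_atom a b
  | (?f ?a, ?g ?b) => unify f g; same_atom a b
  end.

Ltac ring_index x env :=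
  match env with
  | ?y :: _ => let _ := match goal with _ => same_atom x y end in constr:(xH)
  | _ :: ?env' => let p := ring_index x env' in
    let q := eval compute in (BinPos.Pos.succ p) in constr:(q)
  end.

Ltac ring_add_atom x env :=
  match env with
  | _ => let p := ring_index x env in constr:(env)
  | _ => constr:(x :: env)
  end.

Ltac is_numeral n :=
  lazymatch n with O => idtac | S ?m => is_numeral m end.

Ltac ring_atoms t env :=
  match t with
  | @Algebra.add _ ?a ?b => let env := ring_atoms a env in ring_atoms b env
  | @GRing.mul _ ?a ?b => let env := ring_atoms a env in ring_atoms b env
  | @Algebra.opp _ ?a => ring_atoms a env
  | @Algebra.zero _ => constr:(env)
  | @GRing.one _ => constr:(env)
  | @Algebra.natmul _ ?a ?n =>
    let _ := match goal with _ => is_numeral n end in ring_atoms a env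
  | @GRing.exp _ ?a ?n =>
    let _ := match goal with _ => is_numeral n end in ring_atoms a env
  | _ => ring_add_atom t env
  end.

Ltac ring_reify t env :=
  match t with
  | @Algebra.add _ ?a ?b =>
    let a := ring_reify a env in let b := ring_reify b env in
    constr:(RAdd a b)
  | @GRing.mul _ ?a ?b =>
    let a := ring_reify a env in let b := ring_reify b env in
    constr:(RMul a b)
  | @Algebra.opp _ ?a => let a := ring_reify a env in constr:(ROpp a)
  | @Algebra.zero _ => constr:(RZero)
  | @GRing.one _ => constr:(ROne)
  | @Algebra.natmul _ ?a ?n =>
    let _ := match goal with _ => is_numeral n end in
    let a := ring_reify a env in constr:(RNat a n)
  | @GRing.exp _ ?a ?n =>
    let _ := match goal with _ => is_numeral n end in
    let a := ring_reify a env in constr:(RExp a n)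
  | _ => let p := ring_index t env in constr:(RVar p)
  end.

Tactic Notation "ring_over" constr(A) :=
  lazymatch goal with
  | |- @eq _ ?a ?b =>
    let env := ring_atoms a constr:(@nil A) in
    let env := ring_atoms b env in
    let e1 := ring_reify a env in
    let e2 := ring_reify b env in
    refine (@rexpr_correct _ env e1 e2 _); vm_compute; reflexivity
  end.

End RingReflection.

Import RingReflection.

(** * Ideals, derivations and Poisson rings *)

(** Pascal's rule, in the shape taken by the induction step of every Leibniz expansion below;
    [M p q] is the term with p derivatives on one factor and q on the other. *)
Lemma pascal_sum (W : zmodType) (M : nat -> nat -> W) j :
  \sum_(i < j.+1) (M (j - i).+1 i + M (j - i)%N i.+1) *+ 'C(j, i) =
  \sum_(i < j.+2) M (j.+1 - i)%N i *+ 'C(j.+1, i).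
Proof.
under eq_bigr => i _ do rewrite mulrnDl -subSn ?leq_ord //.
rewrite big_split /= [RHS]big_ord_recl /=.
have -> : \sum_(i < j.+1) M (j.+1 - bump 0 i)%N (bump 0 i) *+ 'C(j.+1, bump 0 i) =
    \sum_(i < j.+1) M (j - i)%N i.+1 *+ 'C(j, i.+1) +
    \sum_(i < j.+1) M (j - i)%N i.+1 *+ 'C(j, i).
  by rewrite -big_split; apply: eq_bigr => i _; rewrite /bump add1n binS mulrnDr.
rewrite addrA; congr (_ + _).
rewrite big_ord_recl [X in _ = _ + X]big_ord_recr /=.
by rewrite !bin0 bin_small // mulr0n addr0.
Qed.

Lemma iter_leibniz (U V : Type) (W : zmodType) (m : U -> V -> W)
    (f : U -> U) (g : V -> V) (h : W -> W) :
  {morph h : x y / x + y} ->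
  (forall u v, h (m u v) = m (f u) v + m u (g v)) ->
  forall j u v,
  iter j h (m u v) =
    \sum_(i < j.+1) m (iter (j - i) f u) (iter i g v) *+ 'C(j, i).
Proof.
move=> hD hm; have h0 : h 0 = 0 by apply: (addrI (h 0)); rewrite -hD !addr0.
have hMn x k : h (x *+ k) = h x *+ k.
  by elim: k => [|k IH]; rewrite ?mulr0n // !mulrS hD IH.
elim=> [|j IH] u v; first by rewrite big_ord1 /= mulr1n.
rewrite iterS IH (big_morph h hD h0).
rewrite -(pascal_sum (fun p q => m (iter p f u) (iter q g v))).
by apply: eq_bigr => i _; rewrite hMn hm !iterS.
Qed.

Section Ideals.
Variable A : comNzRingType.
Implicit Types (I P Q S : set A) (D : set (A -> A)).

Record ideal I : Prop := Ideal {
  ideal0 : I 0;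
  idealD : forall a b, I a -> I b -> I (a + b);
  idealM : forall a b, I b -> I (a * b) }.

Record prime_ideal P : Prop := PrimeIdeal {
  prime_ideal_ideal : ideal P;
  prime_ideal1 : ~ P 1;
  prime_idealP : forall a b, P (a * b) -> P a \/ P b }.

Record derivation (d : A -> A) : Prop := Derivation {
  derD : {morph d : a b / a + b};
  derM : forall a b, d (a * b) = d a * b + a * d b }.

Definition stable D I := forall d, D d -> forall a, I a -> I (d a).

Definition mult_closed S := S 1 /\ forall a b, S a -> S b -> S (a * b).

Lemma idealMr I a b : ideal I -> I a -> I (a * b).
Proof. by move=> hI ha; rewrite mulrC; apply: idealM. Qed.

Lemma idealN I a : ideal I -> I a -> I (- a).
Proof. by move=> hI ha; rewrite -mulN1r; apply: idealM. Qed.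

Lemma idealB I a b : ideal I -> I a -> I b -> I (a - b).
Proof. by move=> hI ha hb; apply: idealD => //; apply: idealN. Qed.

Lemma idealMn I a k : ideal I -> I a -> I (a *+ k).
Proof. by move=> hI ha; rewrite -mulr_natl; apply: idealM. Qed.

Lemma idealX I a k : ideal I -> I a -> I (a ^+ k.+1).
Proof. by move=> hI ha; rewrite exprS; apply: idealMr. Qed.

Lemma ideal_sum I (J : Type) (r : seq J) (p : pred J) (F : J -> A) :
  ideal I -> (forall i, p i -> I (F i)) -> I (\sum_(i <- r | p i) F i).
Proof.
by move=> hI hF; apply: big_ind => //; [apply: ideal0 | apply: idealD].
Qed.

Lemma idealBD I a b : ideal I -> I (a - b) -> I b -> I a.
Proof. by move=> hI hab hb; rewrite -[a](subrK b); apply: idealD. Qed.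

Lemma ideal_add_principal I u : ideal I ->
  ideal [set a | exists b, I (a - u * b)]%classic.
Proof.
move=> hI; split=> [|a b [x hx] [y hy]|a b [x hx]].
- by exists 0; rewrite mulr0 subr0; apply: ideal0.
- exists (x + y); have -> : a + b - u * (x + y) = (a - u * x) + (b - u * y).
    by ring_over A.
  exact: idealD.
- exists (a * x); have -> : a * b - u * (a * x) = a * (b - u * x) by ring_over A.
  exact: idealM.
Qed.

Lemma prime_exp P a k : prime_ideal P -> P (a ^+ k) -> P a.
Proof.
move=> hP; elim: k => [/(prime_ideal1 hP)//|k IH].
by rewrite exprS => /(prime_idealP hP)[].
Qed.

Lemma der0 d : derivation d -> d 0 = 0.
Proof. by move=> hd; apply: (addrI (d 0)); rewrite -(derD hd) !addr0. Qed.

Lemma derN d a : derivation d -> d (- a) = - d a.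
Proof.
by move=> hd; apply/eqP; rewrite -addr_eq0 -(derD hd) addNr der0.
Qed.

Lemma derB d a b : derivation d -> d (a - b) = d a - d b.
Proof. by move=> hd; rewrite (derD hd) derN. Qed.

Lemma der1 d : derivation d -> d 1 = 0.
Proof.
move=> hd; have := derM hd 1 1; rewrite !mul1r mulr1.
by move/(congr1 (fun z => z - d 1)); rewrite subrr addrK.
Qed.

Lemma derMn d a k : derivation d -> d (a *+ k) = d a *+ k.
Proof.
by move=> hd; elim: k => [|k IH]; rewrite ?mulr0n ?der0 // !mulrS (derD hd) IH.
Qed.

Lemma derX d a k : derivation d -> d (a ^+ k.+1) = a ^+ k * d a *+ k.+1.
Proof.
move=> hd; elim: k => [|k IH]; first by rewrite expr0 mul1r expr1.
by rewrite exprS (derM hd) IH mulrC mulrnAr mulrA -exprS [in RHS]mulrS.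
Qed.

Lemma der_sum d (J : Type) (r : seq J) (p : pred J) (F : J -> A) :
  derivation d -> d (\sum_(i <- r | p i) F i) = \sum_(i <- r | p i) d (F i).
Proof. by move=> hd; apply: (big_morph d (derD hd) (der0 hd)). Qed.

Lemma iter_derD d k a b :
  derivation d -> iter k d (a + b) = iter k d a + iter k d b.
Proof. by move=> hd; elim: k => //= k ->; rewrite (derD hd). Qed.

Lemma iter_derM d k a b : derivation d ->
  iter k d (a * b) = \sum_(i < k.+1) iter (k - i) d a * iter i d b *+ 'C(k, i).
Proof.
by move=> hd; apply: (@iter_leibniz _ _ _ *%R); [apply: derD | apply: derM].
Qed.

Hypothesis nat_inv : forall k, exists c : A, c * k.+1%:R = 1.

Lemma ideal_natM I a k : ideal I -> I (a *+ k.+1) -> I a.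
Proof.
move=> hI; have [c hc] := nat_inv k.
by move/(idealM hI c); rewrite -mulr_natl mulrA hc mul1r.
Qed.

(** For the least i and j with d^i a and d^j b outside P, the expansion of d^(i+j) (a b) has a
    single term that need not be in P, and its binomial coefficient is invertible. *)
Lemma prime_iter_der P d : derivation d -> prime_ideal P ->
  prime_ideal [set a | forall i, P (iter i d a)]%classic.
Proof.
move=> hd hP; have iP := prime_ideal_ideal hP; split.
- split=> /=.
  + by move=> i; have -> : iter i d 0 = 0;
      [elim: i => //= i ->; rewrite der0 | apply: ideal0].
  + by move=> a b ha hb i; rewrite iter_derD //; apply: idealD.
  + move=> a b hb i; rewrite iter_derM //; apply: ideal_sum => // j _.
    by apply: idealMn => //; apply: idealM.
- by move/(_ 0%N); apply: prime_ideal1.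
- move=> a b /= hab; apply: contrapT => /not_orP[].
  move=> /existsNP /cid[i0 hi0] /existsNP /cid[j0 hj0].
  have exi : exists i, `[< ~ P (iter i d a) >] by exists i0; apply/asboolP.
  have exj : exists i, `[< ~ P (iter i d b) >] by exists j0; apply/asboolP.
  case: (ex_minnP exi) => i /asboolP hi mini.
  case: (ex_minnP exj) => j /asboolP hj minj.
  have lti k : (k < i)%N -> P (iter k d a).
    move=> ki; apply: contrapT => /asboolP /mini; rewrite leqNgt ki //.
  have ltj k : (k < j)%N -> P (iter k d b).
    move=> kj; apply: contrapT => /asboolP /minj; rewrite leqNgt kj //.
  have hk : (j < (i + j).+1)%N by rewrite ltnS leq_addl.
  have := hab (i + j)%N; rewrite iter_derM // (bigD1 (Ordinal hk)) //=.
  set rest := \sum_(_ < _ | _) _ => h.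
  have hrest : P rest.
    apply: ideal_sum => // l hl; apply: idealMn => //.
    have [lj|lj] := ltnP l j; first by apply: idealM => //; apply: ltj.
    apply: idealMr => //; apply: lti.
    have lj' : (j < l)%N.
      rewrite ltn_neqAle lj andbT; apply: contra hl => /eqP e.
      by apply/eqP/val_inj.
    by have := ltn_ord l; lia.
  have := idealB iP h hrest; rewrite addrK.
  have -> : 'C(i + j, j) = 'C(i + j, j).-1.+1.
    by rewrite prednK // bin_gt0 leq_addl.
  by move/(ideal_natM iP); rewrite addnK => /(prime_idealP hP)[].
Qed.

(* A multiplicative set that is maximal among those avoiding I has a prime
   complement Q.  For a derivation d of D, the ideal {a | d^i a in Q for all i}
   is again prime, contains I and lies in Q, so it is Q by maximality. *)
Lemma stable_prime_avoiding D I S :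
  (forall d, D d -> derivation d) -> ideal I -> stable D I ->
  mult_closed S -> (forall a, S a -> ~ I a) ->
  exists Q, [/\ prime_ideal Q, stable D Q, (I `<=` Q)%classic
    & forall a, S a -> ~ Q a].
Proof.
move=> hD iI sI [S1 SM] SI.
(* The condition is put on the union with S because Zorn's lemma also asks for it at the union of
   the empty chain. *)
pose good X := mult_closed (X `|` S)%classic /\
  forall a, (X `|` S)%classic a -> ~ I a.
have [F Fgood Ftot|T [[[T1 TM] TI] Tmax]] := @Zorn_bigcup A good.
  split; first split; first by right.
    move=> a b [[X FX Xa]|Sa] [[Y FY Yb]|Sb]; last by right; apply: SM.
    - have [XY|YX] := Ftot _ _ FX FY.
        have [[_ YM] _] := Fgood _ FY.
        by case: (YM a b (or_introl (XY _ Xa)) (or_introl Yb)) => h;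
          [left; exists Y | right].
      have [[_ XM] _] := Fgood _ FX.
      by case: (XM a b (or_introl Xa) (or_introl (YX _ Yb))) => h;
        [left; exists X | right].
    - have [[_ XM] _] := Fgood _ FX.
      by case: (XM a b (or_introl Xa) (or_intror Sb)) => h;
        [left; exists X | right].
    - have [[_ XM] _] := Fgood _ FY.
      by case: (XM a b (or_intror Sa) (or_introl Yb)) => h;
        [left; exists Y | right].
  by move=> a [[X FX Xa]|]; [apply: (Fgood _ FX).2; left | apply: SI].
pose U := (T `|` S)%classic.
have Umax X : mult_closed X -> (U `<=` X)%classic -> (forall a, X a -> ~ I a) ->
    (X `<=` U)%classic.
  move=> [X1 XM] UX XI a Xa; apply: contrapT => Ua; apply: (Tmax X).
    split=> [b Tb|XT]; first by apply: UX; left.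
    by apply: Ua; left; apply: XT.
  have XS : (X `|` S)%classic = X.
    by apply/seteqP; split=> b; [case=> // Sb; apply: UX; right | left].
  by rewrite /good XS.
(* By maximality, adjoining an excluded [a] to [U] must run into [I]. This description of the
   complement is what makes it an ideal. *)
have UP a : ~ U a <-> exists2 s, U s & exists k, I (s * a ^+ k).
  split=> [Ua|[s Us [k Isa]] Ua].
    apply: contrapT => /forall2NP hs; apply: Ua.
    pose X := [set b | exists2 s, U s & exists k, b = s * a ^+ k]%classic.
    apply: (Umax X); last by exists 1 => //; exists 1%N; rewrite mul1r expr1.
    - split; first by exists 1 => //; exists 0%N; rewrite mul1r.
      move=> _ _ [s Us [k ->]] [t Ut [l ->]]; exists (s * t); first exact: TM.
      by exists (k + l)%N; rewrite exprD mulrACA.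
    - by move=> b Ub; exists b => //; exists 0%N; rewrite mulr1.
    - by move=> _ [s Us [k ->]] h; case: (hs s) => // /(_ (ex_intro _ k h)).
  apply: (TI _ _ Isa); apply: (TM) => //.
  by elim: k {Isa} => [|k IH]; rewrite ?expr0 // exprS; apply: TM.
pose Q := (~` U)%classic.
have iQ : ideal Q.
  split=> [|a b /UP[s Us [k ha]] /UP[t Ut [l hb]]|a b /UP[s Us [k hb]]]; apply/UP.
  - by exists 1 => //; exists 1%N; rewrite expr1 mulr0; apply: ideal0.
  - exists (s * t); first exact: TM.
    exists (k + l)%N; rewrite exprDn mulr_sumr; apply: ideal_sum => // i _.
    rewrite mulrnAr; apply: idealMn => //.
    have [il|li] := leqP i l.
      have e : (k + l - i = k + (l - i))%N by rewrite addnBA.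
      rewrite e exprD.
      have -> : s * t * (a ^+ k * a ^+ (l - i) * b ^+ i) =
        (t * a ^+ (l - i) * b ^+ i) * (s * a ^+ k) by ring_over A.
      exact: idealM.
    have -> : b ^+ i = b ^+ l * b ^+ (i - l) by rewrite -exprD subnKC // ltnW.
    have -> : s * t * (a ^+ (k + l - i) * (b ^+ l * b ^+ (i - l))) =
        (s * a ^+ (k + l - i) * b ^+ (i - l)) * (t * b ^+ l) by ring_over A.
    exact: idealM.
  - exists s => //; exists k; rewrite exprMn.
    have -> : s * (a ^+ k * b ^+ k) = a ^+ k * (s * b ^+ k) by ring_over A.
    exact: idealM.
have pQ : prime_ideal Q.
  split=> // a b Qab; apply: contrapT => /not_orP[/contrapT Ua /contrapT Ub].
  by apply: Qab; apply: (TM).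
have IQ : (I `<=` Q)%classic.
  by move=> a Ia; apply/UP; exists 1 => //; exists 1%N; rewrite mul1r expr1.
exists Q; split=> // [d Dd a Qa|a Sa h]; last by apply: h; right.
have pQd := prime_iter_der (hD d Dd) pQ.
set Qd := [set _ | _]%classic in pQd.
suff /(_ a Qa 1%N) : (Q `<=` Qd)%classic by [].
apply: subsetC2; rewrite /Q setCK.
apply: Umax.
- split; first exact: prime_ideal1 pQd.
  by move=> b c Xb Xc /(prime_idealP pQd)[].
- by move=> b Ub h; exact: (h 0%N Ub).
- move=> b h Ib; apply: h => i; apply: IQ.
  by elim: i => //= i IH; apply: (sI d Dd).
Qed.

End Ideals.

Section PoissonRings.
Variables (K : zmodType) (I : Type).

(* A Poisson bracket on T together with a family D of derivations of both
   structures, all of them killing the scalars iota c. *)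
Record poisson_ring (T : comNzRingType) (iota : K -> T) (br : T -> T -> T)
    (D : I -> T -> T) : Prop := PoissonRing {
  pr_derl : forall b, derivation (br^~ b);
  pr_der : forall a, derivation (br a);
  pr_alt : forall a, br a a = 0;
  pr_jacobi : forall a b c, br a (br b c) = br (br a b) c + br b (br a c);
  pr_const : forall a c, br a (iota c) = 0;
  pr_derD : forall i, derivation (D i);
  pr_constD : forall i c, D i (iota c) = 0;
  pr_brD : forall i a b, D i (br a b) = br (D i a) b + br a (D i b) }.

Definition ders (T : Type) (br : T -> T -> T) (D : I -> T -> T) : set (T -> T) :=
  [set d | (exists a, d = br a) \/ (exists i, d = D i)]%classic.

Variables (T : comNzRingType) (iota : K -> T) (br : T -> T -> T).
Variable (D : I -> T -> T).

Definition normal_mod (J : set T) u := forall a, exists b, J (br u a - u * b).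
Definition homog_mod (J : set T) u :=
  forall i, exists c, J (D i u - iota c * u).

Hypothesis hT : poisson_ring iota br D.

Lemma pr_anti a b : br a b = - br b a.
Proof.
have := pr_alt hT (a + b).
rewrite (derD (pr_derl hT _)) !(derD (pr_der hT _)) !(pr_alt hT) add0r addr0.
by move/eqP; rewrite addr_eq0 => /eqP.
Qed.

Lemma pr_constl a c : br (iota c) a = 0.
Proof. by rewrite pr_anti (pr_const hT) oppr0. Qed.

Lemma ders_derivation d : ders br D d -> derivation d.
Proof. by case=> [[a ->]|[i ->]]; [apply: pr_der hT _ | apply: pr_derD hT _]. Qed.

Lemma normal_modM J u v : ideal J -> normal_mod J u -> normal_mod J v ->
  normal_mod J (u * v).
Proof.
move=> hJ hu hv a; have [b hb] := hu a; have [c hc] := hv a.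
exists (b + c); rewrite (derM (pr_derl hT _)).
have -> : br u a * v + u * br v a - u * v * (b + c) =
  (br u a - u * b) * v + u * (br v a - v * c) by ring_over T.
by apply: idealD => //; [apply: idealMr | apply: idealM].
Qed.

Lemma homog_modM J u v : ideal J -> {morph iota : a b / a + b} ->
  homog_mod J u -> homog_mod J v -> homog_mod J (u * v).
Proof.
move=> hJ iD hu hv i; have [b hb] := hu i; have [c hc] := hv i.
exists (b + c); rewrite (derM (pr_derD hT i)) iD.
have -> : D i u * v + u * D i v - (iota b + iota c) * (u * v) =
  (D i u - iota b * u) * v + u * (D i v - iota c * v) by ring_over T.
by apply: idealD => //; [apply: idealMr | apply: idealM].
Qed.

End PoissonRings.

(** * Normal elements of Poisson polynomial rings *)

Section SkewNormal.
Variables (K : fieldType) (B : idomainType) (iota : {rmorphism K -> B}).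
Variables (br : B -> B -> B) (sg dl : B -> B) (lam : K).
Hypothesis natK : forall k, k.+1%:R != 0 :> K.
Hypothesis brl : forall b, derivation (br^~ b).
Hypothesis brr : forall a, derivation (br a).
Hypothesis br_const : forall c a, br (iota c) a = 0.
Hypothesis brxx : forall a, br a a = 0.
Hypothesis dsg : derivation sg.
Hypothesis ddl : derivation dl.
Hypothesis sg_const : forall c, sg (iota c) = 0.
Hypothesis dl_const : forall c, dl (iota c) = 0.
Hypothesis dl_br : forall a b,
  dl (br a b) = br (dl a) b + br a (dl b) + sg a * dl b - dl a * sg b.
Hypothesis sg_dl : forall a, sg (dl a) = dl (sg a) + iota lam * dl a.
Hypothesis lam0 : lam != 0.
Hypothesis dl_nil : forall a, exists e, iter e dl a = 0.

Lemma natB_neq0 k : k.+1%:R != 0 :> B.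
Proof. by rewrite -(rmorph_nat iota) fmorph_eq0. Qed.

Lemma brN a b : br a b = - br b a.
Proof.
have := brxx (a + b); rewrite (derD (brl _)) !(derD (brr _)) !brxx.
by rewrite add0r addr0 => /eqP; rewrite addr_eq0 => /eqP.
Qed.

Lemma der_const (d : B -> B) c a : derivation d -> d (iota c) = 0 ->
  d (iota c * a) = iota c * d a.
Proof. by move=> hd h; rewrite (derM hd) h mul0r add0r. Qed.

Variables (u : B) (tau : B -> B) (mu : K) (d : nat).
Hypothesis u0 : u != 0.
Hypothesis br_u : forall a, br u a = u * tau a.
Hypothesis sg_u : sg u = iota mu * u.
Let U j := iter j dl u.
Hypothesis Ud : U d != 0.
Hypothesis Ud1 : U d.+1 = 0.

Let m := iota mu.
Let l := iota lam.
Let li := iota lam^-1.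
Let lli : l * li = 1. Proof. by rewrite -rmorphM divff // rmorph1. Qed.

Let sgU j : sg (U j) = (m + l * j%:R) * U j.
Proof.
elim: j => [|j IH]; first by rewrite /= sg_u mulr0 addr0.
rewrite /U iterS -/(U j) sg_dl IH (derM ddl).
have -> : dl (m + l * j%:R) = 0.
  by rewrite -(rmorph_nat iota) -rmorphM -rmorphD dl_const.
rewrite mul0r add0r -natr1.
by rewrite -/l; ring_over B.
Qed.

Let U_gt j : (d < j)%N -> U j = 0.
Proof.
move=> dj; rewrite -(subnK dj) /U iterD -/(U d.+1) Ud1.
by elim: (_ - _)%N => //= k ->; rewrite der0.
Qed.

Lemma tauD : {morph tau : a b / a + b}.
Proof.
move=> a b; apply: (mulfI u0).
by rewrite mulrDr -!br_u (derD (brr u)).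
Qed.

Lemma tauM a b : tau (a * b) = tau a * b + a * tau b.
Proof.
apply: (mulfI u0); rewrite mulrDr mulrA mulrCA -!br_u.
by rewrite (derM (brr u)).
Qed.

Lemma tau_derivation : derivation tau.
Proof. by split; [apply: tauD | apply: tauM]. Qed.

(** The multiple mu / lam of sigma is chosen so that, as [delta, sigma] = - lam delta, its
    commutator with delta cancels the term sigma(u) delta(a) = mu u delta(a) coming from [dl_br]. *)
Let F a := tau a + m * li * sg a.
Let T i := iter i (fun G a => dl (G a) - G (dl a)) F.

Let F0 : F 0 = 0.
Proof. by rewrite /F (der0 tau_derivation) (der0 dsg) mulr0 addr0. Qed.

Let T0 i : T i 0 = 0.
Proof. by elim: i => //= i; rewrite -/(T i) (der0 ddl) => ->; rewrite (der0 ddl) subrr. Qed.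

(** Once the T_i vanish at [dl a] for i >= N, T_(N+n) a is just dl^n (T_N a), which local nilpotency
    kills for large n. *)
Let T_nil a : exists N, forall i, (N <= i)%N -> T i a = 0.
Proof.
have [e] := dl_nil a; elim: e a => [|e IH] a.
  by move=> /= ->; exists 0%N => i _; apply: T0.
rewrite iterSr => /IH[N hN].
have [k hk] := dl_nil (T N a).
exists (N + k)%N => i hi; rewrite -(subnK hi) addnCA addnC.
have {hi} : iter ((i - (N + k)) + k) dl (T N a) = 0.
  rewrite iterD hk; elim: (i - (N + k))%N => //= n ->; exact: der0.
set n := (i - (N + k) + k)%N => hn.
suff -> : T (n + N)%N a = iter n dl (T N a) by [].
elim: n {hn} => //= n hn.
by rewrite -/(T (n + N)%N) hn hN ?leq_addl // subr0.
Qed.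

(* H_0 = u F and H_(j+1) = [dl, H_j], so Leibniz expands H_j in the iterated
   commutators T_i = (ad dl)^i F.  As U_j = 0 for j > d, taking j = d + i shows
   T_i = 0 for i > 1, and taking j = d + 1 gives T_1 = d lam dl. *)
Let H j a := br (U j) a + (m * li - j%:R) * U j * sg a
             + (l * j%:R * j.-1%:R) * U j.-1 * dl a.

Let HS j a : H j.+1 a = dl (H j a) - H j (dl a).
Proof.
rewrite /H !(derD ddl) dl_br.
have dU i : dl (U i) = U i.+1 by [].
have dn k : dl k%:R = 0 by rewrite -(rmorph_nat iota) dl_const.
have dk c x y : dl c = 0 -> dl (c * x * y) = c * (dl x * y + x * dl y).
  by move=> h; rewrite !(derM ddl) h; ring_over B.
have h1 : dl (l * j%:R * j.-1%:R) = 0.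
  by rewrite -!(rmorph_nat iota) -!rmorphM dl_const.
have h2 : dl (m * li - j%:R) = 0.
  by rewrite (derB _ _ ddl) dn -rmorphM dl_const subrr.
rewrite !(dk _ _ _ h1) !(dk _ _ _ h2) !dU sgU sg_dl -/l.
have mE : m = m * li * l by rewrite -mulrA (mulrC li) lli mulr1.
have p0 : exists p, p = m * li by exists (m * li).
case: p0 => p pE; rewrite -pE in mE *; rewrite {}mE {pE}.
move: h1 h2 => _ _; case: j => [|j] /=; first by ring_over B.
by rewrite -!natr1; ring_over B.
Qed.

Let H0 a : H 0 a = u * F a.
Proof.
by rewrite /H /F /= br_u; ring_over B.
Qed.

Let H_leibniz j a : H j a = \sum_(i < j.+1) U (j - i) * T i a *+ 'C(j, i).
Proof.
elim: j a => [|j IH] a; first by rewrite big_ord1 H0.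
rewrite HS !IH (der_sum _ _ _ ddl) -sumrB.
rewrite -(pascal_sum (fun p q => U p * T q a)); apply: eq_bigr => i _.
rewrite (derMn _ _ ddl) (derM ddl) -mulrnBl; congr (_ *+ _).
rewrite /U /T !iterS -/(U _) -/(T i) mulrBr; ring_over B.
Qed.

Let T_ge2 i a : (1 < i)%N -> T i a = 0.
Proof.
have [N hN] := T_nil a; have [k hk] := ubnP (N - i)%N.
elim: k i hk => // k IH i hk i1.
have [Ni|iN] := leqP N i; first exact: hN.
have := H_leibniz (d + i) a.
(* [H] at j involves U_j and U_(j-1); the assumption i > 1 makes both vanish at j = d + i. *)
have -> : H (d + i) a = 0.
  by rewrite /H !U_gt; [rewrite (der0 (brl a)) !mulr0 !mul0r !addr0 | lia | lia].
have li' : (i < (d + i).+1)%N by lia.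
rewrite (bigD1 (Ordinal li')) //= big1 ?addr0 => [|j ji]; last first.
  have {}ji : (j : nat) <> i by move=> e; case/eqP: ji; apply: val_inj.
  have [lij|lji] := ltnP i j; last by rewrite U_gt ?mul0r ?mul0rn //; lia.
  by rewrite IH ?mulr0 ?mul0rn //; lia.
rewrite addnK -[_ *+ _]mulr_natr => /esym/eqP.
have -> : 'C(d + i, i) = 'C(d + i, i).-1.+1.
  by rewrite prednK // bin_gt0 leq_addl.
by rewrite !mulf_eq0 (negPf Ud) (negPf (natB_neq0 _)) orbF => /eqP.
Qed.

Let H_two j a : H j.+1 a = U j.+1 * F a + U j * T 1 a * j.+1%:R.
Proof.
rewrite H_leibniz big_ord_recl big_ord_recl big1 ?addr0 => [|i _]; last first.
  by rewrite T_ge2 ?mulr0 ?mul0rn.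
have -> : (lift ord0 (ord0 : 'I_j.+1) : nat) = 1%N by [].
by rewrite subSS subn0 bin1 -[_ *+ j.+1]mulr_natr.
Qed.

Let T1E a : T 1 a = l * d%:R * dl a.
Proof.
have := H_two d a; rewrite Ud1 mul0r add0r.
rewrite {1}/H Ud1 (der0 (brl a)) mulr0 mul0r !add0r [d.+1.-1]/=.
move=> h; apply: (mulfI Ud); apply: (mulIf (natB_neq0 d)).
by rewrite -h; ring_over B.
Qed.

(** The factor (j+1)(d-j) is the difference of d (j+1), contributed by T_1, and (j+1) j, from the
    correction term in [H]. *)
Lemma br_iter_normal j a : br (U j.+1) a =
  U j.+1 * (tau a + j.+1%:R * sg a) + l * (j.+1 * (d - j))%:R * U j * dl a.
Proof.
have [dj|jd] := ltnP d j.
  by rewrite !U_gt ?(der0 (brl a)) ?mulr0 ?mul0r ?addr0 //; lia.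
have := H_two j a; rewrite T1E {1}/H /F [j.+1.-1]/= -addrA => /(canRL (addrK _)).
by move=> ->; rewrite natrM natrB //; ring_over B.
Qed.

(* Rescaling the iterates dl^(d-i) u in this way makes them the coefficients of
   a normal element of B[X] with leading coefficient u. *)
Definition normal_weight j : K := (-1) ^+ j / (lam ^+ j * j`!%:R).

Definition normal_coef i : B :=
  if (i <= d)%N then iota (normal_weight (d - i)) * U (d - i) else 0.

Lemma normal_weightS j :
  normal_weight j.+1 * (j.+1%:R * lam) = - normal_weight j.
Proof.
have f0 k : k`!%:R != 0 :> K by rewrite -[k`!]prednK ?fact_gt0.
rewrite /normal_weight factS natrM !exprS.
have h1 := natK j; have h2 := f0 j.
have hl : lam ^+ j != 0 by rewrite expf_neq0.
have Pf0 : lam ^+ j * j`!%:R != 0 by rewrite mulf_neq0.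
have D0 : lam * lam ^+ j * (j.+1%:R * j`!%:R) != 0 by rewrite !mulf_neq0.
have <- : (lam * lam ^+ j * (j.+1%:R * j`!%:R))^-1 * (j.+1%:R * lam) =
          (lam ^+ j * j`!%:R)^-1.
  apply: (mulIf Pf0); rewrite [RHS]mulVf // -[RHS](mulVf D0).
  by ring_over K.
by ring_over K.
Qed.

Lemma normal_coef_top : normal_coef d = u.
Proof.
by rewrite /normal_coef leqnn subnn /normal_weight !expr0 !mul1r fact0 invr1 rmorph1 mul1r.
Qed.

Lemma normal_coef_gt i : (d < i)%N -> normal_coef i = 0.
Proof. by rewrite /normal_coef ltnNge => /negPf->. Qed.

Lemma normal_coef_below i : (i < d)%N ->
  normal_coef i * ((d - i)%:R * l) = - (iota (normal_weight (d - i).-1) * U (d - i)).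
Proof.
move=> id; rewrite /normal_coef ltnW //.
case E : (d - i)%N => [|j]; first by lia.
rewrite -mulNr -rmorphN [j.+1.-1]/= -normal_weightS.
move: (normal_weight _) => x; rewrite !rmorphM rmorph_nat -/l.
by ring_over B.
Qed.

Lemma dl_normal_coefS i :
  dl (normal_coef i.+1) = - ((d%:R - i%:R) * l * normal_coef i).
Proof.
have [di|id|<-] := ltngtP d i.
- by rewrite !normal_coef_gt ?(der0 ddl) ?mulr0 ?oppr0 //; lia.
- rewrite -natrB 1?ltnW // mulrC normal_coef_below // opprK.
  have -> : (d - i = (d - i.+1).+1)%N by lia.
  by rewrite /normal_coef id der_const.
- by rewrite normal_coef_gt // (der0 ddl) subrr !mul0r oppr0.
Qed.

Lemma dl_normal_coef0 : dl (normal_coef 0) = 0.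
Proof.
rewrite /normal_coef leq0n subn0 der_const //.
by have -> : dl (U d) = 0 by []; rewrite mulr0.
Qed.

(** Along with [dl_normal_coefS], this is normality of the polynomial with these coefficients, read
    degree by degree: the last term balances what the delta part of {X, a} brings down from degree i
    + 1. *)
Lemma br_normal_coef i a : br (normal_coef i) a =
  normal_coef i * (tau a + (d%:R - i%:R) * sg a)
  - i.+1%:R * normal_coef i.+1 * dl a.
Proof.
have [di|id|<-] := ltngtP d i.
- by rewrite !normal_coef_gt ?(der0 (brl a)) ?mulr0 ?mul0r ?subrr //; lia.
- rewrite -natrB 1?ltnW // [in LHS]/normal_coef ltnW //.
  rewrite (der_const _ (brl a)) //.
  have := normal_weightS (d - i.+1); rewrite /normal_coef (ltnW id) id.
  have -> : (d - i = (d - i.+1).+1)%N by lia.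
  have e : (d - (d - i.+1) = i.+1)%N by lia.
  move: (d - i.+1)%N e => j e; rewrite br_iter_normal e natrM.
  move: (normal_weight _) (normal_weight _) => x y /(congr1 iota).
  rewrite rmorphN !rmorphM rmorph_nat -/l => h.
  have -> : iota x = - (iota y * (j.+1%:R * l)) by rewrite h opprK.
  by ring_over B.
- by rewrite normal_coef_top normal_coef_gt // br_u; ring_over B.
Qed.

End SkewNormal.

Lemma poly_size_lead_sub (B : idomainType) (F G : {poly B}) N :
  size F = N.+1 -> size G = N.+1 -> lead_coef F = lead_coef G ->
  (size (F - G)%R <= N)%N.
Proof.
move=> sF sG; rewrite !lead_coefE sF sG /= => e.
apply/leq_sizeP => j; rewrite leq_eqVlt => /predU1P[<-|Nj].
  by rewrite coefB e subrr.
by rewrite coefB !nth_default ?subrr ?sF ?sG.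
Qed.

Lemma der_poly (B : comNzRingType) (Delta : {poly B} -> {poly B}) (d : B -> B) :
  derivation Delta -> (forall c, Delta c%:P = (d c)%:P) ->
  forall F, Delta F = map_poly d F + F^`() * Delta 'X.
Proof.
move=> hD hd.
have d0 : d 0 = 0 by apply: polyC_inj; rewrite -hd (der0 hD).
have dD a b : d (a + b) = d a + d b.
  by apply: polyC_inj; rewrite polyCD -!hd polyCD (derD hD).
elim/poly_ind => [|F c IH].
  by rewrite (der0 hD) deriv0 mul0r addr0 -[RHS]/(map_poly d 0) map_poly0.
rewrite (derD hD) (derM hD) IH hd derivD derivM derivX derivC.
have -> : map_poly d (F * 'X + c%:P) = map_poly d F * 'X + (d c)%:P.
  apply/polyP => i; rewrite coef_map_id0 // !coefD !coefMX !coefC dD coef_map_id0 //.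
  by case: i => [|i] /=; rewrite ?d0.
by ring_over {poly B}.
Qed.

(** The nilpotency index behaves like a degree: in every other Leibniz term one of the two factors
    has been differentiated beyond its index. *)
Lemma lnd_top (A : comNzRingType) (dl : A -> A) a b e f : derivation dl ->
  iter e.+1 dl a = 0 -> iter f.+1 dl b = 0 ->
  iter (e + f) dl (a * b) = iter e dl a * iter f dl b *+ 'C(e + f, f).
Proof.
move=> hd ha hb.
have gt0 x k j : iter k.+1 dl x = 0 -> (k < j)%N -> iter j dl x = 0.
  move=> h kj; rewrite -(subnK kj) iterD h.
  by elim: (_ - _)%N => //= i ->; rewrite (der0 hd).
have ff : (f < (e + f).+1)%N by lia.
rewrite iter_derM // (bigD1 (Ordinal ff)) //= addnK big1 ?addr0 // => j jf.
have {}jf : (j : nat) <> f by move=> h; case/eqP: jf; apply: val_inj.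
have [ltj|jlt] := ltnP f j; first by rewrite (gt0 b f) // mulr0 mul0rn.
by rewrite (gt0 a e) ?mul0r ?mul0rn //; lia.
Qed.

(** * Normal elements separating two stable primes of B[X] *)

Section SkewPoly.
Variables (K : fieldType) (I : Type) (B : idomainType).
Variables (iota : {rmorphism K -> B}).
Variables (Br : {poly B} -> {poly B} -> {poly B}).
Variables (D : I -> {poly B} -> {poly B}).
Variables (br : B -> B -> B) (dB : I -> B -> B) (dl : B -> B) (om : I -> K) (i0 : I).
Let sg := dB i0.
Let lam := om i0.
Hypothesis natK : forall k, k.+1%:R != 0 :> K.
Hypothesis hT : poisson_ring (fun c => (iota c)%:P) Br D.
Hypothesis BrC : forall a b, Br a%:P b%:P = (br a b)%:P.
Hypothesis DC : forall i a, D i a%:P = (dB i a)%:P.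
Hypothesis BrX : forall a, Br 'X a%:P = (sg a)%:P * 'X + (dl a)%:P.
Hypothesis DX : forall i, D i 'X = (iota (om i))%:P * 'X.
Hypothesis lam0 : lam != 0.
Hypothesis dl_nil : forall a, exists e, iter e dl a = 0.

Let natB k : k.+1%:R != 0 :> B.
Proof. by rewrite -(rmorph_nat iota) fmorph_eq0. Qed.

Let brl b : derivation (br^~ b).
Proof.
split=> [x y|x y]; apply: polyC_inj; rewrite -BrC ?(polyCD, polyCM) -?BrC.
  by rewrite (derD (pr_derl hT _)).
by rewrite (derM (pr_derl hT _)).
Qed.

Let brr a : derivation (br a).
Proof.
split=> [x y|x y]; apply: polyC_inj; rewrite -BrC ?(polyCD, polyCM) -?BrC.
  by rewrite (derD (pr_der hT _)).
by rewrite (derM (pr_der hT _)).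
Qed.

Let brxx a : br a a = 0.
Proof. by apply: polyC_inj; rewrite -BrC (pr_alt hT). Qed.

Let br_const c a : br (iota c) a = 0.
Proof. by apply: polyC_inj; rewrite -BrC (pr_constl hT). Qed.

Let ddB i : derivation (dB i).
Proof.
split=> [x y|x y]; apply: polyC_inj; rewrite -DC ?(polyCD, polyCM) -?DC.
  by rewrite (derD (pr_derD hT _)).
by rewrite (derM (pr_derD hT _)).
Qed.

Let dB_const i c : dB i (iota c) = 0.
Proof. by apply: polyC_inj; rewrite -DC (pr_constD hT). Qed.

Let linear_coef (a b c e : B) :
  a%:P * 'X + b%:P = c%:P * 'X + e%:P -> a = c /\ b = e.
Proof.
move=> h; split.
  by move: (congr1 (coefp 1) h); rewrite /= !coefD !coefMX !coefC /= !addr0.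
by move: (congr1 (coefp 0) h); rewrite /= !coefD !coefMX !coefC /= !add0r.
Qed.

Let dl_der : derivation dl.
Proof.
split=> [a b|a b].
  have := BrX (a + b); rewrite polyCD (derD (pr_der hT _)) !BrX.
  rewrite [X in X = _](_ : _ = (sg a + sg b)%:P * 'X + (dl a + dl b)%:P).
    by case/linear_coef.
  by rewrite !polyCD; ring_over {poly B}.
have := BrX (a * b); rewrite polyCM (derM (pr_der hT _)) !BrX.
rewrite [X in X = _](_ : _ = (sg a * b + a * sg b)%:P * 'X +
                             (dl a * b + a * dl b)%:P).
  by case/linear_coef.
by rewrite !polyCD !polyCM; ring_over {poly B}.
Qed.

Let dl_const c : dl (iota c) = 0.
Proof.
have := BrX (iota c); rewrite (pr_const hT).
rewrite [X in X = _](_ : _ = 0%:P * 'X + 0%:P); first by case/linear_coef.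
by rewrite polyC0 mul0r addr0.
Qed.

Let BrXl a : Br a%:P 'X = - ((sg a)%:P * 'X + (dl a)%:P).
Proof. by rewrite (pr_anti hT) BrX. Qed.

(** This axiom of Poisson sigma-derivations is the constant coefficient of the Jacobi identity for
    X, a, b. *)
Let dl_br a b :
  dl (br a b) = br (dl a) b + br a (dl b) + sg a * dl b - dl a * sg b.
Proof.
have := pr_jacobi hT 'X a%:P b%:P; rewrite BrC !BrX.
rewrite (derD (pr_derl hT _)) (derM (pr_derl hT _)) BrX.
rewrite (derD (pr_der hT _)) (derM (pr_der hT _)) BrXl !BrC.
rewrite [X in _ = X -> _](_ : _ = (br (sg a) b + br a (sg b))%:P * 'X +
  (br (dl a) b + br a (dl b) + sg a * dl b - dl a * sg b)%:P).
  by case/linear_coef.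
rewrite !(polyCD, polyCN, polyCM); ring_over {poly B}.
Qed.

Let dB_dl i a : dB i (dl a) = dl (dB i a) + iota (om i) * dl a.
Proof.
have := pr_brD hT i 'X a%:P; rewrite DX DC !BrX (derM (pr_derl hT _)).
rewrite (pr_constl hT) mul0r add0r !BrX (derD (pr_derD hT _)) (derM (pr_derD hT _)).
rewrite DX !DC => h.
have : (dB i (sg a) + iota (om i) * sg a)%:P * 'X + (dB i (dl a))%:P =
  (sg (dB i a) + iota (om i) * sg a)%:P * 'X + (dl (dB i a) + iota (om i) * dl a)%:P.
  rewrite !(polyCD, polyCM).
  apply: etrans (etrans h _); ring_over {poly B}.
by case/linear_coef.
Qed.

Let sg_dl a : sg (dl a) = dl (sg a) + iota lam * dl a.
Proof. exact: dB_dl. Qed.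

Lemma Br_const_coef F b j : (Br F b%:P)`_j =
  br F`_j b + F`_j * j%:R * sg b + F`_j.+1 * j.+1%:R * dl b.
Proof.
rewrite (@der_poly _ (Br^~ b%:P) (br^~ b)) ?BrX; [|exact: pr_derl hT _|by []].
rewrite coefD coef_map_id0 ?(der0 (brl b)) // mulrDr coefD mulrA coefMX.
rewrite !coefMC !coef_deriv addrA !mulr_natr.
by case: j => [|j] //=; rewrite mulr0n mul0r.
Qed.

Lemma D_coef i F j : (D i F)`_j = dB i F`_j + F`_j * j%:R * iota (om i).
Proof.
rewrite (@der_poly _ (D i) (dB i)) ?DX; [|exact: pr_derD hT _|by []].
rewrite coefD coef_map_id0 ?(der0 (ddB i)) // mulrA coefMX coefMC coef_deriv.
by case: j => [|j] //=; rewrite ?mulr0 ?mul0r // [in RHS]mulr_natr.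
Qed.

Lemma Br_X_coef F j : (Br 'X F)`_j =
  (if j is k.+1 then sg F`_k else 0) + dl F`_j.
Proof.
have sg0 : sg 0 = 0 := der0 (ddB i0).
have dl0 : dl 0 = 0 := der0 dl_der.
suff -> : Br 'X F = map_poly sg F * 'X + map_poly dl F.
  by rewrite coefD coefMX; case: j => [|j] /=; rewrite !coef_map_id0.
elim/poly_ind: F => [|F c IH].
  by rewrite (der0 (pr_der hT _)) !(@map_poly0 _ _) mul0r addr0.
rewrite (derD (pr_der hT _)) (derM (pr_der hT _)) IH (pr_alt hT) mulr0 addr0 BrX.
have mapE (d : B -> B) : derivation d ->
    map_poly d (F * 'X + c%:P) = map_poly d F * 'X + (d c)%:P.
  move=> hd; apply/polyP => i.
  rewrite coef_map_id0 ?der0 // !coefD !coefMX !coefC (derD hd).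
  by rewrite coef_map_id0 ?der0 //; case: i => /=; rewrite ?der0.
by rewrite (mapE sg (ddB i0)) (mapE dl dl_der); ring_over {poly B}.
Qed.

Lemma normal_mod_poly (J : set {poly B}) u : ideal J ->
  (forall b, exists G, J (Br u b%:P - u * G)) ->
  (exists G, J (Br u 'X - u * G)) -> normal_mod Br J u.
Proof.
move=> hJ hb [Gx hx]; elim/poly_ind => [|F c [G IH]].
  by exists 0; rewrite (der0 (pr_der hT _)) mulr0 subrr; apply: ideal0.
have [H hH] := hb c; exists (G * 'X + F * Gx + H).
rewrite (derD (pr_der hT _)) (derM (pr_der hT _)).
have -> : Br u F * 'X + F * Br u 'X + Br u c%:P - u * (G * 'X + F * Gx + H) =
  (Br u F - u * G) * 'X + F * (Br u 'X - u * Gx) + (Br u c%:P - u * H).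
  by ring_over {poly B}.
by apply: idealD => //; apply: idealD => //; [apply: idealMr | apply: idealM].
Qed.

(** Modulo J, u X is the constant -w, so a power of u turns any polynomial into a constant. For an
    element of J' that constant is in J', hence zero, and the power of u cancels. *)
Lemma linear_reduction (J J' : set {poly B}) u w :
  prime_ideal J -> ideal J' -> (J `<=` J')%classic ->
  (forall b, J' b%:P -> b = 0) -> ~ J u%:P -> J (u%:P * 'X + w%:P) ->
  (J' `<=` J)%classic.
Proof.
move=> pJ iJ' JJ' J'0 Ju JW; have iJ := prime_ideal_ideal pJ.
have red F : exists N c, J (u%:P ^+ N * F - c%:P).
  elim/poly_ind: F => [|F e [N [c IH]]].
    by exists 0%N, 0; rewrite mulr0 subrr; apply: ideal0.
  exists N.+1, (u ^+ N.+1 * e - w * c).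
  have -> : u%:P ^+ N.+1 * (F * 'X + e%:P) - (u ^+ N.+1 * e - w * c)%:P =
    u%:P * 'X * (u%:P ^+ N * F - c%:P) + c%:P * (u%:P * 'X + w%:P).
    rewrite polyCB !polyCM polyC_exp exprS; ring_over {poly B}.
  by apply: idealD => //; apply: idealM.
move=> F J'F; have [N [c hc]] := red F.
have /J'0 c0 : J' c%:P.
  have -> : c%:P = u%:P ^+ N * F - (u%:P ^+ N * F - c%:P) by ring_over {poly B}.
  by apply: idealB => //; [apply: idealM | apply: JJ'].
by move: hc; rewrite c0 subr0 => /(prime_idealP pJ)[/(prime_exp pJ)|].
Qed.

Section Normal.
Variables (u : B) (tau : B -> B) (w : I -> K) (d : nat).
Hypothesis u0 : u != 0.
Hypothesis br_u : forall a, br u a = u * tau a.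
Hypothesis dB_u : forall i, dB i u = iota (w i) * u.
Hypothesis Ud : iter d dl u != 0.
Hypothesis Ud1 : iter d.+1 dl u = 0.
Let mu := w i0.

Let dB_iter i j : dB i (iter j dl u) =
  (iota (w i) + j%:R * iota (om i)) * iter j dl u.
Proof.
elim: j => [|j IH]; first by rewrite /= dB_u; ring_over B.
rewrite iterS dB_dl IH (derM dl_der) -natr1.
have -> : dl (iota (w i) + j%:R * iota (om i)) = 0.
  by rewrite -(rmorph_nat iota) -rmorphM -rmorphD dl_const.
by ring_over B.
Qed.

Let v := normal_coef iota dl lam u d.

Let v_br j a : br (v j) a =
  v j * (tau a + (d%:R - j%:R) * sg a) - j.+1%:R * v j.+1 * dl a.
Proof.
exact: (br_normal_coef natK brl brr br_const (ddB i0) dl_der dl_const dl_br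
  sg_dl lam0 dl_nil u0 br_u (dB_u i0) Ud Ud1).
Qed.

Let v_dlS j : dl (v j.+1) = - ((d%:R - j%:R) * iota lam * v j).
Proof. exact: (dl_normal_coefS natK dl_der dl_const lam0 u0 Ud). Qed.

Let v_dl0 : dl (v 0) = 0.
Proof. exact: (dl_normal_coef0 _ dl_der dl_const Ud1). Qed.

Let v_dB i j : dB i (v j) = (iota (w i) + (d%:R - j%:R) * iota (om i)) * v j.
Proof.
rewrite /v /normal_coef; case: leqP => h; last by rewrite (der0 (ddB i)) mulr0.
rewrite (derM (ddB i)) dB_const dB_iter natrB //; ring_over B.
Qed.

Definition normal_poly : {poly B} := \poly_(i < d.+1) v i.
Let V := normal_poly.

Let V_coef j : V`_j = v j.
Proof.
rewrite coef_poly ltnS; case: leqP => // dj.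
by rewrite /v normal_coef_gt.
Qed.

Lemma Br_normal_poly a : Br V a%:P = V * (tau a + d%:R * sg a)%:P.
Proof.
apply/polyP => j; rewrite Br_const_coef coefMC !V_coef v_br.
by ring_over B.
Qed.

Lemma Br_X_normal_poly : Br 'X V = (iota mu)%:P * 'X * V.
Proof.
apply/polyP => j; rewrite Br_X_coef -mulrA coefCM coefXM !V_coef.
case: j => [|j] /=; first by rewrite v_dl0 addr0 mulr0.
by rewrite !V_coef /sg v_dB v_dlS -/mu -/lam; ring_over B.
Qed.

Lemma D_normal_poly i : D i V = (iota (w i) + d%:R * iota (om i))%:P * V.
Proof.
apply/polyP => j; rewrite D_coef coefCM !V_coef v_dB; ring_over B.
Qed.

Lemma size_normal_poly : size V = d.+1.
Proof. by rewrite size_poly_eq // /v normal_coef_top. Qed.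

Lemma lead_normal_poly : lead_coef V = u.
Proof. by rewrite lead_coefE size_normal_poly V_coef /v normal_coef_top. Qed.

Lemma normal_poly_normal J : ideal J -> normal_mod Br J V.
Proof.
move=> hJ; apply: normal_mod_poly => // [b|].
  exists (tau b + d%:R * sg b)%:P; rewrite Br_normal_poly subrr; exact: ideal0.
exists (- ((iota mu)%:P * 'X)); rewrite (pr_anti hT) Br_X_normal_poly.
rewrite (_ : _ - _ = 0); first exact: ideal0.
by ring_over {poly B}.
Qed.

Lemma normal_poly_homog J : ideal J -> homog_mod (fun c => (iota c)%:P) D J V.
Proof.
move=> hJ i; exists (w i + d%:R * om i).
rewrite D_normal_poly [iota (w i + _)]rmorphD [iota (_ * _)]rmorphM rmorph_nat subrr.
exact: ideal0.
Qed.

(* Polynomials on which the brackets {-, a} and the derivation D i0 act as on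
   u ^ p * y ^ q, where y would be a normal element of degree one. *)
Definition same_type p q (F : {poly B}) : Prop :=
  (forall a, Br F a%:P = F * (p%:R * tau a + q%:R * sg a)%:P) /\
  D i0 F = (p%:R * iota mu + q%:R * iota lam)%:P * F.

Lemma same_typeM p q p' q' F G : same_type p q F -> same_type p' q' G ->
  same_type (p + p') (q + q') (F * G).
Proof.
move=> [F1 F2] [G1 G2]; split=> [a|].
  by rewrite (derM (pr_derl hT _)) F1 G1 !natrD !(polyCD, polyCM); ring_over {poly B}.
by rewrite (derM (pr_derD hT _)) F2 G2 !natrD !(polyCD, polyCM); ring_over {poly B}.
Qed.

Lemma same_typeX p q F N : same_type p q F ->
  same_type (N * p) (N * q) (F ^+ N).
Proof.
move=> hF; elim: N => [|N IH]; last by rewrite exprS !mulSn; apply: same_typeM.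
rewrite expr0 !mul0n; split=> [a|].
  by rewrite (der1 (pr_derl hT _)) !mul0r addr0 mulr0.
by rewrite (der1 (pr_derD hT _)) !mul0r addr0 mul0r.
Qed.

Lemma same_typeB p q F G : same_type p q F -> same_type p q G ->
  same_type p q (F - G).
Proof.
move=> [F1 F2] [G1 G2]; split=> [a|].
  by rewrite (derB _ _ (pr_derl hT _)) F1 G1 mulrBl.
by rewrite (derB _ _ (pr_derD hT _)) F2 G2 mulrBr.
Qed.

Lemma same_type_u : same_type 1 0 u%:P.
Proof.
by split=> [a|]; rewrite ?BrC ?DC ?br_u ?dB_u -/mu -polyCM;
  congr _%:P; ring_over B.
Qed.

Lemma same_type_V : same_type 1 d V.
Proof.
by split=> [a|]; rewrite ?Br_normal_poly ?D_normal_poly mul1r.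
Qed.

(* The unknown leading coefficient r of G satisfies two incompatible
   eigenvalue equations, coming from {r, u} and {r, r}. *)
Lemma same_type_eq0 N G : same_type N N G -> (size G <= N)%N -> G = 0.
Proof.
move=> [G1 G2] sG; apply/eqP; apply: contraTT isT => G0.
set k := (size G).-1; set r := G`_k.
have sGk : size G = k.+1 by rewrite prednK // size_poly_gt0.
have r0 : r != 0 by rewrite /r /k -lead_coefE lead_coef_eq0.
have kN : (k < N)%N by rewrite -sGk.
have rS : G`_k.+1 = 0 by rewrite nth_default ?sGk.
have coef a : br r a + r * k%:R * sg a = r * (N%:R * tau a + N%:R * sg a).
  move: (congr1 (coefp k) (G1 a)); rewrite /= Br_const_coef coefMC -/r rS.
  by move=> <-; ring_over B.
have wt : sg r + r * k%:R * iota lam = (N%:R * iota mu + N%:R * iota lam) * r.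
  by move: (congr1 (coefp k) G2); rewrite /= D_coef coefCM.
have tu : tau u = 0 by apply: (mulfI u0); rewrite -br_u brxx mulr0.
have eu := coef u; have er := coef r.
have bru : br r u = - (u * tau r) by rewrite -br_u -(brN brl brr brxx).
rewrite brxx add0r in er; rewrite bru tu (dB_u i0 : sg u = iota mu * u) in eu.
have {}er : k%:R * sg r = N%:R * (tau r + sg r).
  apply: (mulfI r0); rewrite mulrA er; ring_over B.
have {}eu : tau r = (k%:R - N%:R) * iota mu * r.
  apply: (mulfI u0).
  have -> : u * tau r = - (- (u * tau r) + r * k%:R * (iota mu * u))
                        + r * k%:R * (iota mu * u) by ring_over B.
  by rewrite eu; ring_over B.
have sr : sg r = (N%:R * iota mu + (N%:R - k%:R) * iota lam) * r.
  by rewrite -[sg r](addrK (r * k%:R * iota lam)) wt; ring_over B.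
have NkE : N%:R - k%:R = (N - k).-1.+1%:R :> B by rewrite -natrB 1?ltnW // prednK ?subn_gt0.
have : (N%:R - k%:R) * ((N%:R - k%:R) * (iota lam * r)) = 0.
  have : k%:R * sg r - N%:R * (tau r + sg r) = 0 by rewrite er subrr.
  by rewrite eu sr => h; rewrite -[RHS]oppr0 -h; ring_over B.
move/eqP; rewrite NkE !mulf_eq0 (negPf (natB _)) (negPf r0) /= orbF.
by rewrite fmorph_eq0 (negPf lam0).
Qed.

Lemma same_type_eq N F G : same_type N N F -> same_type N N G ->
  size F = N.+1 -> size G = N.+1 -> lead_coef F = lead_coef G -> F = G.
Proof.
move=> hF hG sF sG e; apply/eqP; rewrite -subr_eq0; apply/eqP.
apply: (@same_type_eq0 N); first exact: same_typeB.
exact: poly_size_lead_sub.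
Qed.

Section Linear.
Hypothesis d0 : (0 < d)%N.

(** A d-th root of u^(d-1) V, where V is [normal_poly]: comparing the two highest coefficients
    forces the constant term v_(d-1) / d. *)
Definition normal_linear : {poly B} :=
  u%:P * 'X + (iota d%:R^-1 * v d.-1)%:P.
Let W := normal_linear.

Let dd : iota d%:R^-1 * d%:R = 1.
Proof.
rewrite -(rmorph_nat iota) -rmorphM mulVf ?rmorph1 //.
by case: d d0.
Qed.

Let sizeW : size W = 2%N.
Proof. by rewrite /W /normal_linear size_MXaddC polyC_eq0 (negPf u0) size_polyC u0. Qed.

Let leadW : lead_coef W = u.
Proof.
by rewrite lead_coefE sizeW /W /normal_linear coefD coefMX !coefC /= addr0.
Qed.

Let vd : v d = u. Proof. by rewrite /v normal_coef_top. Qed.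

Lemma same_type_W : same_type 1 1 W.
Proof.
have vE : (d.-1.+1 = d) by rewrite prednK.
have natd : d%:R - d.-1%:R = 1 :> B by rewrite -[X in X%:R - _]vE -natr1; ring_over B.
have v1 a : br (v d.-1) a = v d.-1 * (tau a + sg a) - d%:R * u * dl a.
  by rewrite v_br natd vE vd mul1r.
have v2 : dB i0 (v d.-1) = (iota mu + iota lam) * v d.-1.
  by rewrite v_dB natd mul1r.
split=> [a|].
  rewrite /W /normal_linear (derD (pr_derl hT _)) (derM (pr_derl hT _)) !BrC BrX.
  rewrite br_u (derM (brl a)) br_const v1.
  have e : iota d%:R^-1 * (d%:R * u * dl a) = u * dl a by rewrite !mulrA dd mul1r.
  rewrite mulrBr e !mul1r mul0r add0r !(polyCD, polyCM, polyCN, polyCB).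
  by ring_over {poly B}.
rewrite /W /normal_linear (derD (pr_derD hT _)) (derM (pr_derD hT _)) !DC DX.
rewrite (derM (ddB i0)) dB_const v2 dB_u -/mu -/lam.
by rewrite mul0r add0r !mul1r !(polyCD, polyCM); ring_over {poly B}.
Qed.

(** Both sides have type (d, d), degree d and leading coefficient u^d, so [same_type_eq] applies.
    Consequently a prime containing V contains W, of degree one in X. *)
Lemma normal_poly_linear : u%:P ^+ d.-1 * V = W ^+ d.
Proof.
apply: (@same_type_eq d).
- have := same_typeM (same_typeX d.-1 same_type_u) same_type_V.
  by rewrite muln1 muln0 add0n addn1 prednK.
- by have := same_typeX d same_type_W; rewrite muln1.
- rewrite -polyC_exp size_Cmul ?expf_neq0 //; exact: size_normal_poly.
- by rewrite -[LHS]prednK ?size_poly_gt0 ?expf_neq0 -?size_poly_gt0 ?sizeW // size_exp sizeW mul1n.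
- rewrite lead_coefM lead_coef_exp lead_coef_exp lead_coefC leadW.
  by rewrite lead_normal_poly -exprSr prednK.
Qed.

End Linear.

Lemma normal_poly_in (J : set {poly B}) : prime_ideal J ->
  (forall b, J b%:P -> b = 0) -> J V ->
  (0 < d)%N /\ J normal_linear.
Proof.
move=> pJ J0 JV; have d0 : (0 < d)%N.
  rewrite lt0n; apply/eqP => d0; move: (size_normal_poly) => sV.
  have VE : V = u%:P.
    rewrite [LHS]size1_polyC; last by rewrite /V sV d0.
    by rewrite V_coef /v -[in LHS]d0 normal_coef_top.
  by move: u0; rewrite (J0 u) ?eqxx // -VE.
split=> //; apply: (@prime_exp _ _ _ d) => //.
by rewrite -normal_poly_linear //; apply: idealM (prime_ideal_ideal pJ) _ _ JV.
Qed.

(** As delta(u) = - lam v_(d-1), and W in J makes v_(d-1) congruent to - d u X, the bracket {X, u} =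
    mu u X + delta(u) is a multiple of u modulo J. *)
Lemma u_normal_mod (J : set {poly B}) : prime_ideal J -> (0 < d)%N ->
  J normal_linear -> normal_mod Br J u%:P.
Proof.
move=> pJ d0 JW; have iJ := prime_ideal_ideal pJ.
apply: normal_mod_poly => // [b|].
  exists (tau b)%:P; rewrite BrC br_u polyCM subrr; exact: ideal0.
exists (- (iota mu + d%:R * iota lam)%:P * 'X); rewrite BrXl (dB_u i0 : sg u = _).
have -> : dl u = - (d%:R * iota lam * (iota d%:R^-1 * v d.-1)).
  have := v_dlS d.-1; rewrite prednK // /v normal_coef_top -/v => ->.
  have -> : d%:R - d.-1%:R = 1 :> B.
    by rewrite -[X in X%:R - _](prednK d0) -natr1; ring_over B.
  have dd : iota d%:R^-1 * d%:R = 1.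
    by rewrite -(rmorph_nat iota) -rmorphM mulVf ?rmorph1 //; case: (d) d0.
  have -> : d%:R * iota lam * (iota d%:R^-1 * v d.-1) =
    (iota d%:R^-1 * d%:R) * iota lam * v d.-1 by ring_over B.
  by rewrite dd mul1r.
have -> : - ((iota mu * u)%:P * 'X
     + (- (d%:R * iota lam * (iota d%:R^-1 * v d.-1)))%:P)
     - u%:P * (- (iota mu + d%:R * iota lam)%:P * 'X) =
     (d%:R * iota lam)%:P * normal_linear.
  rewrite /normal_linear !(polyCD, polyCN, polyCM); ring_over {poly B}.
by apply: idealM.
Qed.

End Normal.

Hypothesis normal_exists : forall S : set B, ideal S ->
  stable (ders br dB) S -> (exists2 a, S a & a != 0) ->
  exists u, [/\ S u, u != 0, (forall a, exists b, br u a = u * b)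
    & forall i, exists c, dB i u = iota c * u].

Lemma nilpotency_index u : u != 0 ->
  exists d, iter d dl u != 0 /\ iter d.+1 dl u = 0.
Proof.
move=> u0; have ex : exists e, iter e dl u == 0.
  by have [e he] := dl_nil u; exists e; apply/eqP.
case: (ex_minnP ex) => [[|e] /eqP he mine]; first by move: u0; rewrite -[u]/(iter 0 dl u) he eqxx.
exists e; split=> //; apply/negP => /mine; rewrite ltnn //.
Qed.

Variables J J' : set {poly B}.
Hypothesis pJ : prime_ideal J.
Hypothesis pJ' : prime_ideal J'.
Hypothesis sJ : stable (ders Br D) J.
Hypothesis sJ' : stable (ders Br D) J'.
Hypothesis JJ' : (J `<=` J')%classic.
Hypothesis J'J : ~ (J' `<=` J)%classic.
(** Arranged in [poly_normal_separation] by dividing the coefficient ring by its intersection with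
    J. *)
Hypothesis J0 : forall b, J b%:P -> b = 0.

Let iJ := prime_ideal_ideal pJ.
Let iJ' := prime_ideal_ideal pJ'.

Let J'br a F : J' F -> J' (Br a F).
Proof. by apply: sJ'; left; exists a. Qed.

Let J'D i F : J' F -> J' (D i F).
Proof. by apply: sJ'; right; exists i. Qed.

Let goal := exists u, [/\ J' u, ~ J u, normal_mod Br J u
  & homog_mod (fun c => (iota c)%:P) D J u].

Let normal_data u : u != 0 -> (forall a, exists b, br u a = u * b) ->
  (forall i, exists c, dB i u = iota c * u) ->
  exists tau w d, [/\ forall a, br u a = u * tau a,
     forall i, dB i u = iota (w i) * u, iter d dl u != 0 & iter d.+1 dl u = 0].
Proof.
move=> u0 /choice[tau htau] /choice[w hw]; have [d [h1 h2]] := nilpotency_index u0.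
by exists tau, w, d.
Qed.

(** The trace of J' on B is a nonzero stable ideal, also closed under delta. So it contains a
    homogeneous normal [u] with all its iterates, and J' contains the normal polynomial V. If V is
    in J, so is W, and [u] itself is normal modulo J. *)
Lemma skew_step_meet b : J' b%:P -> b != 0 -> goal.
Proof.
move=> J'b b0; pose S := [set a | J' a%:P]%classic.
have iS : ideal S.
  split=> [|x y hx hy|x y hy]; rewrite /S /= ?polyC0 ?polyCD ?polyCM.
  - exact: ideal0.
  - exact: idealD.
  - exact: idealM.
have Sdl x : S x -> S (dl x).
  move=> hx; rewrite /S /=.
  have -> : (dl x)%:P = Br 'X x%:P - D i0 x%:P * 'X.
    by rewrite BrX DC -/sg; ring_over {poly B}.
  by apply: idealB => //; [apply: J'br | apply: (idealMr _ iJ'); apply: J'D].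
have sS : stable (ders br dB) S.
  move=> _ [[x ->]|[i ->]] y hy; rewrite /S /=.
    by rewrite -BrC; apply: J'br.
  by rewrite -DC; apply: J'D.
have [u [Su u0 brb hb]] := normal_exists iS sS (ex_intro2 _ _ b J'b b0).
have [tau [w [d [br_u dB_u Ud Ud1]]]] := normal_data u0 brb hb.
have [JV|nJV] := pselect (J (normal_poly u d)).
  have [d0 JW] := normal_poly_in u0 br_u dB_u Ud Ud1 pJ J0 JV.
  exists u%:P; split=> //.
  - by move/J0/eqP; rewrite (negPf u0).
  - exact: (u_normal_mod u0 br_u dB_u Ud pJ d0 JW).
  - move=> i; exists (w i); rewrite DC dB_u polyCM subrr; exact: ideal0.
exists (normal_poly u d); split=> //.
- rewrite /normal_poly poly_def; apply: ideal_sum => // i _.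
  rewrite -mul_polyC; apply: (idealMr _ iJ').
  rewrite /normal_coef; case: ifP => _; last by rewrite polyC0; apply: ideal0 iJ'.
  rewrite polyCM; apply: (idealM iJ'); rewrite -/(S _).
  by elim: (d - i)%N => //= k; apply: Sdl.
- exact: (normal_poly_normal u0 br_u dB_u Ud Ud1).
- by apply: normal_poly_homog.
Qed.

(* Let F = u X^m + ... have least degree in J'.  Elements of the same type with
   the same leading term coincide.  If d > 0 this gives u^(dm-m) V^m = u^(dm-d) F^d,
   so the normal polynomial V is in J'.  If d = 0, the constant coefficients of
   {X, F} force dl = 0, and then F is proportional to X^m. *)
Lemma skew_step_no_meet : (forall b, J' b%:P -> b = 0) -> goal.
Proof.
move=> J'0.
have JX : ~ J 'X.
  move=> hX; apply: J'J; apply: (linear_reduction (u := 1) (w := 0)) => //.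
    by move/J0/eqP; rewrite oner_eq0.
  by rewrite polyC0 polyC1 mul1r addr0.
have [J'X|J'X] := pselect (J' 'X).
  have dl0 b : dl b = 0.
    apply: J'0; have -> : (dl b)%:P = Br 'X b%:P - (sg b)%:P * 'X.
      by rewrite BrX; ring_over {poly B}.
    apply: idealB => //; last exact: idealM.
    rewrite (pr_anti hT); apply: idealN => //; exact: J'br.
  exists 'X; split=> //.
    apply: normal_mod_poly => // [b|].
      exists (sg b)%:P; rewrite BrX dl0 polyC0 addr0 mulrC subrr.
      exact: ideal0.
    exists 0; rewrite (pr_alt hT) mulr0 subrr; exact: ideal0.
  by move=> i; exists (om i); rewrite DX subrr; apply: ideal0.
have exm : exists m, `[< exists F, [/\ J' F, F != 0 & (size F <= m.+1)%N] >].
  have /existsNP[F /not_implyP[J'F JF]] := J'J.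
  exists (size F); apply/asboolP; exists F; split=> //.
  by apply/eqP => F0; apply: JF; rewrite F0; apply: ideal0.
case: (ex_minnP exm) => m /asboolP[F1 [J'F1 F10 sF1]] minm.
have minF (F : {poly B}) : J' F -> (size F <= m)%N -> F = 0.
  move=> J'F sF; apply/eqP; apply: contraT => F0.
  case: m sF minm {sF1 F1 J'F1 F10} => [|k] sF minm.
    by move: sF; rewrite leqn0 size_poly_eq0 (negPf F0).
  suff /minm : `[< exists F, [/\ J' F, F != 0 & (size F <= k.+1)%N] >].
    by rewrite ltnn.
  by apply/asboolP; exists F.
(* The leading coefficients in the minimal degree m form a stable ideal: {F, x} has coefficient br q
   x + m q sg x in that degree, and D i changes it similarly. *)
pose S := [set q | exists2 F, J' F & (size F <= m.+1)%N /\ F`_m = q]%classic.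
have iS : ideal S.
  split=> [|_ _ [F hF [sF <-]] [G hG [sG <-]]|x _ [F hF [sF <-]]].
  - by exists 0; [apply: ideal0 | rewrite size_poly0 coef0].
  - exists (F + G); first exact: idealD.
    by rewrite coefD (leq_trans (size_polyD _ _)) // geq_max sF.
  - exists (x%:P * F); first exact: idealM.
    rewrite coefCM; split=> //.
    by rewrite mul_polyC (leq_trans (size_scale_leq _ _)).
have sizeD i (F : {poly B}) : (size F <= m.+1)%N -> (size (D i F) <= m.+1)%N.
  move=> sF; apply/leq_sizeP => j mj; rewrite D_coef nth_default ?(leq_trans sF) //.
  by rewrite (der0 (ddB i)) !mul0r addr0.
have sizeBr b (F : {poly B}) : (size F <= m.+1)%N -> (size (Br F b%:P) <= m.+1)%N.
  move=> sF; apply/leq_sizeP => j mj.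
  have e k : (m < k)%N -> F`_k = 0 by move=> h; rewrite nth_default ?(leq_trans sF).
  by rewrite Br_const_coef (e j mj) (e j.+1 (leqW mj)) (der0 (brl b)) !mul0r !addr0.
have sS : stable (ders br dB) S.
  have SD i q : S q -> S (dB i q).
    move=> [F hF [sF <-]].
    exists (D i F - (m%:R * iota (om i))%:P * F).
      by apply: idealB => //; [apply: J'D | apply: idealM].
    split; last by rewrite coefB coefCM D_coef; ring_over B.
    rewrite (leq_trans (size_polyD _ _)) // geq_max sizeD //= size_polyN.
    by rewrite mul_polyC (leq_trans (size_scale_leq _ _)).
  move=> _ [[x ->]|[i ->]] q Sq; last exact: SD.
  have [F hF [sF Fq]] := Sq.
  have : S (- (br q x + q * m%:R * sg x)).
    apply: idealN => //; exists (Br F x%:P).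
      by rewrite (pr_anti hT); apply: idealN => //; apply: J'br.
    split; first exact: sizeBr.
    by rewrite Br_const_coef Fq (nth_default 0 sF) !mul0r addr0.
  rewrite opprD -(brN brl brr brxx) => h.
  apply: (idealBD iS (b := q * m%:R * sg x)); last by rewrite -mulrA; apply: idealMr.
  exact: h.
have [|u [Su u0 brb hb]] := normal_exists iS sS.
  exists F1`_m; first by exists F1.
  have sF1m : size F1 = m.+1.
    apply/eqP; rewrite eqn_leq sF1 ltnNge; apply/negP => /minF F1E.
    by move: F10; rewrite F1E ?eqxx.
  by rewrite -[m]/(m.+1.-1) -sF1m -lead_coefE lead_coef_eq0.
have [tau [w [d [br_u dB_u Ud Ud1]]]] := normal_data u0 brb hb.
have [F J'F [sF Fm]] := Su.
have Fm1 : F`_m.+1 = 0 by rewrite nth_default.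
have size_drop (G : {poly B}) : (size G <= m.+1)%N -> G`_m = 0 -> (size G <= m)%N.
  move=> /leq_sizeP hG Gm; apply/leq_sizeP => j.
  by rewrite leq_eqVlt => /predU1P[<-//|]; apply: hG.
(* Both sides of each equation agree in degree m, so their difference is an element of J' of smaller
   degree, hence zero. *)
have F_type : same_type tau w 1 m F.
  split=> [a|]; apply/eqP; rewrite -subr_eq0; apply/eqP; apply: minF.
  - apply: idealB => //; last exact: idealMr.
    by rewrite (pr_anti hT); apply: idealN => //; apply: J'br.
  - apply: size_drop.
      rewrite (leq_trans (size_polyD _ _)) // geq_max sizeBr //= size_polyN.
      by rewrite mulrC mul_polyC (leq_trans (size_scale_leq _ _)).
    by rewrite coefB coefMC Br_const_coef Fm Fm1 br_u; ring_over B.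
  - by apply: idealB => //; [apply: J'D | apply: idealM].
  - apply: size_drop.
      rewrite (leq_trans (size_polyD _ _)) // geq_max sizeD //= size_polyN.
      by rewrite mul_polyC (leq_trans (size_scale_leq _ _)).
    by rewrite coefB coefCM D_coef Fm dB_u -/lam; ring_over B.
have J'u : ~ J' u%:P by move/J'0/eqP; rewrite (negPf u0).
have m0 : (0 < m)%N.
  rewrite lt0n; apply/eqP => m0; apply: J'u.
  by rewrite -Fm m0 -size1_polyC // -m0.
have sizeF : size F = m.+1.
  apply/eqP; rewrite eqn_leq sF ltnNge; apply/negP => /minF F0.
  by move: u0; rewrite -Fm F0 ?coef0 ?eqxx.
have leadF : lead_coef F = u by rewrite lead_coefE sizeF.
have sizeuX N (G : {poly B}) k : size G = k.+1 -> size (u%:P ^+ N * G) = k.+1.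
  by move=> sG; rewrite -polyC_exp size_Cmul ?expf_neq0.
have lead_u N : lead_coef (u%:P ^+ N) = u ^+ N by rewrite lead_coef_exp lead_coefC.
have size_exp1 (G : {poly B}) N k : size G = k.+1 -> size (G ^+ N) = (k * N).+1.
  move=> sG; rewrite -[LHS]prednK ?size_exp ?sG //.
  by rewrite size_poly_gt0 expf_neq0 // -size_poly_gt0 sG.
have Ju : ~ J u%:P by move/J0/eqP; rewrite (negPf u0).
have type_u := same_type_u br_u dB_u.
have [d0|d0] := posnP d; last first.
  have lem : (m <= d * m)%N by rewrite leq_pmull.
  have led : (d <= d * m)%N by rewrite leq_pmulr.
  (* The powers of u bring both sides to type (dm, dm), degree dm and leading coefficient u^(dm). *)
  have VF : u%:P ^+ (d * m - m) * normal_poly u d ^+ m = u%:P ^+ (d * m - d) * F ^+ d.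
    apply: (same_type_eq u0 br_u dB_u (N := (d * m)%N)).
    - have type_V := same_type_V u0 br_u dB_u Ud Ud1.
      have := same_typeM (same_typeX (d * m - m) type_u) (same_typeX m type_V).
      by rewrite !muln1 muln0 add0n subnK // [(m * d)%N]mulnC.
    - have := same_typeM (same_typeX (d * m - d) type_u) (same_typeX d F_type).
      by rewrite !muln1 muln0 add0n subnK.
    - by apply: sizeuX; apply: size_exp1; apply: size_normal_poly.
    - by rewrite mulnC; apply: sizeuX; apply: size_exp1.
    - rewrite !lead_coefM !lead_u !(lead_coef_exp _ m) !(lead_coef_exp _ d).
      by rewrite leadF lead_normal_poly // -!exprD !subnK.
  exists (normal_poly u d); split.
  - have : J' (u%:P ^+ (d * m - m) * normal_poly u d ^+ m).
      rewrite VF; apply: idealM => //.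
      by case: (d) d0 => // k _; apply: idealX.
    by case/(prime_idealP pJ') => /(prime_exp pJ').
  - move=> JV; have [_ JW] := normal_poly_in u0 br_u dB_u Ud Ud1 pJ J0 JV.
    exact: J'J (linear_reduction pJ iJ' JJ' J'0 Ju JW).
  - exact: normal_poly_normal.
  - exact: normal_poly_homog.
exfalso; move: Ud1; rewrite d0 /= => dlu.
have F00 : F`_0 != 0.
  apply/eqP => F00; have /factor_theorem[G FG] : root F 0.
    by rewrite /root horner_coef0 F00.
  rewrite subr0 in FG; have G0 : G != 0.
    by apply/eqP => G0; move: sizeF; rewrite FG G0 mul0r size_poly0.
  have : J' (G * 'X) by rewrite -FG.
  case/(prime_idealP pJ') => // /minF GE; case/eqP: (G0); apply: GE.
  by move: sizeF; rewrite FG size_mulX // => -[->].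
have mE : m = m.-1.+1 by rewrite prednK.
set p := F`_m.-1.
have sp : sg p = (iota (w i0) + iota lam) * p.
  have := congr1 (coefp m.-1) F_type.2; rewrite /= D_coef coefCM -/p -/lam.
  have -> : m%:R = m.-1%:R + 1 :> B by rewrite natr1 prednK.
  move=> h; rewrite -[LHS](addrK (p * m.-1%:R * iota lam)) h; ring_over B.
have dl0 : dl 0 = 0 := der0 dl_der.
have sg0 : sg 0 = 0 := der0 (ddB i0).
(* {X, F} - mu X F has degree at most m, with coefficient lam p there. So u times it minus lam p F
   is in J' with degree below m and vanishes; the identity is its constant coefficient. *)
have key : u * dl F`_0 = iota lam * p * F`_0.
  pose G := u%:P * (Br 'X F - (iota (w i0))%:P * 'X * F) - (iota lam * p)%:P * F.
  have G0 : G = 0.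
    apply: minF.
      apply: idealB; [by []| |exact: idealM]; apply: idealM => //.
      by apply: idealB => //; [apply: J'br | apply: idealM].
    apply/leq_sizeP => j mj; rewrite /G coefB !coefCM coefB -mulrA coefCM coefXM.
    rewrite Br_X_coef; case: j mj => [|j] mj /=; first by rewrite leqn0 in mj; rewrite mE in mj.
    have [jm|jm|jm] := ltngtP j.+1 m; first by rewrite leqNgt jm in mj.
      have Fj k : (m < k)%N -> F`_k = 0 by move=> h; rewrite nth_default // sizeF.
      have [jm'|<-] : (m < j)%N \/ m = j by lia.
        by rewrite (Fj j jm') (Fj j.+1 (leqW jm')) dl0 sg0; ring_over B.
      rewrite Fm Fm1 dl0 (dB_u i0 : sg u = _); ring_over B.
    have jE : j = m.-1 by rewrite -jm.
    by rewrite jm jE Fm -/p dlu sp; ring_over B.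
  have := congr1 (coefp 0) G0; rewrite /= /G coefB !coefCM coefB -mulrA coefCM coefXM /= coef0.
  rewrite Br_X_coef /= => /eqP; rewrite subr_eq0 => /eqP <-; ring_over B.
have p0 : p = 0.
  apply/eqP; apply: contraT => p0.
  have [e [pe pe1]] := nilpotency_index p0.
  have [f [Ff Ff1]] := nilpotency_index F00.
  have iu k x : iter k dl (u * x) = u * iter k dl x.
    by elim: k => //= k ->; rewrite (derM dl_der) dlu mul0r add0r.
  have il k x : iter k dl (iota lam * x) = iota lam * iter k dl x.
    by elim: k => //= k ->; rewrite (derM dl_der) dl_const mul0r add0r.
  have : iter (e + f) dl (u * dl F`_0) = 0.
    rewrite iu -iterSr -addnS iterD Ff1.
    have -> : iter e dl 0 = 0 by elim: e {pe pe1} => //= k ->.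
    by rewrite mulr0.
  rewrite key -mulrA il (lnd_top dl_der pe1 Ff1) => /eqP.
  have -> : 'C(e + f, f) = 'C(e + f, f).-1.+1 by rewrite prednK // bin_gt0 leq_addl.
  rewrite -[_ *+ _]mulr_natr !mulf_eq0 (negPf pe) (negPf Ff) (negPf (natB _)).
  by rewrite fmorph_eq0 (negPf lam0).
(* With p = 0, degree m - 1 of the equation for {F, b} reads m u delta(b) = 0. *)
have dlz b : dl b = 0.
  have := congr1 (coefp m.-1) (F_type.1 b).
  rewrite /= Br_const_coef coefMC -/p p0 !mul0r (der0 (brl b)) !add0r -mE Fm.
  by move/eqP; rewrite !mulf_eq0 (negPf u0) mE (negPf (natB _)) => /eqP.
have type_X : same_type tau w 0 1 'X.
  split=> [b|]; first by rewrite BrX dlz polyC0 addr0 mul0r add0r mul1r mulrC.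
  by rewrite DX mul0r add0r mul1r.
have FX : u%:P ^+ m.-1 * F = u%:P ^+ m * 'X ^+ m.
  apply: (same_type_eq u0 br_u dB_u (N := m)).
  - have := same_typeM (same_typeX m.-1 type_u) F_type.
    by rewrite muln1 muln0 add0n addn1 -mE.
  - have := same_typeM (same_typeX m type_u) (same_typeX m type_X).
    by rewrite !muln1 !muln0 addn0 add0n.
  - exact: sizeuX.
  - by apply: sizeuX; rewrite size_polyXn.
  - by rewrite !lead_coefM !lead_u leadF lead_coefXn mulr1 -exprSr -mE.
have := congr1 (coefp 0) FX.
rewrite /= -!polyC_exp !coefCM coefXn eq_sym (negPf (lt0n_neq0 m0)) mulr0 => /eqP.
by rewrite mulf_eq0 (negPf F00) expf_eq0 (negPf u0) andbF.
Qed.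

Theorem skew_step : goal.
Proof.
have [J'0|/existsNP[b /not_implyP[J'b /eqP b0]]] :=
  pselect (forall b, J' b%:P -> b = 0); first exact: skew_step_no_meet.
exact: skew_step_meet J'b b0.
Qed.

End SkewPoly.

(** * Residue domains and Poisson structures on quotients *)

Section QuotientDomain.
Variables (A : comNzRingType) (P : set A).
Hypothesis pP : prime_ideal P.

Definition prime_pred : pred A := fun a => `[< P a >].

Lemma prime_pred_idealr : idealr_closed prime_pred.
Proof.
have iP := prime_ideal_ideal pP; split.
- by apply/asboolP; apply: ideal0.
- by apply/asboolP; apply: prime_ideal1.
- move=> a u v /asboolP Pu /asboolP Pv; apply/asboolP.
  by apply: idealD => //; apply: idealM.
Qed.

Lemma prime_pred_prime : prime_idealr_closed prime_pred.
Proof.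
move=> u v /asboolP /(prime_idealP pP)[h|h]; apply/orP; [left|right]; exact/asboolP.
Qed.

HB.instance Definition _ := isIdealr.Build A prime_pred prime_pred_idealr.
HB.instance Definition _ := isPrimeIdealrClosed.Build A prime_pred prime_pred_prime.

Definition prime_idl : prime_idealr A := prime_pred.

Definition prime_quot : Type := {ideal_quot prime_idl}.
HB.instance Definition _ := GRing.ComNzRing.on prime_quot.

Let unitq : pred prime_quot := fun x => `[< exists y, y * x = 1 >].
Let invq (x : prime_quot) : prime_quot :=
  if pselect (exists y, y * x = 1) is left h then projT1 (cid h) else x.

Let mulVq : {in unitq, left_inverse 1 invq *%R}.
Proof.
move=> x /asboolP h; rewrite /invq; case: pselect => // h'.
exact: (projT2 (cid h')).
Qed.

Let unitqP x y : y * x = 1 -> unitq x.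
Proof. by move=> h; apply/asboolP; exists y. Qed.

Let invq_out : {in [predC unitq], invq =1 id}.
Proof.
by move=> x /asboolP h; rewrite /invq; case: pselect.
Qed.

HB.instance Definition _ := GRing.ComNzRing_hasMulInverse.Build prime_quot
  mulVq unitqP invq_out.

Let quot_domain (x y : prime_quot) : x * y = 0 -> (x == 0) || (y == 0).
Proof. exact: (@Quotient.rquot_IdomainAxiom A prime_idl). Qed.

HB.instance Definition _ := GRing.ComUnitRing_isIntegral.Build prime_quot quot_domain.

Lemma quotient_domain_exists : exists (B : idomainType) (pi : {rmorphism A -> B}),
  (forall b, exists a, pi a = b) /\ (forall a, pi a = 0 <-> P a).
Proof.
pose pi : {rmorphism A -> {ideal_quot prime_idl}} := \pi_({ideal_quot prime_idl})%qT.
exists (prime_quot : idomainType), pi.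
split=> [b|a]; first by exists (repr b); exact: reprK.
have -> : pi a = 0 <-> a - 0 \in (prime_idl : pred A).
  rewrite -[0 in X in X <-> _](rmorph0 pi) Quotient.idealrBE.
  by split=> [/eqP|/eqP].
by rewrite subr0; split=> /asboolP.
Qed.
End QuotientDomain.

Lemma quotient_field_exists (A : comNzRingType) (P : set A) : prime_ideal P ->
  exists (Om : fieldType) (phi : {rmorphism A -> Om}), forall a, phi a = 0 <-> P a.
Proof.
move=> /quotient_domain_exists[B [pi [_ hpi]]].
exists {fraction B}, (@FracField.tofrac B \o pi : {rmorphism A -> {fraction B}}).
move=> a /=; rewrite -hpi; split=> [/eqP|->]; last exact: rmorph0.
by rewrite tofrac_eq0 => /eqP.
Qed.

Lemma ker_ideal (R S : comNzRingType) (pi : {rmorphism R -> S}) :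
  ideal [set a | pi a = 0]%classic.
Proof.
split=> [|a b /= ha hb|a b /= hb]; rewrite /= ?rmorph0 //.
- by rewrite rmorphD ha hb addr0.
- by rewrite rmorphM hb mulr0.
Qed.

Lemma poisson_descend (K : zmodType) (I : Type) (R S : comNzRingType)
    (pi : {rmorphism R -> S}) (iota : K -> R) br (D : I -> R -> R) :
  (forall b, exists a, pi a = b) -> poisson_ring iota br D ->
  stable (ders br D) [set a | pi a = 0]%classic ->
  exists brS DS, [/\ forall a b, brS (pi a) (pi b) = pi (br a b),
    forall i a, DS i (pi a) = pi (D i a) & poisson_ring (pi \o iota) brS DS].
Proof.
move=> /choice[s sK] hT st.
have kbr a b b' : pi b = pi b' -> pi (br a b) = pi (br a b').
  move=> h; apply/eqP; rewrite -subr_eq0 -rmorphB -(derB _ _ (pr_der hT a)); apply/eqP.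
  apply: (st (br a)); first by left; exists a.
  by rewrite /= rmorphB h subrr.
have kbl a b b' : pi b = pi b' -> pi (br b a) = pi (br b' a).
  by by move=> h; rewrite (pr_anti hT b) (pr_anti hT b') !rmorphN (kbr _ _ _ h).
have kD i b b' : pi b = pi b' -> pi (D i b) = pi (D i b').
  move=> h; apply/eqP; rewrite -subr_eq0 -rmorphB -(derB _ _ (pr_derD hT i)); apply/eqP.
  apply: (st (D i)); first by right; exists i.
  by rewrite /= rmorphB h subrr.
pose brS x y := pi (br (s x) (s y)); pose DS i x := pi (D i (s x)).
have brE a b : brS (pi a) (pi b) = pi (br a b).
  by rewrite /brS (kbr _ _ b) ?sK // (kbl _ _ a) ?sK.
have DE i a : DS i (pi a) = pi (D i a) by rewrite /DS (kD _ _ a) ?sK.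
exists brS, DS; split=> //; split=> [y|x|x|x y z|x c|i|i c|i x y].
- split=> [x x'|x x'] /=; rewrite -(sK x) -(sK x') -(sK y).
    by rewrite -rmorphD !brE (derD (pr_derl hT _)) rmorphD.
  by rewrite -rmorphM !brE (derM (pr_derl hT _)) rmorphD !rmorphM.
- split=> [y y'|y y'] /=; rewrite -(sK x) -(sK y) -(sK y').
    by rewrite -rmorphD !brE (derD (pr_der hT _)) rmorphD.
  by rewrite -rmorphM !brE (derM (pr_der hT _)) rmorphD !rmorphM.
- by rewrite -(sK x) brE (pr_alt hT) rmorph0.
- by rewrite -(sK x) -(sK y) -(sK z) !brE (pr_jacobi hT) rmorphD.
- by rewrite -(sK x) /= brE (pr_const hT) rmorph0.
- split=> [x y|x y] /=; rewrite -(sK x) -(sK y).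
    by rewrite -rmorphD !DE (derD (pr_derD hT _)) rmorphD.
  by rewrite -rmorphM !DE (derM (pr_derD hT _)) rmorphD !rmorphM.
- by rewrite /= DE (pr_constD hT) rmorph0.
- by rewrite -(sK x) -(sK y) !(brE, DE) (pr_brD hT) rmorphD.
Qed.

Definition normal_separation (K : zmodType) (I : Type) (T : comNzRingType)
    (iota : K -> T) br (D : I -> T -> T) :=
  forall J J' : set T, prime_ideal J -> prime_ideal J' ->
  stable (ders br D) J -> stable (ders br D) J' ->
  (J `<=` J')%classic -> ~ (J' `<=` J)%classic ->
  exists u, [/\ J' u, ~ J u, normal_mod br J u & homog_mod iota D J u].

(* Otherwise a stable prime of the quotient containing S and avoiding the
   multiplicative set of homogeneous normal elements would pull back to a
   counterexample to normal separation. *)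
Lemma normal_in_stable_ideal (K : fieldType) (I : Type) (A : comNzRingType)
    (B : idomainType) (iota : {rmorphism K -> A}) (pi : {rmorphism A -> B})
    br (D : I -> A -> A) brB dB (S : set B) :
  (forall k, k.+1%:R != 0 :> K) ->
  (forall b, exists a, pi a = b) -> poisson_ring iota br D ->
  stable (ders br D) [set a | pi a = 0]%classic ->
  (forall a b, brB (pi a) (pi b) = pi (br a b)) ->
  (forall i a, dB i (pi a) = pi (D i a)) ->
  poisson_ring (pi \o iota) brB dB ->
  normal_separation iota br D ->
  ideal S -> stable (ders brB dB) S -> (exists2 a, S a & a != 0) ->
  exists u, [/\ S u, u != 0, (forall a, exists b, brB u a = u * b)
    & forall i, exists c, dB i u = pi (iota c) * u].
Proof.
move=> natK surj hT st brE DE hB NS iS sS [a0 Sa0 a00].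
apply: contrapT => noS.
pose N := [set u | [/\ u != 0, normal_mod brB [set 0]%classic u
  & homog_mod (pi \o iota) dB [set 0]%classic u]]%classic.
have i0 : ideal ([set 0]%classic : set B).
  by split=> // [a b -> ->|a b ->]; rewrite /= ?addr0 ?mulr0.
have NM : mult_closed N.
  split; first split; first exact: oner_neq0.
  - by move=> a; exists 0; rewrite /= (der1 (pr_derl hB a)) mulr0 subrr.
  - move=> i; exists 0; rewrite /= (der1 (pr_derD hB i)).
    by rewrite !rmorph0 mul0r subrr.
  move=> u v [u0 nu hu] [v0 nv hv]; split; first by rewrite mulf_neq0.
  - exact: (normal_modM hB).
  - by apply: (homog_modM hB) => // x y; rewrite /= !rmorphD.
have disj u : N u -> ~ S u.
  move=> [u0 nu hu] Su; apply: noS; exists u; split=> //.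
  - by move=> a; have [b /= /eqP] := nu a; rewrite subr_eq0 => /eqP; exists b.
  - by move=> i; have [b /= /eqP] := hu i; rewrite subr_eq0 => /eqP; exists b.
have natB k : exists c : B, c * k.+1%:R = 1.
  exists (pi (iota k.+1%:R^-1)).
  by rewrite -(rmorph_nat pi) -(rmorph_nat iota) -!rmorphM mulVf // !rmorph1.
have [Q [pQ sQ SQ QN]] :=
  stable_prime_avoiding natB (@ders_derivation _ _ _ _ _ _ hB) iS sS NM disj.
have [||||||u [/= Qu u0 nu hu]] :=
  NS [set a | pi a = 0]%classic [set a | Q (pi a)]%classic.
- split; first exact: ker_ideal.
    by rewrite /= rmorph1; apply/eqP; apply: oner_neq0.
  move=> a b /= /eqP; rewrite rmorphM mulf_eq0 => /orP[/eqP|/eqP]; by [left|right].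
- have iQ := prime_ideal_ideal pQ; split.
  + split=> [|a b|a b] /=; rewrite ?rmorph0 ?rmorphD ?rmorphM.
    * exact: ideal0.
    * exact: idealD.
    * exact: idealM.
  + by rewrite /= rmorph1; apply: prime_ideal1.
  + by move=> a b /=; rewrite rmorphM; apply: prime_idealP.
- exact: st.
- move=> _ [[x ->]|[i ->]] a /= Qa; rewrite -?brE -?DE.
    by apply: (sQ (brB (pi x))) => //; left; exists (pi x).
  by apply: (sQ (dB i)) => //; right; exists i.
- by move=> a /= ->; apply: ideal0 (prime_ideal_ideal pQ).
- have [a1 a1E] := surj a0; move=> /(_ a1) /=; rewrite a1E => /(_ (SQ _ Sa0)) /eqP.
  by rewrite (negPf a00).
apply: (QN (pi u)) => //; split; first exact/eqP.
- move=> b; have [a <-] := surj b; have [c /= hc] := nu a.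
  by exists (pi c); rewrite /= brE -rmorphM -rmorphB.
- move=> i; have [c /= hc] := hu i; exists c.
  by rewrite /= DE -rmorphM -rmorphB.
Qed.

Lemma poly_coef_expansion (A : comNzRingType) (F : {poly A}) :
  F = \sum_(i < size F) (F`_i)%:P * 'X^i.
Proof.
rewrite -[LHS]coefK poly_def; apply: eq_bigr => i _; exact/esym/mul_polyC.
Qed.

(** The trace P of J on A is a stable prime, and the kernel of A[X] -> (A/P)[X] lies in J. So J and
    J' can be replaced by their images, J meeting the coefficients in zero, and
    [normal_in_stable_ideal] turns separation in A into the elements that [skew_step] asks for. *)
Theorem poly_normal_separation (K : fieldType) (I : Type) (A : comNzRingType)
    (iota : {rmorphism K -> A}) br (D : I -> A -> A)
    (Br : {poly A} -> {poly A} -> {poly A}) (DD : I -> {poly A} -> {poly A})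
    (dl : A -> A) (om : I -> K) (i0 : I) :
  (forall k, k.+1%:R != 0 :> K) ->
  poisson_ring iota br D -> poisson_ring (fun c => (iota c)%:P) Br DD ->
  (forall a b, Br a%:P b%:P = (br a b)%:P) ->
  (forall i a, DD i a%:P = (D i a)%:P) ->
  (forall a, Br 'X a%:P = (D i0 a)%:P * 'X + (dl a)%:P) ->
  (forall i, DD i 'X = (iota (om i))%:P * 'X) ->
  om i0 != 0 -> (forall a, exists e, iter e dl a = 0) ->
  normal_separation iota br D ->
  normal_separation (fun c => (iota c)%:P) Br DD.
Proof.
move=> natK hA hT BrC DC BrX DX om0 dl_nil NS J J' pJ pJ' sJ sJ' JJ' J'J.
have iJ := prime_ideal_ideal pJ; have iJ' := prime_ideal_ideal pJ'.
pose P := [set a | J a%:P]%classic.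
have pP : prime_ideal P.
  split; first split.
  - by rewrite /P /= polyC0; apply: ideal0.
  - by move=> a b; rewrite /P /= polyCD; apply: idealD.
  - by move=> a b; rewrite /P /= polyCM; apply: idealM.
  - by rewrite /P /= polyC1; apply: prime_ideal1.
  - by move=> a b; rewrite /P /= polyCM; apply: prime_idealP.
have PD i a : P a -> P (D i a).
  by rewrite /P /= -DC => h; apply: (sJ (DD i)) => //; right; exists i.
have Pbr a b : P b -> P (br a b).
  by rewrite /P /= -BrC => h; apply: (sJ (Br a%:P)) => //; left; exists a%:P.
have Pdl a : P a -> P (dl a).
  move=> Pa; rewrite /P /=.
  have -> : (dl a)%:P = Br 'X a%:P - (D i0 a)%:P * 'X by rewrite BrX; ring_over {poly A}.
  apply: idealB => //; last by apply: idealMr => //; apply: PD.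
  by apply: (sJ (Br 'X)) => //; left; exists 'X.
have [B [pi [surj hpi]]] := quotient_domain_exists pP.
have kerP : [set a | pi a = 0]%classic = P by apply/seteqP; split=> a /hpi.
have stP : stable (ders br D) [set a | pi a = 0]%classic.
  by rewrite kerP => _ [[a ->]|[i ->]] b; [apply: Pbr | apply: PD].
have [brB [dB [brBE dBE hB]]] := poisson_descend surj hA stP.
pose Pi : {rmorphism {poly A} -> {poly B}} := map_poly pi.
have PiC a : Pi a%:P = (pi a)%:P by exact: map_polyC.
have PiX : Pi 'X = 'X by exact: map_polyX.
have Pisurj F : exists G, Pi G = F.
  elim/poly_ind: F => [|F c [G GF]]; first by exists 0; rewrite rmorph0.
  have [a ac] := surj c; exists (G * 'X + a%:P).
  by rewrite rmorphD rmorphM PiC PiX GF ac.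
have kerPi F : Pi F = 0 <-> forall i, P F`_i.
  split=> [h i|h]; last by apply/polyP => i; rewrite coef_map coef0; apply/hpi.
  by apply/hpi; rewrite -coef_map -[map_poly _ _]/(Pi F) h coef0.
have kerJ F : Pi F = 0 -> J F.
  move=> /kerPi h; rewrite [F]poly_coef_expansion; apply: ideal_sum => // i _.
  by apply: idealMr => //; apply: h.
have kI := ker_ideal Pi.
have kconst a : P a -> Pi a%:P = 0 by move=> /hpi h; rewrite PiC h polyC0.
have kder (Delta : {poly A} -> {poly A}) : derivation Delta ->
    (forall a, P a -> Pi (Delta a%:P) = 0) -> forall F, Pi F = 0 -> Pi (Delta F) = 0.
  move=> hD hP F /kerPi hF; rewrite [F]poly_coef_expansion (der_sum _ _ _ hD).
  rewrite rmorph_sum big1 // => i _; rewrite (derM hD) rmorphD !rmorphM.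
  by rewrite (hP _ (hF i)) (kconst _ (hF i)) !mul0r addr0.
have stPi : stable (ders Br DD) [set F | Pi F = 0]%classic.
  move=> _ [[G ->]|[i ->]]; last first.
    by apply: kder => [|a Pa]; [apply: pr_derD hT i | rewrite DC; apply/kconst/PD].
  apply: kder => [|a Pa]; first exact: pr_der hT G.
  elim/poly_ind: G => [|G c IH].
    by rewrite (der0 (pr_derl hT _)) rmorph0.
  rewrite (derD (pr_derl hT _)) (derM (pr_derl hT _)) !rmorphD !rmorphM IH.
  rewrite BrC BrX rmorphD rmorphM (kconst _ (PD _ _ Pa)) (kconst _ (Pdl _ Pa)).
  by rewrite (kconst _ (Pbr _ _ Pa)) !mul0r !addr0 mulr0 addr0.
have [BrT [DT [BrTE DTE hTT]]] := poisson_descend Pisurj hT stPi.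
have dl_ker a b : pi a = pi b -> pi (dl a) = pi (dl b).
  move=> h; apply/eqP; rewrite -subr_eq0 -rmorphB; apply/eqP.
  have -> : dl a - dl b = dl (a - b).
    apply: polyC_inj; have := BrX (a - b); rewrite polyCB (derB _ _ (pr_der hT _)) !BrX.
    rewrite (derB _ _ (pr_derD hA i0)) polyCB => e.
    have -> : (dl (a - b))%:P = ((D i0 a)%:P - (D i0 b)%:P) * 'X + (dl (a - b))%:P -
      ((D i0 a)%:P - (D i0 b)%:P) * 'X by ring_over {poly A}.
    by rewrite -e polyCB; ring_over {poly A}.
  by apply/hpi/Pdl/hpi; rewrite rmorphB h subrr.
have [s sK] : exists s, forall b, pi (s b) = b.
  by have /choice[s hs] := surj; exists s.
pose dlB b := pi (dl (s b)).
have dlBE a : dlB (pi a) = pi (dl a) by apply: dl_ker; rewrite sK.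
pose im (S : set {poly A}) := [set F | exists2 G, S G & Pi G = F]%classic.
have imP S G : ideal S -> (J `<=` S)%classic -> im S (Pi G) -> S G.
  move=> iS JS [H SH HG]; apply: (idealBD iS (b := H)) => //.
  by apply: JS; apply: kerJ; rewrite rmorphB HG subrr.
have im_ideal S : ideal S -> ideal (im S).
  move=> iS; split=> [|_ _ [F hF <-] [G hG <-]|a _ [G hG <-]].
  - by exists 0; [apply: ideal0 | rewrite rmorph0].
  - by exists (F + G); [apply: idealD | rewrite rmorphD].
  - have [F <-] := Pisurj a.
    by exists (F * G); [apply: idealM | rewrite rmorphM].
have im_prime S : prime_ideal S -> (J `<=` S)%classic -> prime_ideal (im S).
  move=> pS JS; have iS := prime_ideal_ideal pS; split; first exact: im_ideal.
    by rewrite -(rmorph1 Pi) => /(imP _ _ iS JS); apply: prime_ideal1.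
  move=> F G; have [F' <-] := Pisurj F; have [G' <-] := Pisurj G.
  rewrite -rmorphM => /(imP _ _ iS JS) /(prime_idealP pS)[h|h].
    by left; exists F'.
  by right; exists G'.
have im_stable S : stable (ders Br DD) S -> stable (ders BrT DT) (im S).
  move=> sS _ [[F ->]|[i ->]] _ [G SG <-].
    have [F' <-] := Pisurj F; rewrite BrTE; exists (Br F' G) => //.
    by apply: (sS (Br F')) => //; left; exists F'.
  by rewrite DTE; exists (DD i G) => //; apply: (sS (DD i)) => //; right; exists i.
pose iotaB : {rmorphism K -> B} := pi \o iota.
have hTB : poisson_ring (fun c => (iotaB c)%:P) BrT DT.
  suff -> : (fun c => (iotaB c)%:P) = Pi \o (fun c => (iota c)%:P) by [].
  by apply: funext => c; rewrite /= PiC.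
have [|||||||||U [[F J'F FU] JU nU hU]] := @skew_step K I B iotaB BrT DT brB dB dlB om i0
  natK hTB _ _ _ _ om0 _ _ (im J) (im J') (im_prime _ pJ (@subset_refl _ J))
  (im_prime _ pJ' JJ') (im_stable _ sJ').
- by move=> a b; have [a' <-] := surj a; have [b' <-] := surj b;
    rewrite -!PiC BrTE BrC PiC -brBE.
- by move=> i a; have [a' <-] := surj a; rewrite -!PiC DTE DC PiC -dBE.
- move=> a; have [a' <-] := surj a; rewrite -PiC -PiX BrTE BrX rmorphD rmorphM !PiC PiX.
  by rewrite dBE dlBE.
- by move=> i; rewrite -PiX DTE DX rmorphM PiC.
- move=> b; have [a <-] := surj b; have [e he] := dl_nil a; exists e.
  have -> : iter e dlB (pi a) = pi (iter e dl a).
    by elim: e {he} => //= e ->; rewrite dlBE.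
  by rewrite he rmorph0.
- by move=> S iS sS; apply: (normal_in_stable_ideal natK surj hA stP).
- by move=> _ [G /JJ' J'G <-]; exists G.
- move=> h; apply: J'J => G J'G; apply: (imP _ _ iJ (@subset_refl _ J)).
  by apply: h; exists G.
- move=> b; have [a <-] := surj b; rewrite -PiC => /(imP _ _ iJ (@subset_refl _ J)) Ja.
  exact/hpi.
exists F; split=> //.
- by move=> JF; apply: JU; exists F.
- move=> G; have [H] := nU (Pi G); have [H' <-] := Pisurj H.
  rewrite -FU BrTE -rmorphM -rmorphB => /(imP _ _ iJ (@subset_refl _ J)).
  by exists H'.
- move=> i; have [c] := hU i; rewrite -FU DTE => h; exists c.
  apply: (imP _ _ iJ (@subset_refl _ J)).
  by rewrite rmorphB rmorphM PiC.
Qed.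

(** * Normal separation for Poisson nilpotent algebras *)

Lemma poisson_restrict (K : zmodType) (I : Type) (R S : comNzRingType)
    (j : {rmorphism R -> S}) (iotaR : K -> R) (iota : K -> S) br (D : I -> S -> S) :
  injective j -> (forall c, j (iotaR c) = iota c) ->
  (forall a b, exists c, j c = br (j a) (j b)) ->
  (forall i a, exists c, j c = D i (j a)) ->
  poisson_ring iota br D ->
  exists brR DR, [/\ forall a b, j (brR a b) = br (j a) (j b),
    forall i a, j (DR i a) = D i (j a) & poisson_ring iotaR brR DR].
Proof.
move=> jI jc cbr cD hS.
have /choice[brR brE] : forall ab : R * R, exists c, j c = br (j ab.1) (j ab.2).
  by move=> ab; apply: cbr.
have /choice[DR DE] : forall ia : I * R, exists c, j c = D ia.1 (j ia.2).
  by move=> ab; apply: cD.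
have {}brE a b : j (brR (a, b)) = br (j a) (j b) := brE (a, b).
have {}DE i a : j (DR (i, a)) = D i (j a) := DE (i, a).
exists (fun a b => brR (a, b)), (fun i a => DR (i, a)).
split=> //; split=> [y|x|x|x y z|x c|i|i c|i x y].
- split=> [x x'|x x']; apply: jI; rewrite ?rmorphD ?rmorphM ?brE ?rmorphD ?rmorphM.
    exact: (derD (pr_derl hS _)).
  exact: (derM (pr_derl hS _)).
- split=> [y y'|y y']; apply: jI; rewrite ?rmorphD ?rmorphM ?brE ?rmorphD ?rmorphM.
    exact: (derD (pr_der hS _)).
  exact: (derM (pr_der hS _)).
- by apply: jI; rewrite brE (pr_alt hS) rmorph0.
- by apply: jI; rewrite rmorphD !brE (pr_jacobi hS).
- by apply: jI; rewrite brE jc (pr_const hS) rmorph0.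
- split=> [x y|x y]; apply: jI; rewrite ?rmorphD ?rmorphM ?DE ?rmorphD ?rmorphM.
    exact: (derD (pr_derD hS _)).
  exact: (derM (pr_derD hS _)).
- by apply: jI; rewrite DE jc (pr_constD hS) rmorph0.
- by apply: jI; rewrite rmorphD !(brE, DE) (pr_brD hS).
Qed.

Lemma prime_preimage (R S : comNzRingType) (j : {rmorphism R -> S}) (P : set S) :
  prime_ideal P -> prime_ideal [set a | P (j a)]%classic.
Proof.
move=> pP; have iP := prime_ideal_ideal pP; split.
- split=> [|a b|a b] /=; rewrite ?rmorph0 ?rmorphD ?rmorphM.
  + exact: ideal0.
  + exact: idealD.
  + exact: idealM.
- by rewrite /= rmorph1; apply: prime_ideal1.
- by move=> a b /=; rewrite rmorphM; apply: prime_idealP.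
Qed.

Lemma normal_separation_iso (K : zmodType) (I : Type) (R S : comNzRingType)
    (j : {rmorphism R -> S}) (iotaR : K -> R) (iota : K -> S) br (D : I -> S -> S)
    brR DR :
  (forall b, exists a, j a = b) -> (forall c, j (iotaR c) = iota c) ->
  (forall a b, j (brR a b) = br (j a) (j b)) ->
  (forall i a, j (DR i a) = D i (j a)) ->
  normal_separation iotaR brR DR -> normal_separation iota br D.
Proof.
move=> surj jc brE DE NS J J' pJ pJ' sJ sJ' JJ' J'J.
have stJ (P : set S) : stable (ders br D) P ->
    stable (ders brR DR) [set a | P (j a)]%classic.
  move=> sP _ [[x ->]|[i ->]] a /= Pa; rewrite ?brE ?DE.
    by apply: (sP (br (j x))) => //; left; exists (j x).
  by apply: (sP (D i)) => //; right; exists i.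
have [|u [/= J'u Ju nu hu]] := NS _ _ (prime_preimage j pJ) (prime_preimage j pJ')
    (stJ _ sJ) (stJ _ sJ') (fun a => JJ' (j a)).
  by move=> h; apply: J'J => b; have [a <-] := surj b; apply: h.
exists (j u); split=> //.
- move=> b; have [a <-] := surj b; have [c /= hc] := nu a.
  by exists (j c); rewrite -brE -rmorphM -rmorphB.
- by move=> i; have [c /= hc] := hu i; exists c; rewrite -DE -jc -rmorphM -rmorphB.
Qed.

(** * The subalgebras generated by the initial variables *)

Section Subpoly.
Variables (K : fieldType) (n : nat).

Lemma subpolyP k (p : {mpoly K[n]}) :
  reflect (forall m (i : 'I_n), p@_m != 0 -> (k <= i)%N -> m i = 0%N) (p \in @subpoly K n k).
Proof.
apply: (iffP allP) => [h m i pm ki|h m].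
  by have := h m; rewrite mcoeff_msupp pm => /(_ isT)/forallP/(_ i)/implyP/(_ ki)/eqP.
rewrite mcoeff_msupp => pm; apply/forallP=> i; apply/implyP=> ki; apply/eqP.
exact: h pm ki.
Qed.

Lemma subpolyC k c : c%:MP \in @subpoly K n k.
Proof.
apply/subpolyP=> m i; rewrite mcoeffC; have [->|] := eqVneq m 0%MM; first by rewrite mnm0E.
by rewrite mulr0 eqxx.
Qed.

Lemma subpolyX k (i : 'I_n) : (i < k)%N -> 'X_i \in @subpoly K n k.
Proof.
move=> ik; apply/subpolyP=> m l; rewrite mcoeffX.
have [<-|] := eqVneq U_(i)%MM m; last by rewrite eqxx.
by move=> _ kl; rewrite mnm1E; case: eqP => // e; move: kl; rewrite -e leqNgt ik.
Qed.

Lemma subpolyD k p q : p \in @subpoly K n k -> q \in @subpoly K n k ->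
  p + q \in @subpoly K n k.
Proof.
move=> /subpolyP hp /subpolyP hq; apply/subpolyP=> m i; rewrite mcoeffD.
have [pm|pm _] := eqVneq p@_m 0; last exact: hp.
by rewrite pm add0r; apply: hq.
Qed.

Lemma subpolyM k p q : p \in @subpoly K n k -> q \in @subpoly K n k ->
  p * q \in @subpoly K n k.
Proof.
move=> /subpolyP hp /subpolyP hq; apply/subpolyP=> m i.
rewrite -mcoeff_msupp => /msuppM_le/allpairsP[[m1 m2] /=].
rewrite !mcoeff_msupp => -[h1 h2 ->] ki.
by rewrite mnmDE (hp _ _ h1 ki) (hq _ _ h2 ki).
Qed.

Lemma subpoly_full p : p \in @subpoly K n n.
Proof. by apply/subpolyP=> m i _; rewrite leqNgt ltn_ord. Qed.

Lemma subpolyW k l p : (k <= l)%N -> p \in @subpoly K n k -> p \in @subpoly K n l.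
Proof.
by move=> kl /subpolyP hp; apply/subpolyP=> m i pm li; apply: hp pm (leq_trans kl li).
Qed.

Lemma subpoly_ind k (Q : {mpoly K[n]} -> Prop) :
  (forall c, Q c%:MP) -> (forall i : 'I_n, (i < k)%N -> Q 'X_i) ->
  (forall p q, Q p -> Q q -> Q (p + q)) -> (forall p q, Q p -> Q q -> Q (p * q)) ->
  forall p, p \in @subpoly K n k -> Q p.
Proof.
move=> QC QX QD QM p /subpolyP hp.
have Q0 : Q 0 by rewrite -mpolyC0; apply: QC.
have Q1 : Q 1 by rewrite -mpolyC1; apply: QC.
rewrite [p]mpolyE big_seq; apply: big_ind => // m; rewrite mcoeff_msupp => pm.
rewrite -mul_mpolyC; apply: (QM) => //; rewrite mpolyXE_id.
apply: (@big_ind _ Q 1 *%R Q1 QM) => i _; have [ik|ki] := ltnP i k; last by rewrite (hp m i pm ki).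
by elim: {pm} (m i) => [|e IH]; rewrite ?expr0 // exprS; apply: QM => //; apply: QX.
Qed.

End Subpoly.

Lemma mpoly_ring_ind (K : fieldType) n (Q : {mpoly K[n]} -> Prop) :
  (forall c, Q c%:MP) -> (forall i : 'I_n, Q 'X_i) ->
  (forall p q, Q p -> Q q -> Q (p + q)) -> (forall p q, Q p -> Q q -> Q (p * q)) ->
  forall p, Q p.
Proof.
move=> QC QX QD QM p; apply: (subpoly_ind QC _ QD QM (subpoly_full p)) => i _.
exact: QX.
Qed.

Lemma subpoly0 (K : fieldType) n (p : {mpoly K[n]}) :
  p \in @subpoly K n 0 -> exists c, p = c%:MP.
Proof.
apply: (@subpoly_ind _ _ _ (fun p => exists c, p = c%:MP)) => //.
- by move=> c; exists c.
- by move=> _ _ [c ->] [d ->]; exists (c + d); rewrite mpolyCD.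
- by move=> _ _ [c ->] [d ->]; exists (c * d); rewrite mpolyCM.
Qed.

(** The morphism sending X_k to an indeterminate and the other variables to constants recovers F
    from its value at X_k. *)
Lemma subpoly_transcendental (K : fieldType) n (k : 'I_n) (F : {poly {mpoly K[n]}}) :
  (forall i, F`_i \in @subpoly K n k) -> F.['X_k] = 0 -> F = 0.
Proof.
move=> FS F0.
pose h (i : 'I_n) : {poly {mpoly K[n]}} := if i == k then 'X else ('X_i)%:P.
pose phi : {rmorphism {mpoly K[n]} -> {poly {mpoly K[n]}}} :=
  mmap (polyC \o @mpolyC n K) h.
have phiS p : p \in @subpoly K n k -> phi p = p%:P.
  apply: (@subpoly_ind _ _ _ (fun p => phi p = p%:P)) => [c|i ik|a b ha hb|a b ha hb].
  - by rewrite /phi /= mmapC.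
  - rewrite /phi /= mmapX mmap1U /h; case: eqP ik => // ->; by rewrite ltnn.
  - by rewrite rmorphD ha hb polyCD.
  - by rewrite rmorphM ha hb polyCM.
have phiX : phi 'X_k = 'X by rewrite /phi /= mmapX mmap1U /h eqxx.
have <- : phi F.['X_k] = F; last by rewrite F0 rmorph0.
rewrite horner_coef rmorph_sum /= [RHS]poly_coef_expansion.
by apply: eq_bigr => i _; rewrite rmorphM rmorphXn phiX phiS.
Qed.

Section Tower.
Variables (K : fieldType) (n : nat) (I : Type).
Variables (br : {mpoly K[n]} -> {mpoly K[n]} -> {mpoly K[n]}).
Variables (D : I -> {mpoly K[n]} -> {mpoly K[n]}) (om : I -> 'I_n -> K).
Variable (delta : 'I_n -> {mpoly K[n]} -> {mpoly K[n]}).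
Hypothesis natK : forall k, k.+1%:R != 0 :> K.
Hypothesis hR : poisson_ring (@mpolyC n K) br D.
Hypothesis DX : forall i k, D i 'X_k = om i k *: 'X_k.
Hypothesis brS : forall k : 'I_n,
  {in @subpoly K n k &, forall a b, br a b \in @subpoly K n k}.
Hypothesis brX : forall k : 'I_n, exists2 i, om i k != 0 &
  forall a, a \in @subpoly K n k -> [/\ delta k a \in @subpoly K n k,
    br 'X_k a = D i a * 'X_k + delta k a & exists e, iter e (delta k) a = 0].

Lemma der_subpoly i k a : a \in @subpoly K n k -> D i a \in @subpoly K n k.
Proof.
move=> aS; suff [] : a \in @subpoly K n k /\ D i a \in @subpoly K n k by [].
pose Q a := a \in @subpoly K n k /\ D i a \in @subpoly K n k.
apply: (@subpoly_ind _ _ k Q _ _ _ _ a) => //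
  [c|j jk|p q [pS DpS] [qS DqS]|p q [pS DpS] [qS DqS]]; rewrite /Q.
- by rewrite (pr_constD hR) -mpolyC0; split; apply: subpolyC.
- rewrite DX -mul_mpolyC; split; first exact: subpolyX.
  by apply: subpolyM; [apply: subpolyC | apply: subpolyX].
- by rewrite (derD (pr_derD hR i)); split; apply: subpolyD.
- rewrite (derM (pr_derD hR i)); split; first exact: subpolyM.
  by apply: subpolyD; apply: subpolyM.
Qed.

(** Each R_k is presented as an abstract ring with an embedding onto [subpoly], so that the next one
    can be a ring of univariate polynomials. All of the [D] are kept at every level, since every
    later sigma is among them. *)
Lemma tower_normal_separation : normal_separation (@mpolyC n K) br D.
Proof.
have step k : (k <= n)%N -> exists (T : comNzRingType) (iota : {rmorphism K -> T})
    (j : {rmorphism T -> {mpoly K[n]}}) (brT : T -> T -> T) (DT : I -> T -> T),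
  [/\ injective j, forall c, j (iota c) = c%:MP,
      forall p, p \in @subpoly K n k <-> exists a, j a = p,
      (forall a b, j (brT a b) = br (j a) (j b)) /\
        (forall i a, j (DT i a) = D i (j a))
    & poisson_ring iota brT DT /\ normal_separation iota brT DT].
  elim: k => [|k IH] kn.
    have j_inj : injective (@mpolyC n K) by exact: can_inj (@mpolyCK n K).
    have const a b : exists c : K, c%:MP = br a%:MP b%:MP :> {mpoly K[n]}.
      by exists 0; rewrite (pr_const hR) mpolyC0.
    have constD i a : exists c : K, c%:MP = D i a%:MP :> {mpoly K[n]}.
      by exists 0; rewrite (pr_constD hR) mpolyC0.
    have [brT [DT [brE DE hT]]] :=
      @poisson_restrict _ _ _ _ (@mpolyC n K : {rmorphism K -> {mpoly K[n]}}) idfun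
        _ _ _ j_inj (fun=> erefl) const constD hR.
    exists K, idfun, (@mpolyC n K : {rmorphism K -> {mpoly K[n]}}), brT, DT.
    split=> //.
      move=> p; split=> [/subpoly0[c ->]|[c <-]]; first by exists c.
      exact: subpolyC.
    split=> // J J' pJ pJ' sJ sJ' JJ' J'J; case: J'J => a J'a.
    have [->|a0] := eqVneq a 0; first by apply: ideal0 (prime_ideal_ideal pJ).
    case: (prime_ideal1 pJ'); rewrite -(mulVf a0).
    by apply: idealM (prime_ideal_ideal pJ') _ _ J'a.
  have [T [iota [j [brT [DT [jI jc jS [brE DE] [hT NS]]]]]]] := IH (ltnW kn).
  pose x := Ordinal kn.
  pose j' : {rmorphism {poly T} -> {mpoly K[n]}} :=
    horner_morph (fun a => mulrC 'X_x (j a)).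
  have j'C a : j' a%:P = j a by rewrite /j' /= horner_morphC.
  have j'X : j' 'X = 'X_x by rewrite /j' /= horner_morphX.
  have j'I : injective j'.
    move=> F G /eqP; rewrite -subr_eq0 -rmorphB => /eqP FG.
    apply/eqP; rewrite -subr_eq0; apply/eqP.
    have e : map_poly j (F - G) = 0.
      apply: (@subpoly_transcendental _ _ x) => // i.
      by rewrite coef_map; apply/jS; exists (F - G)`_i.
    apply/polyP=> i; apply: jI; rewrite coef0 rmorph0.
    by rewrite -coef_map e coef0.
  pose iota' : {rmorphism K -> {poly T}} := polyC \o iota.
  have j'c c : j' (iota' c) = c%:MP by rewrite /= j'C jc.
  have j'S p : p \in @subpoly K n k.+1 <-> exists a, j' a = p.
    split.
      apply: (@subpoly_ind _ _ k.+1 (fun p => exists a, j' a = p)).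
      - by move=> c; exists (iota' c).
      - move=> i; rewrite ltnS leq_eqVlt => /predU1P[ik|ik].
          by exists 'X; rewrite j'X; congr 'X_ _; apply: val_inj.
        have /jS[a <-] : 'X_i \in @subpoly K n k by apply: subpolyX.
        by exists a%:P.
      - by move=> _ _ [a <-] [b <-]; exists (a + b); rewrite rmorphD.
      - by move=> _ _ [a <-] [b <-]; exists (a * b); rewrite rmorphM.
    move=> [a <-]; rewrite /j' /= /horner_morph horner_coef.
    apply: (big_ind (fun p => p \in @subpoly K n k.+1)) => [||i _].
    - by rewrite -mpolyC0; apply: subpolyC.
    - exact: subpolyD.
    - apply: subpolyM.
        by apply: (subpolyW (leqnSn k)); rewrite coef_map; apply/jS; exists a`_i.
      elim: (val i) => [|e IHe]; first by rewrite expr0 -mpolyC1; apply: subpolyC.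
      by rewrite exprS; apply: subpolyM => //; apply: subpolyX => /=.
  have brS' a b : exists c, j' c = br (j' a) (j' b).
    apply/j'S; have [k1|k1] := ltnP k.+1 n.
      by apply: (brS (k := Ordinal k1)); apply/j'S; eexists.
    by apply: (subpolyW k1); apply: subpoly_full.
  have DS' i a : exists c, j' c = D i (j' a).
    by apply/j'S/der_subpoly/j'S; exists a.
  have [br' [D' [brE' DE' hT']]] := poisson_restrict j'I j'c brS' DS' hR.
  exists {poly T}, iota', j', br', D'; split=> //; split=> //.
  have [i0 om0 del] := brX x.
  have inS a : j a \in @subpoly K n k by apply/jS; exists a.
  have /choice[dl dlE] a : exists b, j b = delta x (j a).
    by apply/jS; have [] := del _ (inS a).
  apply: (@poly_normal_separation K I T iota brT DT br' D' dl (fun i => om i x) i0) => //.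
  - by move=> a b; apply: j'I; rewrite brE' !j'C brE.
  - by move=> i a; apply: j'I; rewrite DE' !j'C DE.
  - move=> a; apply: j'I; rewrite brE' rmorphD rmorphM !j'C j'X.
    by have [_ -> _] := del _ (inS a); rewrite dlE DE.
  - move=> i; apply: j'I; rewrite DE' rmorphM j'C j'X jc DX mul_mpolyC //.
  - move=> a; have [_ _ [e he]] := del _ (inS a); exists e; apply: jI.
    by rewrite rmorph0 -he; elim: e {he} => //= e <-.
have [T [iota [j [brT [DT [jI jc jS [brE DE] [hT NS]]]]]]] := step n (leqnn n).
apply: (normal_separation_iso _ jc brE DE NS) => p.
by apply/jS; apply: subpoly_full.
Qed.

End Tower.

(** * Characters of the torus and the action of its Lie algebra *)

Section Characters.
Variables (K : fieldType) (r : nat).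
Implicit Types chi psi : character K r.

Lemma char_at_one chi : chi 1%g = 1%g.
Proof.
have := char_morph chi 1%g 1%g; rewrite mulg1 => e.
by apply: (@mulgI _ (chi 1%g)); rewrite mulg1 -e.
Qed.

Lemma char_num_at_one chi : (char_num chi).@[fun=> 1] = 1.
Proof.
have := char_regular chi 1%g; rewrite char_at_one.
have e i : Kstar_val ((1%g : torus K r) i) = 1 by rewrite ffunE.
rewrite /= big1 => [|i _]; last by rewrite e.
rewrite expr1n divr1 => e1; rewrite [RHS](e1 : 1 = _); apply: meval_eq => i.
by rewrite e.
Qed.

Lemma char_mul_subproof chi psi :
  (forall s t, (chi (s * t) * psi (s * t) = (chi s * psi s) * (chi t * psi t))%g) /\
  forall t : torus K r, val (chi t * psi t)%g =
    (char_num chi * char_num psi).@[fun i => val (t i)]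
     / (\prod_(i < r) val (t i)) ^+ (char_exp chi + char_exp psi).
Proof.
split=> [s t|t].
  rewrite !char_morph; apply: val_inj => /=; rewrite mulrACA //.
by rewrite /= !char_regular mevalM exprD invfM mulrACA.
Qed.

Definition char_mul chi psi : character K r :=
  Character (char_fun := fun t => (chi t * psi t)%g)
    (char_mul_subproof chi psi).1 (char_mul_subproof chi psi).2.

Lemma char_diff_mul chi psi u :
  char_diff (char_mul chi psi) u = char_diff chi u + char_diff psi u.
Proof.
rewrite /char_diff /= mevalM !char_num_at_one !mul1r natrD mulrDl.
have -> : \sum_(i < r) ((char_num chi * char_num psi)^`M(i)).@[fun=> 1] * u i =
  \sum_(i < r) ((char_num chi)^`M(i)).@[fun=> 1] * u i +
  \sum_(i < r) ((char_num psi)^`M(i)).@[fun=> 1] * u i.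
  rewrite -big_split; apply: eq_bigr => i _ /=.
  by rewrite mderivM mevalD !mevalM !char_num_at_one mulr1 mul1r mulrDl.
by rewrite opprD addrACA.
Qed.

End Characters.

Section RationalAction.
Variables (K : fieldType) (r : nat) (A : comAlgType K).
Variable act : torus K r -> A -> A.
Hypothesis hact : rational_action act.

Definition rational_eigenvector v := exists chi : character K r, eigenvector act chi v.

(** The number of terms is recorded because [eigenvector_rational] is proved by induction on it;
    eigenvalues may repeat. *)
Inductive eigen_sum : nat -> A -> Prop :=
| EigenSum0 : eigen_sum 0 0
| EigenSumS k c v a : rational_eigenvector v -> eigen_sum k a ->
    eigen_sum k.+1 (c *: v + a).

Lemma eigen_sum_exists a : exists k, eigen_sum k a.
Proof.
have [s [hs ->]] := hact.2 a; exists (size s).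
elim: s hs => [|cv s IH] hs; first by rewrite big_nil; apply: EigenSum0.
rewrite big_cons; apply: EigenSumS; first by apply: hs; rewrite mem_head.
by apply: IH => x xs; apply: hs; rewrite inE xs orbT.
Qed.

Lemma act_scale t c a : act t (c *: a) = c *: act t a.
Proof.
have lin := act_linear hact.1 t.
have a0 : act t 0 = 0.
  by have := lin (-1) 0 0; rewrite scaler0 addr0 scaleN1r addNr.
by rewrite -[c *: a]addr0 lin a0 addr0.
Qed.

Lemma act_add t a b : act t (a + b) = act t a + act t b.
Proof. by have := act_linear hact.1 t 1 a b; rewrite !scale1r. Qed.

Lemma eigen_sum_scale k c a : eigen_sum k a -> eigen_sum k (c *: a).
Proof.
elim=> [|{}k d v {}a hv _ IH]; first by rewrite scaler0; apply: EigenSum0.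
by rewrite scalerDr scalerA; apply: EigenSumS.
Qed.

Lemma eigen_sum_act k t c a : eigen_sum k a -> eigen_sum k (act t a - c *: a).
Proof.
elim=> [|{}k d v {}a [chi [v0 hv]] _ IH].
  rewrite scaler0 subr0; have := act_scale t 0 0; rewrite !scale0r => ->.
  exact: EigenSum0.
rewrite act_add act_scale hv scalerDr opprD addrACA !scalerA -scalerBl.
by apply: EigenSumS => //; exists chi.
Qed.

(* If the first eigenvalue differs from chi at t, then act t - chi t kills that
   term of the sum and multiplies v by a nonzero scalar. *)
Lemma eigenvector_rational chi v : eigenvector act chi v -> rational_eigenvector v.
Proof.
move=> [v0 hv]; have [k] := eigen_sum_exists v.
elim: k v v0 hv => [|k IH] v v0 hv hk; first by inversion hk; subst; rewrite eqxx in v0.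
inversion hk as [|k' c w a [psi [w0 hw]] ha ek ev]; subst.
have [e|/existsNP[t ht]] := pselect (forall t, psi t = chi t).
  by exists psi; split=> // t; rewrite hv e.
apply: IH => //; set x := val (chi t) - val (psi t).
have x0 : x != 0 by rewrite subr_eq0; apply: contra_notN ht => /eqP/val_inj ->.
have -> : c *: w + a = x^-1 *: (act t a - val (psi t) *: a).
  apply: (@scalerI _ _ x) => //.
  rewrite scalerA divff // scale1r scalerBl -hv act_add act_scale hw !scalerDr !scalerA.
  by rewrite mulrC opprD addrACA subrr add0r.
by apply: eigen_sum_scale; apply: eigen_sum_act.
Qed.

Variables (u : Lie K r) (D : A -> A).
Hypothesis hD : is_Lie_action act u D.

Lemma Lie_scale c a : D (c *: a) = c *: D a.
Proof.
have lin := hD.1.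
have a0 : D 0 = 0.
  by have := lin (-1) 0 0; rewrite scaler0 addr0 scaleN1r addNr.
by rewrite -[c *: a]addr0 lin a0 addr0.
Qed.

Lemma Lie_add a b : D (a + b) = D a + D b.
Proof. by have := hD.1 1 a b; rewrite !scale1r. Qed.

(** For rational eigenvectors v and w, [m v w] is zero or an eigenvector for the product character,
    whose differential is the sum of the two. Stated for a general bilinear map, to serve both the
    product and the bracket. *)
Lemma Lie_bilinear (m : A -> A -> A) :
  (forall a, linear (m a)) -> (forall b, linear (m^~ b)) ->
  (forall t a b, act t (m a b) = m (act t a) (act t b)) ->
  forall a b, D (m a b) = m (D a) b + m a (D b).
Proof.
move=> linr linl hm a b.
have mZr x c y : m x (c *: y) = c *: m x y.
  have h0 : m x 0 = 0 by have := linr x (-1) 0 0; rewrite scaler0 addr0 scaleN1r addNr.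
  by rewrite -[c *: y]addr0 linr h0 addr0.
have mDr x y z : m x (y + z) = m x y + m x z.
  by have := linr x 1 y z; rewrite !scale1r.
have mZl x c y : m (c *: y) x = c *: m y x.
  have h0 : m 0 x = 0 by have := linl x (-1) 0 0; rewrite scaler0 addr0 scaleN1r addNr.
  by rewrite -[c *: y]addr0 linl h0 addr0.
have mDl x y z : m (y + z) x = m y x + m z x.
  by have := linl x 1 y z; rewrite !scale1r.
have D0 : D 0 = 0 by have := Lie_scale 0 0; rewrite !scale0r.
have [k ha] := eigen_sum_exists a; elim: ha => [|{}k c v {}a [chi hv] _ IHa].
  have m0 x : m 0 x = 0 by have := mZl x 0 0; rewrite !scale0r.
  by rewrite D0 !m0 D0 addr0.
rewrite mDl mZl !Lie_add Lie_scale mDl IHa mDl addrACA; congr (_ + _).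
rewrite Lie_scale !mZl -scalerDr; congr (_ *: _).
have [l hb] := eigen_sum_exists b; move: hb {IHa}; elim=> [|{}l d w {}b [psi hw] _ IHb].
  have m0 x : m x 0 = 0 by have := mZr x 0 0; rewrite !scale0r.
  by rewrite D0 !m0 D0 addr0.
rewrite mDr mZr !Lie_add Lie_scale mDr IHb mDr addrACA; congr (_ + _).
rewrite Lie_scale !mZr -scalerDr; congr (_ *: _).
rewrite (hD.2 _ _ hv) (hD.2 _ _ hw) mZl mZr -scalerDl -char_diff_mul.
have [->|mvw] := eqVneq (m v w) 0; first by rewrite D0 scaler0.
apply: hD.2; split=> // t; rewrite hm hv.2 hw.2 mZl mZr scalerA //.
Qed.

(** The variables come with an eigenvalue that is merely a map; [eigenvector_rational] replaces it
    by a character, which has a differential. *)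
Lemma Lie_eigenvector chi v : eigenvector act chi v -> exists c, D v = c *: v.
Proof.
by move=> /eigenvector_rational[psi hv]; exists (char_diff psi u); apply: hD.2.
Qed.

End RationalAction.

Section Weights.
Variables (K : fieldType) (n r : nat).
Variables (br : {mpoly K[n]} -> {mpoly K[n]} -> {mpoly K[n]}).
Variables (sigma delta : 'I_n -> {mpoly K[n]} -> {mpoly K[n]}).
Variable (act : torus K r -> {mpoly K[n]} -> {mpoly K[n]}).
Hypothesis nilp : poisson_nilpotent br sigma delta act.

Lemma linear_der (d : {mpoly K[n]} -> {mpoly K[n]}) : linear d ->
  (forall a b, d (a * b) = d a * b + a * d b) -> derivation d.
Proof.
by move=> lin dM; split=> // a b; have := lin 1 a b; rewrite !scale1r.
Qed.

Lemma linear_const (d : {mpoly K[n]} -> {mpoly K[n]}) c : linear d ->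
  derivation d -> d c%:MP = 0.
Proof.
move=> lin hd; have := lin c 1 0.
by rewrite addr0 (der1 hd) (der0 hd) scaler0 addr0 -mul_mpolyC mulr1.
Qed.

Lemma nilpotent_weights : exists (D : 'I_n -> {mpoly K[n]} -> {mpoly K[n]})
    (om : 'I_n -> 'I_n -> K),
  [/\ poisson_ring (@mpolyC n K) br D, (forall i k, D i 'X_k = om i k *: 'X_k),
      (forall k, om k k != 0) & forall k : 'I_n, {in @subpoly K n k, D k =1 sigma k}].
Proof.
have /choice[hD] := pn_Lie nilp; have rat := pn_rational nilp.
move=> /choice[D LD].
have DL k : is_Lie_action act (hD k) (D k) by have [] := LD k.
have pb := (pn_iterated nilp).1.
have /choice[om omE] : forall ik : 'I_n * 'I_n, exists c, D ik.1 'X_ik.2 = c *: 'X_ik.2.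
  move=> [i k] /=; have [chi hchi] := pn_eigen nilp k.
  exact: (Lie_eigenvector rat (DL i) hchi).
have derDk k : derivation (D k).
  apply: linear_der; first exact: (DL k).1.
  apply: (Lie_bilinear rat (DL k)).
  - by move=> a c x y; rewrite mulrDr scalerAr.
  - by move=> a c x y; rewrite mulrDl scalerAl.
  - by move=> t a b; have [_ ->] := act_monoid_morphism rat.1 t.
exists D, (fun i k => om (i, k)); split.
- split=> [b|a|a|a b c|a c|//|i c|i a b].
  + apply: linear_der (pb_linear_l pb b) _ => x y; exact: (pb_leibniz_l pb).
  + apply: linear_der (pb_linear_r pb a) _ => x y; exact: (pb_leibniz_r pb).
  + exact: (pb_alternating pb).
  + have anti x y : br x y = - br y x.
      apply/eqP; rewrite -addr_eq0; have := pb_alternating pb (x + y).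
      have lr := pb_linear_r pb; have ll := pb_linear_l pb.
      have := ll (x + y) 1 x y; rewrite !scale1r => ->.
      have := lr x 1 x y; have := lr y 1 x y; rewrite !scale1r => -> ->.
      by rewrite !(pb_alternating pb) add0r addr0 => ->.
    have oppr x y : br x (- y) = - br x y.
      have := pb_linear_r pb x (-1) y 0; rewrite !scaleN1r addr0 => ->.
      have := pb_linear_r pb x (-1) 0 0; rewrite !scaleN1r addr0 oppr0 => e.
      by rewrite e addNr addr0.
    have := pb_jacobi pb a b c; rewrite (anti c (br a b)) (anti c a) oppr.
    by move/eqP; rewrite subr_eq0 => /eqP <-; rewrite subrK.
  + apply: linear_const (pb_linear_r pb a) _.
    apply: linear_der (pb_linear_r pb a) _ => x y; exact: (pb_leibniz_r pb).
  + exact: linear_const (DL i).1 (derDk i).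
  + apply: (Lie_bilinear rat (DL i)).
    * exact: (pb_linear_r pb).
    * exact: (pb_linear_l pb).
    * exact: (pn_poisson nilp).
- by move=> i k; apply: (omE (i, k)).
- move=> k; have [_ _ [l l0 lE]] := LD k.
  apply: contraNneq l0 => e; have := omE (k, k); rewrite /= e scale0r lE => /eqP.
  rewrite scaler_eq0 => /orP[//|/eqP X0].
  have [chi [/eqP[]]] := pn_eigen nilp k; exact: X0.
- by move=> k; have [] := LD k.
Qed.

Lemma nilpotent_normal_separation : [pchar K] =i pred0 ->
  exists (D : 'I_n -> {mpoly K[n]} -> {mpoly K[n]}) (om : 'I_n -> 'I_n -> K),
  [/\ poisson_ring (@mpolyC n K) br D, (forall i k, D i 'X_k = om i k *: 'X_k)
    & normal_separation (@mpolyC n K) br D].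
Proof.
move=> charK; have [D [om [hR DX om0 Dsigma]]] := nilpotent_weights.
exists D, om; split=> //.
have ppo := (pn_iterated nilp).2.
apply: (@tower_normal_separation K n 'I_n br D om delta) => //.
- by move=> k; rewrite natf_neq0_pchar; apply/pnatP => // p pp _; rewrite inE charK.
- by move=> k; apply: pp_closed (ppo k).
- move=> k; exists k => // a aS; split.
  + exact: (der_closed (pp_delta (ppo k)).1).
  + by rewrite (pp_bracket (ppo k)) // Dsigma.
  (* Local nilpotency is assumed for k > 0. For k = 0 only constants occur, on which the bracket and
     [D] vanish, so delta vanishes too. *)
  + have [k0|k0] := posnP k; last exact: (pn_nilpotent nilp).
    exists 1%N => /=; rewrite k0 in aS; have [c ac] := subpoly0 aS.
    have := pp_bracket (ppo k); move/(_ a); rewrite -Dsigma ?k0 // => /(_ aS).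
    by rewrite ac (pr_const hR) (pr_constD hR) mul0r add0r => <-.
Qed.

End Weights.

(** * Adjacent Poisson primes *)

Section LocallyNormal.
Variables (K : fieldType) (I : Type) (T : comNzRingType) (iota : {rmorphism K -> T}).
Variables (br : T -> T -> T) (D : I -> T -> T).
Hypothesis nat_inv : forall k, exists c : T, c * k.+1%:R = 1.
Hypothesis hT : poisson_ring iota br D.
Hypothesis NS : normal_separation iota br D.

Definition homogeneous v := forall i, exists c, D i v = iota c * v.

Inductive homog_sum : nat -> T -> Prop :=
| HomogSum0 : homog_sum 0 0
| HomogSumS k v a : homogeneous v -> homog_sum k a -> homog_sum k.+1 (v + a).

Hypothesis homog_span : forall a, exists k, homog_sum k a.

Definition poisson_stable (P : set T) := forall a b, P b -> P (br a b).

Lemma homogeneous_br u v : homogeneous u -> homogeneous v -> homogeneous (br u v).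
Proof.
move=> hu hv i; have [b hb] := hu i; have [c hc] := hv i; exists (b + c).
rewrite (pr_brD hT) hb hc (derM (pr_derl hT _)) (derM (pr_der hT _)).
by rewrite (pr_const hT) (pr_constl hT) rmorphD; ring_over T.
Qed.

Lemma homogeneousM_br u v g : homogeneous u -> homogeneous v -> homogeneous g ->
  homogeneous (v * br u g - u * br v g).
Proof.
move=> hu hv hg i; have [a ha] := hu i; have [b hb] := hv i; have [c hc] := hg i.
exists (a + b + c); rewrite (derB _ _ (pr_derD hT i)) !(derM (pr_derD hT i)).
rewrite !(pr_brD hT) ha hb hc !(derM (pr_derl hT _)) !(derM (pr_der hT _)).
by rewrite !(pr_const hT) !(pr_constl hT) !rmorphD; ring_over T.
Qed.

Inductive homog_ideal (P : set T) : T -> Prop :=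
| HomogIdeal0 : homog_ideal P 0
| HomogIdealS a v b : homogeneous v -> P v -> homog_ideal P b ->
    homog_ideal P (a * v + b).

Lemma homog_idealD P a b : homog_ideal P a -> homog_ideal P b -> homog_ideal P (a + b).
Proof.
elim=> [|{}a v c hv Pv _ IH] hb; first by rewrite add0r.
by rewrite -addrA; apply: HomogIdealS => //; apply: IH.
Qed.

Lemma homog_ideal_gen P a v : homogeneous v -> P v -> homog_ideal P (a * v).
Proof. by move=> hv Pv; rewrite -[a * v]addr0; apply: HomogIdealS => //; left. Qed.

Lemma homog_ideal_ideal P : ideal (homog_ideal P).
Proof.
split; [exact: HomogIdeal0 | exact: homog_idealD |].
move=> a b; elim=> [|c v {}b hv Pv _ IH]; first by rewrite mulr0; left.
by rewrite mulrDr mulrA; apply: HomogIdealS.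
Qed.

Lemma homog_ideal_sub (P : set T) : ideal P -> (homog_ideal P `<=` P)%classic.
Proof.
move=> iP b; elim=> [|c v {}b hv Pv _ IH]; first exact: ideal0.
by apply: idealD => //; apply: idealM.
Qed.

(** Homogeneous elements span, so it suffices to bracket generators with them; such brackets are
    homogeneous and remain in P. The [D] only rescale the generators. *)
Lemma homog_ideal_stable P : poisson_stable P -> stable (ders br D) (homog_ideal P).
Proof.
move=> sP _ [[x ->]|[i ->]] b; elim=> [|c v {}b hv Pv _ IH].
- by rewrite (der0 (pr_der hT x)); left.
- rewrite (derD (pr_der hT x)) (derM (pr_der hT x)); apply: homog_idealD => //.
  apply: homog_idealD; first exact: homog_ideal_gen.
  have [k hx] := homog_span x; elim: hx {IH} => [|{}k w {}x hw _ IH].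
    by rewrite (der0 (pr_derl hT v)) mulr0; left.
  rewrite (derD (pr_derl hT v)) mulrDr; apply: homog_idealD => //.
  by apply: homog_ideal_gen; [apply: homogeneous_br | apply: sP].
- by rewrite (der0 (pr_derD hT i)); left.
- rewrite (derD (pr_derD hT i)) (derM (pr_derD hT i)).
  apply: homog_idealD => //.
  apply: homog_idealD; first exact: homog_ideal_gen.
  by have [e ->] := hv i; rewrite mulrA; apply: homog_ideal_gen.
Qed.

(** The infinitesimal form of the largest torus-stable ideal inside P; since [ders] includes the
    brackets, it is at the same time a Poisson ideal. *)
Definition core (P : set T) : set T :=
  [set a | exists J, [/\ ideal J, stable (ders br D) J, (J `<=` P)%classic & J a]]%classic.

Lemma core_ideal P : ideal P -> ideal (core P).
Proof.
move=> iP; split.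
- exists [set 0]%classic; split=> //; first split=> //=.
  + by move=> a b -> ->; rewrite addr0.
  + by move=> a b ->; rewrite mulr0.
  + by move=> d hd a ->; rewrite /= (der0 (ders_derivation hT hd)).
  + by move=> a ->; apply: ideal0.
- move=> a b [J [iJ sJ JP Ja]] [L [iL sL LP Lb]].
  exists [set c | exists x y, [/\ J x, L y & c = x + y]]%classic; split.
  + split=> [|x y|x y].
    * by exists 0, 0; split; rewrite ?addr0 //; apply: ideal0.
    * move=> [p [q [Jp Lq ->]]] [s [t [Js Lt ->]]].
      by exists (p + s), (q + t); split; rewrite 1?addrACA //; apply: idealD.
    * move=> [p [q [Jp Lq ->]]]; exists (x * p), (x * q).
      by split; rewrite ?mulrDr //; apply: idealM.
  + move=> d hd _ [p [q [Jp Lq ->]]]; exists (d p), (d q).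
    by split; rewrite ?(derD (ders_derivation hT hd)) //; [apply: sJ | apply: sL].
  + by move=> _ [p [q [Jp Lq ->]]]; apply: idealD => //; [apply: JP | apply: LP].
  + by exists a, b.
- move=> a b [J [iJ sJ JP Jb]]; exists J; split=> //; exact: idealM.
Qed.

Lemma core_stable P : stable (ders br D) (core P).
Proof. by move=> d hd a [J [iJ sJ JP Ja]]; exists J; split=> //; apply: (sJ d). Qed.

Lemma core_sub P : (core P `<=` P)%classic.
Proof. by move=> a [J [_ _ JP Ja]]; apply: JP. Qed.

(** A stable prime squeezed between the core and P is one of the ideals whose union is the core,
    hence equals it. *)
Lemma core_prime P : prime_ideal P -> prime_ideal (core P).
Proof.
move=> pP; have iP := prime_ideal_ideal pP.
have CM : mult_closed (~` P)%classic.
  by split; [exact: prime_ideal1 | move=> a b Pa Pb /(prime_idealP pP)[]].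
have [|J [pJ sJ CJ avJ]] := stable_prime_avoiding nat_inv
    (@ders_derivation _ _ _ _ _ _ hT) (core_ideal iP) (@core_stable P) CM.
  by move=> a Pa /core_sub.
suff -> : core P = J by [].
apply/seteqP; split=> // a Ja; exists J; split=> //; first exact: prime_ideal_ideal.
by move=> b Jb; apply: contrapT => Pb; apply: (avJ b).
Qed.

(** The element [v] is in the core of Q but not in that of P, so separation applies to the cores.
    The resulting [u] is outside P: otherwise [u] and the core of P would generate a larger stable
    ideal inside P. Homogeneity of [u] is used exactly there. *)
Lemma homogeneous_normal P Q v : prime_ideal P -> prime_ideal Q ->
  poisson_stable Q -> (P `<=` Q)%classic -> homogeneous v -> Q v -> ~ P v ->
  exists u, [/\ Q u, ~ P u & forall g, exists b, P (br u g - u * b)].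
Proof.
move=> pP pQ sQ PQ hv Qv Pv.
have iQ := prime_ideal_ideal pQ; have iP := prime_ideal_ideal pP.
have [||u [Qu Cu nu hu]] := NS (core_prime pP) (core_prime pQ)
    (@core_stable P) (@core_stable Q).
- by move=> a [J [iJ sJ JP Ja]]; exists J; split=> // b Jb; apply: PQ; apply: JP.
- move=> h; apply: Pv; apply: core_sub; apply: h.
  exists (homog_ideal Q); split.
  + exact: homog_ideal_ideal.
  + exact: homog_ideal_stable.
  + exact: homog_ideal_sub.
  + by rewrite -[v]mul1r; apply: homog_ideal_gen.
have iC := core_ideal iP.
exists u; split; first exact: core_sub.
- move=> Pu; apply: Cu.
  exists [set c | exists x, core P (c - u * x)]%classic; split.
  + exact: ideal_add_principal.
  + move=> d hd a [x hx]; have dd := ders_derivation hT hd.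
    have [y hy] : exists y, core P (d u - u * y).
      case: hd {dd} => [[z ->]|[i ->]]; last by have [c hc] := hu i; exists (iota c); rewrite mulrC.
      have [b hb] := nu z; exists (- b); rewrite (pr_anti hT).
      have -> : - br u z - u * - b = - (br u z - u * b) by ring_over T.
      exact: idealN.
    exists (y * x + d x).
    have -> : d a - u * (y * x + d x) = d (a - u * x) + x * (d u - u * y).
      by rewrite (derB _ _ dd) (derM dd); ring_over T.
    by apply: idealD => //; [apply: (core_stable hd) | apply: idealM].
  + move=> a [x hx]; rewrite -[a](subrK (u * x)); apply: idealD => //.
      exact: core_sub.
    exact: idealMr.
  + by exists 1; rewrite mulr1 subrr; apply: ideal0.
- by move=> g; have [b hb] := nu g; exists b; apply: core_sub.
Qed.

(* Take f in Q \ P with as few homogeneous components as possible, v being the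
   first one.  For homogeneous g the element v {f,g} - f {v,g} of Q has fewer
   components, so it lies in P. *)
Lemma locally_normal P Q : prime_ideal P -> prime_ideal Q ->
  poisson_stable Q -> (P `<=` Q)%classic -> ~ (Q `<=` P)%classic ->
  exists u s, [/\ Q u, ~ P u, ~ Q s & forall g, exists b, P (s * br u g - u * b)].
Proof.
move=> pP pQ sQ PQ QP; have iP := prime_ideal_ideal pP; have iQ := prime_ideal_ideal pQ.
have [f Qf Pf] : exists2 f, Q f & ~ P f.
  by apply: contrapT => /forall2NP h; apply: QP => f Qf; case: (h f) => // /contrapT.
have ex : exists k, `[< exists f, [/\ homog_sum k f, Q f & ~ P f] >].
  by have [k hk] := homog_span f; exists k; apply/asboolP; exists f.
case: (ex_minnP ex) => k /asboolP[{Qf Pf}{}f [hf Qf Pf]] mink.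
have less l g : (l < k)%N -> homog_sum l g -> Q g -> P g.
  move=> lk hg Qg; apply: contrapT => Pg.
  have : `[< exists f, [/\ homog_sum l f, Q f & ~ P f] >] by apply/asboolP; exists g.
  by move/mink; rewrite leqNgt lk.
case: hf less Qf Pf {mink} => [|{}k v a hv ha] less Qf Pf.
  by case: Pf; apply: ideal0.
have [Qv|Qv] := pselect (Q v).
  have Pv : ~ P v.
    move=> Pv; apply: Pf; apply: idealD => //; apply: (less k) => //.
    by have := idealB iQ Qf Qv; rewrite addrC addKr.
  have [u [Qu Pu hu]] := homogeneous_normal pP pQ sQ PQ hv Qv Pv.
  exists u, 1; split=> //; first exact: prime_ideal1.
  by move=> g; have [b hb] := hu g; exists b; rewrite mul1r.
exists (v + a), v; split=> // g; exists (br v g).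
have [l hg] := homog_span g; elim: hg => [|{}l w {}g hw _ IH].
  by rewrite !(der0 (pr_der hT _)) !mulr0 subr0; apply: ideal0.
rewrite !(derD (pr_der hT _)).
have -> : v * (br (v + a) w + br (v + a) g) - (v + a) * (br v w + br v g) =
  (v * br (v + a) w - (v + a) * br v w) + (v * br (v + a) g - (v + a) * br v g).
  by ring_over T.
apply: idealD => //; apply: (less k) => //.
  rewrite (derD (pr_derl hT w)).
  have -> : v * (br v w + br a w) - (v + a) * br v w = v * br a w - a * br v w.
    by ring_over T.
  elim: ha {less IH Qf Pf} => [|{}k x {}a hx _ IH].
    by rewrite (der0 (pr_derl hT w)) mulr0 mul0r subr0; left.
  rewrite (derD (pr_derl hT w)).
  have -> : v * (br x w + br a w) - (x + a) * br v w =
    (v * br x w - x * br v w) + (v * br a w - a * br v w) by ring_over T.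
  by constructor; first exact: homogeneousM_br.
apply: idealB => //; last exact: idealMr.
by apply: idealM => //; rewrite (pr_anti hT); apply: idealN => //; apply: sQ.
Qed.

End LocallyNormal.

Lemma mpoly_homog_span (K : fieldType) n (I : Type) br (D : I -> {mpoly K[n]} -> {mpoly K[n]})
    (om : I -> 'I_n -> K) : poisson_ring (@mpolyC n K) br D ->
  (forall i k, D i 'X_k = om i k *: 'X_k) ->
  forall a, exists k, homog_sum (@mpolyC n K) D k a.
Proof.
move=> hR DX a; have hm c m : homogeneous (@mpolyC n K) D (c%:MP * 'X_[m]).
  move=> i; exists (\sum_(k < n) om i k *+ m k).
  rewrite (derM (pr_derD hR i)) (pr_constD hR) mul0r add0r mulrCA; congr (_ * _).
  rewrite mpolyXE_id; pose H x c := D i x = c%:MP * x.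
  apply: (@big_ind2 _ _ H _ *%R _ +%R) => [|x d y e hx he|k _]; rewrite /H.
  - by rewrite mpolyC0 mul0r (der1 (pr_derD hR i)).
  - by rewrite (derM (pr_derD hR i)) hx he mpolyCD mulrDl -mulrA [x * (_ * _)]mulrCA.
  - case: (m k) => [|e].
      by rewrite mulr0n mpolyC0 mul0r expr0 (der1 (pr_derD hR i)).
    rewrite (derX _ _ (pr_derD hR i)) DX -mul_mpolyC mulrCA -exprSr.
    by rewrite -mulrnAl mpolyCMn.
rewrite [a]mpolyE; elim: (msupp a) => [|m s [k IH]]; first by exists 0%N; rewrite big_nil; left.
exists k.+1; rewrite big_cons; constructor => //.
by rewrite -mul_mpolyC.
Qed.

(** * Noetherian rings and Hilbert's basis theorem *)

Section Noetherian.

(* "Generated by s" is phrased as "contained in every ideal containing s". *)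
Definition noetherian (A : comNzRingType) := forall I : set A, ideal I ->
  exists s : seq A, (forall x, x \in s -> I x) /\
    forall J : set A, ideal J -> (forall x, x \in s -> J x) -> (I `<=` J)%classic.

Lemma noetherian_surj (A B : comNzRingType) (h : {rmorphism A -> B}) :
  (forall b, exists a, h a = b) -> noetherian A -> noetherian B.
Proof.
move=> surj nA I iI.
have pre (J : set B) : ideal J -> ideal [set a | J (h a)]%classic.
  move=> iJ; split=> [|a b|a b] /=; rewrite ?rmorph0 ?rmorphD ?rmorphM.
  - exact: ideal0.
  - exact: idealD.
  - exact: idealM.
have [s [sI sJ]] := nA _ (pre _ iI).
exists (map h s); split=> [_ /mapP[x xs ->]|J iJ hJ b Ib]; first exact: sI.
have [a ab] := surj b; move: Ib; rewrite -ab => /(sJ _ (pre _ iJ)); apply.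
by move=> x xs; apply: hJ; apply: map_f.
Qed.

Lemma noetherian_field (K : fieldType) : noetherian K.
Proof.
move=> I iI; have [[a Ia a0]|h] := pselect (exists2 a, I a & a != 0).
  exists [:: a]; split=> [x|J iJ hJ b _]; first by rewrite inE => /eqP->.
  by rewrite -[b](divfK a0); apply: idealM => //; apply: hJ; rewrite inE.
exists [::]; split=> // J iJ _ b Ib; have [->|b0] := eqVneq b 0; first exact: ideal0.
by case: h; exists b.
Qed.

Variable A : comNzRingType.
Implicit Types (I J : set {poly A}) (F G : {poly A}).

Definition lead_ideal I d : set A :=
  [set a | exists G, [/\ I G, (size G <= d.+1)%N & G`_d = a]]%classic.

Lemma lead_ideal_ideal I d : ideal I -> ideal (lead_ideal I d).
Proof.
move=> iI; split.
- by exists 0; split; [apply: ideal0 | rewrite size_poly0 | rewrite coef0].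
- move=> _ _ [F [IF sF <-]] [G [IG sG <-]]; exists (F + G); split.
  + exact: idealD.
  + by apply: leq_trans (size_polyD _ _) _; rewrite geq_max sF sG.
  + by rewrite coefD.
- move=> a _ [F [IF sF <-]]; exists (a%:P * F); split.
  + exact: idealM.
  + by rewrite mul_polyC; apply: leq_trans (size_scale_leq _ _) sF.
  + by rewrite coefCM.
Qed.

Lemma lead_idealW I d k a : ideal I -> lead_ideal I d a -> lead_ideal I (d + k) a.
Proof.
move=> iI [G [IG sG <-]]; exists (G * 'X^k); split.
- exact: idealMr.
- have [->|G0] := eqVneq G 0; first by rewrite mul0r size_poly0.
  by rewrite size_mulXn // addnC -addSn leq_add2r.
- by rewrite coefMXn ltnNge leq_addl addnK.
Qed.

Hypothesis nA : noetherian A.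

(** The intersection with J provides a polynomial lying in both I and J with a prescribed leading
    coefficient, as the cancellation in [hilbert_basis] requires. *)
Lemma lead_ideal_gens I d : ideal I -> exists S : seq {poly A},
  (forall G, G \in S -> I G) /\ forall J, ideal J -> (forall G, G \in S -> J G) ->
    forall a, lead_ideal I d a -> lead_ideal (I `&` J)%classic d a.
Proof.
move=> iI; have [s [sI sJ]] := nA (lead_ideal_ideal d iI).
have /choice[w hw] x : exists G, lead_ideal I d x -> [/\ I G, (size G <= d.+1)%N & G`_d = x].
  by have [[G hG]|h] := pselect (lead_ideal I d x); [exists G | exists 0].
exists (map w s); split=> [_ /mapP[x xs ->]|J iJ hJ].
  by have [] := hw x (sI x xs).
apply: sJ => [|x xs].
  apply: lead_ideal_ideal; split=> [|a b [Ia Ja] [Ib Jb]|a b [Ib Jb]].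
  - by split; apply: ideal0.
  - by split; apply: idealD.
  - by split; apply: idealM.
have [IG sG Gx] := hw x (sI x xs); exists (w x); split=> //; split=> //.
by apply: hJ; apply: map_f.
Qed.

(** The ideals of leading coefficients increase with the degree and are constant from some N on.
    Lifted generators for the degrees up to N therefore suffice to cancel the leading term of any
    element of I. *)
Theorem hilbert_basis : noetherian {poly A}.
Proof.
move=> I iI.
pose L := [set a | exists d, lead_ideal I d a]%classic.
have iL : ideal L.
  split.
  - by exists 0%N; apply: ideal0 (lead_ideal_ideal 0 iI).
  - move=> a b [d ha] [e hb]; exists (d + e)%N.
    apply: (idealD (lead_ideal_ideal _ iI)); first exact: lead_idealW.
    by rewrite addnC; apply: lead_idealW.
  - by move=> a b [d hb]; exists d; apply: (idealM (lead_ideal_ideal d iI)).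
have [s [sL sJ]] := nA iL.
have [N hN] : exists N, forall x, x \in s -> lead_ideal I N x.
  elim: s sL {sJ} => [|x s IH] sL; first by exists 0%N.
  have [|N hN] := IH; first by move=> y ys; apply: sL; rewrite inE ys orbT.
  have [d hd] : L x by apply: sL; rewrite mem_head.
  exists (d + N)%N => y; rewrite inE => /predU1P[->|ys]; first exact: lead_idealW.
  by rewrite addnC; apply: lead_idealW => //; apply: hN.
have LN d a : lead_ideal I d a -> lead_ideal I N a.
  by move=> h; apply: (sJ _ (lead_ideal_ideal N iI) hN); exists d.
have [S [SI SJ]] : exists S : seq {poly A}, (forall G, G \in S -> I G) /\
    forall J, ideal J -> (forall G, G \in S -> J G) -> forall d, (d <= N)%N ->
    forall a, lead_ideal I d a -> lead_ideal (I `&` J)%classic d a.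
  elim: N {LN hN} => [|N [S [SI SJ]]].
    have [S [SI SJ]] := lead_ideal_gens 0 iI; exists S; split=> // J iJ hJ d.
    by rewrite leqn0 => /eqP->; apply: SJ.
  have [S' [SI' SJ']] := lead_ideal_gens N.+1 iI; exists (S ++ S'); split.
    by move=> G; rewrite mem_cat => /orP[]; [apply: SI | apply: SI'].
  move=> J iJ hJ d; rewrite leq_eqVlt => /predU1P[->|dN].
    by apply: SJ' => // G GS; apply: hJ; rewrite mem_cat GS orbT.
  by apply: SJ => // G GS; apply: hJ; rewrite mem_cat GS.
exists S; split=> // J iJ hJ F.
elim: {F}(size F) {-2}F (leqnn (size F)) => [|d IH] F sF IF.
  by move: sF; rewrite leqn0 size_poly_eq0 => /eqP->; apply: ideal0.
have [G [[IG JG] sG GF]] : lead_ideal (I `&` J)%classic d F`_d.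
  have hF : lead_ideal I d F`_d by exists F.
  have [dN|Nd] := leqP d N; first exact: SJ.
  suff : lead_ideal (I `&` J)%classic (N + (d - N)) F`_d by rewrite subnKC // ltnW.
  apply: lead_idealW.
    split=> [|a b [Ia Ja] [Ib Jb]|a b [Ib Jb]].
    - by split; apply: ideal0.
    - by split; apply: idealD.
    - by split; apply: idealM.
  exact: (SJ J iJ hJ N (leqnn N) _ (LN _ _ hF)).
rewrite -[F](subrK G); apply: idealD => //; apply: IH; last exact: idealB.
apply/leq_sizeP => j; rewrite leq_eqVlt => /predU1P[<-|dj].
  by rewrite coefB GF subrr.
by rewrite coefB !nth_default ?subrr //; apply: leq_trans dj.
Qed.

End Noetherian.

Lemma noetherian_mpoly (K : fieldType) n : noetherian {mpoly K[n]}.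
Proof.
elim: n => [|n IH].
  apply: (noetherian_surj (h := @mpolyC 0 K)) (@noetherian_field K).
  apply: mpoly_ring_ind => [c|[]//|p q [a <-] [b <-]|p q [a <-] [b <-]].
  - by exists c.
  - by exists (a + b); rewrite rmorphD.
  - by exists (a * b); rewrite rmorphM.
pose h : {rmorphism {poly {mpoly K[n]}} -> {mpoly K[n.+1]}} :=
  horner_morph (fun a => mulrC ('X_ord_max : {mpoly K[n.+1]}) (mwiden a)).
have hC a : h a%:P = mwiden a by rewrite /h /= horner_morphC.
have hX : h 'X = 'X_ord_max by rewrite /h /= horner_morphX.
apply: (noetherian_surj (h := h)) (hilbert_basis IH).
apply: mpoly_ring_ind => [c|i|p q [a <-] [b <-]|p q [a <-] [b <-]].
- by exists c%:MP%:P; rewrite hC mwidenC.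
- case: (unliftP ord_max i) => [j ->|->]; last by exists 'X.
  exists ('X_j)%:P; rewrite hC mwidenX mnmwiden1.
  by congr 'X_[U_(_)]; apply: val_inj; rewrite /= /bump leqNgt ltn_ord add0n.
- by exists (a + b); rewrite rmorphD.
- by exists (a * b); rewrite rmorphM.
Qed.

(** * Adjacent Poisson primes: Q as a minimal prime over u R + P *)

Section Adjacent.
Variables (T : comNzRingType) (br : T -> T -> T).
Hypothesis nat_inv : forall k, exists c : T, c * k.+1%:R = 1.
Hypothesis nT : noetherian T.
Hypothesis derr : forall a, derivation (br a).
Hypothesis anti : forall a b, br a b = - br b a.

Lemma adjacent_minimal (P Q : set T) : prime_ideal P -> prime_ideal Q ->
  poisson_stable br P -> poisson_stable br Q -> (P `<=` Q)%classic ->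
  (forall X, prime_ideal X -> poisson_stable br X -> (P `<=` X)%classic ->
    (X `<=` Q)%classic -> ~ (X `<=` P)%classic -> X = Q) ->
  (exists u s, [/\ Q u, ~ P u, ~ Q s & forall g, exists b, P (s * br u g - u * b)]) ->
  exists u g, [/\ Q u, ~ P u, ~ Q g &
    forall v, Q v -> exists k b, P ((g * v) ^+ k - u * b)].
Proof.
move=> pP pQ sP sQ PQ adj [u [s [Qu Pu Qs hs]]].
have iP := prime_ideal_ideal pP; have iQ := prime_ideal_ideal pQ.
pose J := [set a | exists b, P (a - u * b)]%classic.
have iJ : ideal J := ideal_add_principal u iP.
have PJ a : P a -> J a by exists 0; rewrite mulr0 subr0.
have Ju b : J (u * b) by exists b; rewrite subrr; apply: ideal0.
have Jus g : J (s * br u g) by have [b hb] := hs g; exists b.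
have JQ a : J a -> Q a.
  move=> [b hb]; rewrite -[a](subrK (u * b)); apply: idealD => //; first exact: PQ.
  exact: idealMr.
have QX a k : ~ Q a -> ~ Q (a ^+ k) by move=> ha /(prime_exp pQ).
have Qm a b : ~ Q a -> ~ Q b -> ~ Q (a * b) by move=> ha hb /(prime_idealP pQ)[].
have main v : Q v -> exists g k, ~ Q g /\ J (g * v ^+ k).
  move=> Qv; apply: contrapT => /forallNP no.
  pose I := [set a | exists k, J (s ^+ k * a)]%classic.
  (* Avoiding all products g v^k keeps a prime inside Q and away from v at once, which contradicts
     adjacency. *)
  pose S := [set a | exists g k, ~ Q g /\ a = g * v ^+ k]%classic.
  have iI : ideal I.
    split=> [|a b [k hk] [l hl]|a b [k hk]].
    - by exists 0%N; rewrite mulr0; apply: ideal0.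
    - exists (k + l)%N; rewrite mulrDr; apply: idealD => //.
        by rewrite exprD mulrAC; apply: idealMr.
      by rewrite exprD -mulrA; apply: idealM.
    - by exists k; rewrite mulrCA; apply: idealM.
  have stI : stable [set d | exists g, d = br g]%classic I.
    (* By the choice of s, the map s {g, -} sends J into itself; this costs the additional power of
       s. *)
    move=> _ [g ->] a [k [b hb]]; exists k.+1.
    set w := s ^+ k * a in hb; have dg := derr g.
    have Jw : J (s * br g w).
      have -> : s * br g w = s * br g (w - u * b) - s * br u g * b + u * (s * br g b).
        by rewrite (derB _ _ dg) (derM dg) (anti g u); ring_over T.
      apply: (idealD iJ) => //; apply: (idealB iJ); last by apply: idealMr.
      by apply: PJ; apply: idealM => //; apply: sP.
    have -> : s ^+ k.+1 * br g a = s * br g w - s * br g (s ^+ k) * a.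
      by rewrite /w (derM dg) exprS; ring_over T.
    apply: (idealB iJ) => //.
    case: k @w hb Jw => [|k] w hb Jw.
      by rewrite expr0 (der1 dg) mulr0 mul0r; apply: ideal0.
    rewrite (derX _ _ dg) mulrnAr mulrnAl; apply: idealMn => //.
    rewrite mulrA -exprS mulrAC; apply: idealMr => //; by exists b.
  have mS : mult_closed S.
    split; first by exists 1, 0%N; split; [apply: prime_ideal1 | rewrite mulr1].
    move=> _ _ [g [k [hg ->]]] [h [l [hh ->]]]; exists (g * h), (k + l)%N.
    by split; [apply: Qm | rewrite exprD mulrACA].
  have [||X [pX sX IX avX]] := stable_prime_avoiding nat_inv _ iI stI mS.
  - by move=> _ [g ->].
  - move=> _ [g [k [hg ->]]] [l hl]; apply: (no (s ^+ l * g)).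
    by exists k; split; [apply: Qm => //; apply: QX | rewrite -mulrA].
  have XQ : (X `<=` Q)%classic.
    move=> a Xa; apply: contrapT => Qa; apply: (avX a) => //.
    by exists a, 0%N; rewrite mulr1.
  have PX a : P a -> X a.
    by move=> Pa; apply: IX; exists 0%N; rewrite mul1r; apply: PJ.
  have Xu : X u by apply: IX; exists 0%N; rewrite mul1r -[u]mulr1.
  have eXQ : X = Q.
    apply: adj => //; last by move=> h; apply/Pu/h.
    by move=> a b Xb; apply: (sX (br a)) => //; exists a.
  apply: (avX v); last by rewrite eXQ.
  by exists 1, 1%N; split; [apply: prime_ideal1 | rewrite mul1r].
have [t [tQ tJ]] := nT iQ.
(* For a fixed g these elements form an ideal, so it is enough to find one g that works for finitely
   many generators of Q. *)
pose rad g := [set v | exists k, J ((g * v) ^+ k)]%classic.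
have irad g : ideal (rad g).
  split=> [|a b [k hk] [l hl]|a b [k hk]].
  - by exists 1%N; rewrite expr1 mulr0; apply: ideal0.
  - exists (k + l)%N; rewrite mulrDr exprDn; apply: ideal_sum => // i _.
    apply: idealMn => //; have [il|li] := leqP i l.
      by rewrite -addnBA // exprD -mulrA; apply: idealMr.
    by rewrite -(subnKC (ltnW li)) exprD mulrA; apply: idealMr => //; apply: idealM.
  - by exists k; rewrite mulrCA exprMn; apply: idealM.
have [g Qg hg] : exists2 g, ~ Q g & forall x, x \in t -> rad g x.
  elim: t tQ {tJ} => [|x t IH] tQ; first by exists 1 => //; apply: prime_ideal1.
  have [|g Qg hg] := IH; first by move=> y yt; apply: tQ; rewrite inE yt orbT.
  have [h [k [Qh hk]]] := main x (tQ x (mem_head _ _)).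
  exists (h * g); first exact: Qm.
  move=> y; rewrite inE => /predU1P[->|/hg[l hl]].
    exists k.+1; have -> : (h * g * x) ^+ k.+1 = h ^+ k * g ^+ k.+1 * x * (h * x ^+ k).
      by rewrite !exprMn !exprS; ring_over T.
    exact: idealM.
  by exists l; rewrite -mulrA exprMn; apply: idealM.
exists u, g; split=> // v Qv.
by have [k [b hb]] := tJ _ (irad g) hg v Qv; exists k, b.
Qed.

End Adjacent.

(** * Transcendence degree of residue fields *)

Definition mpev (K : fieldType) e (S : comNzRingType) (kap : {rmorphism K -> S})
  (w : 'I_e -> S) : {rmorphism {mpoly K[e]} -> S} := mmap kap w.

Lemma mpevC (K : fieldType) e (S : comNzRingType) (kap : {rmorphism K -> S})
  (w : 'I_e -> S) c : mpev kap w c%:MP = kap c.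
Proof. exact: mmapC. Qed.

Lemma mpevX (K : fieldType) e (S : comNzRingType) (kap : {rmorphism K -> S})
  (w : 'I_e -> S) i : mpev kap w 'X_i = w i.
Proof. by rewrite /mpev /= mmapX mmap1U. Qed.

#[local] Opaque mpev.

Lemma mpev_unique (K : fieldType) e (S : comNzRingType) (kap : {rmorphism K -> S})
    (w : 'I_e -> S) (G : {rmorphism {mpoly K[e]} -> S}) :
  (forall c, G c%:MP = kap c) -> (forall i, G 'X_i = w i) -> G =1 mpev kap w.
Proof.
move=> GC GX; elim/mpoly_ring_ind => [c|i|f g hf hg|f g hf hg].
- by rewrite mpevC.
- by rewrite mpevX.
- by rewrite !rmorphD hf hg.
- by rewrite !rmorphM hf hg.
Qed.

Lemma mpev_rmorph (K : fieldType) e (S S' : comNzRingType) (G : {rmorphism S -> S'})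
    (kap : {rmorphism K -> S}) (kap' : {rmorphism K -> S'}) (w : 'I_e -> S) f :
  (forall c, G (kap c) = kap' c) -> G (mpev kap w f) = mpev kap' (G \o w) f.
Proof.
move=> hk; apply: (mpev_unique (G := G \o mpev kap w)) => [c|i] /=.
  by rewrite mpevC hk.
by rewrite mpevX.
Qed.

Section Separation.
Variables (K : fieldType) (e : nat) (i : 'I_e.+1).

(** Views a polynomial as univariate in X_i over the remaining variables; [mpoly_join] undoes
    this. *)
Definition mpoly_sep : {rmorphism {mpoly K[e.+1]} -> {poly {mpoly K[e]}}} :=
  mpev (polyC \o @mpolyC e K) (fun j => oapp (fun k => ('X_k)%:P) 'X (unlift i j)).

Definition mpoly_lift : {rmorphism {mpoly K[e]} -> {mpoly K[e.+1]}} :=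
  mpev (@mpolyC e.+1 K) (fun k => 'X_(lift i k)).

Definition mpoly_join : {rmorphism {poly {mpoly K[e]}} -> {mpoly K[e.+1]}} :=
  horner_morph (fun a => mulrC ('X_i : {mpoly K[e.+1]}) (mpoly_lift a)).

Lemma mpoly_sepC c : mpoly_sep c%:MP = c%:MP%:P.
Proof. exact: mpevC. Qed.

Lemma mpoly_sepX : mpoly_sep 'X_i = 'X.
Proof. by rewrite /mpoly_sep mpevX unlift_none. Qed.

Lemma mpoly_sep_lift k : mpoly_sep 'X_(lift i k) = ('X_k)%:P.
Proof. by rewrite /mpoly_sep mpevX liftK. Qed.

Lemma mpoly_liftC c : mpoly_lift c%:MP = c%:MP.
Proof. exact: mpevC. Qed.

Lemma mpoly_liftX k : mpoly_lift 'X_k = 'X_(lift i k).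
Proof. exact: mpevX. Qed.

Lemma mpoly_joinC a : mpoly_join a%:P = mpoly_lift a.
Proof. by rewrite /mpoly_join /= horner_morphC. Qed.

Lemma mpoly_joinX : mpoly_join 'X = 'X_i.
Proof. by rewrite /mpoly_join /= horner_morphX. Qed.

#[local] Opaque mpoly_sep mpoly_lift mpoly_join.

Lemma mpoly_sep_of_lift a : mpoly_sep (mpoly_lift a) = a%:P.
Proof.
elim/mpoly_ring_ind: a => [c|k|a b ha hb|a b ha hb].
- by rewrite mpoly_liftC mpoly_sepC.
- by rewrite mpoly_liftX mpoly_sep_lift.
- by rewrite !rmorphD ha hb.
- by rewrite !rmorphM ha hb.
Qed.

Lemma mpoly_sepK : cancel mpoly_sep mpoly_join.
Proof.
elim/mpoly_ring_ind => [c|j|a b ha hb|a b ha hb].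
- by rewrite mpoly_sepC mpoly_joinC mpoly_liftC.
- case: (unliftP i j) => [k ->|->]; last by rewrite mpoly_sepX mpoly_joinX.
  by rewrite mpoly_sep_lift mpoly_joinC mpoly_liftX.
- by rewrite (rmorphD mpoly_sep) (rmorphD mpoly_join); congr (_ + _); [exact: ha | exact: hb].
- by rewrite (rmorphM mpoly_sep) (rmorphM mpoly_join); congr (_ * _); [exact: ha | exact: hb].
Qed.

Lemma mpev_sep (S : comNzRingType) (kap : {rmorphism K -> S}) (w : 'I_e.+1 -> S) f :
  mpev kap w f = (map_poly (mpev kap (w \o lift i)) (mpoly_sep f)).[w i].
Proof.
elim/mpoly_ring_ind: f => [c|j|f g hf hg|f g hf hg].
- by rewrite mpoly_sepC map_polyC hornerC /= !mpevC.
- rewrite mpevX; case: (unliftP i j) => [k ->|->].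
    by rewrite mpoly_sep_lift map_polyC hornerC /= mpevX.
  by rewrite mpoly_sepX map_polyX hornerX.
- by rewrite rmorphD hf hg !rmorphD hornerD.
- by rewrite rmorphM hf hg !rmorphM hornerM.
Qed.

End Separation.

Definition alg_indep (K : fieldType) (S : comNzRingType) (kap : {rmorphism K -> S})
    e (w : 'I_e -> S) := forall f : {mpoly K[e]}, mpev kap w f = 0 -> f = 0.

Section Localization.
Variables (R : comNzRingType) (Om : fieldType) (phi : {rmorphism R -> Om}) (s : R).

(* The extension of phi to R[1/s], the latter presented by R[X]. *)
Definition locev : {rmorphism {poly R} -> Om} :=
  horner_morph (fun a => mulrC (phi s)^-1 (phi a)).

Lemma locevC a : locev a%:P = phi a.
Proof. by rewrite /locev /= horner_morphC. Qed.

Lemma locevX : locev 'X = (phi s)^-1.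
Proof. by rewrite /locev /= horner_morphX. Qed.

End Localization.

#[local] Opaque locev.

(** N and h are chosen before phi, so the same h represents F in the residue fields of both P and
    Q. *)
Lemma clear_denominators (R : comNzRingType) (s : R) (F : {poly R}) :
  exists N h, forall (Om : fieldType) (phi : {rmorphism R -> Om}), phi s != 0 ->
    forall k, phi s ^+ (N + k) * locev phi s F = phi (s ^+ k * h).
Proof.
exists (size F), (\sum_(i < size F) F`_i * s ^+ (size F - i)) => Om phi s0 k.
rewrite {2}[F]poly_coef_expansion rmorph_sum /= rmorphM rmorphXn addnC exprD -mulrA.
congr (_ * _); rewrite rmorph_sum mulr_sumr; apply: eq_bigr => i _.
rewrite !rmorphM !rmorphXn locevC locevX mulrCA; congr (_ * _).
by rewrite -{1}(subnK (ltnW (ltn_ord i))) exprD exprVn mulfK // expf_neq0.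
Qed.

Lemma clear_denominators_family (R : comNzRingType) (s : R) e (F : 'I_e -> {poly R}) :
  exists N h, forall (Om : fieldType) (phi : {rmorphism R -> Om}), phi s != 0 ->
    forall i, phi s ^+ N * locev phi s (F i) = phi (h i).
Proof.
have /choice[N0 /choice[h hh]] i := clear_denominators s (F i).
have le i : (N0 i <= \sum_i N0 i)%N by rewrite (bigD1 i) //= leq_addr.
exists (\sum_i N0 i)%N, (fun i => s ^+ (\sum_i N0 i - N0 i) * h i) => Om phi s0 i.
by rewrite -(hh i Om phi s0) subnKC.
Qed.

(** As s is invertible in both fields, vanishing of F means that one common numerator lies in P,
    respectively in Q. *)
Lemma locev_sub (R : comNzRingType) (P Q : set R) (Om Om' : fieldType) (phi : {rmorphism R -> Om})
    (psi : {rmorphism R -> Om'}) s F :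
  (forall a, phi a = 0 <-> P a) -> (forall a, psi a = 0 <-> Q a) ->
  (P `<=` Q)%classic -> psi s != 0 -> locev phi s F = 0 -> locev psi s F = 0.
Proof.
move=> hP hQ PQ s0 F0; have [N [h hN]] := clear_denominators s F.
have s1 : phi s != 0.
  by apply: contraNneq s0 => /hP/PQ/hQ ->.
have := hN _ phi s1 0%N; rewrite addn0 F0 mulr0 expr0 mul1r => /esym/hP/PQ/hQ.
have := hN _ psi s0 0%N; rewrite addn0 expr0 mul1r => <- /eqP.
by rewrite mulf_eq0 expf_eq0 (negPf s0) andbF => /eqP.
Qed.

(** Under Psi, where q vanishes, a relation shrinks to its constant coefficient, which must be zero;
    under Phi the relation can then be divided by q. *)
Lemma indep_extend (A R : comNzRingType) (Om Om' : fieldType) (ev : {rmorphism A -> R})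
    (Phi : {rmorphism R -> Om}) (Psi : {rmorphism R -> Om'}) q :
  (forall F, Phi F = 0 -> Psi F = 0) -> (forall a, Psi (ev a) = 0 -> a = 0) ->
  Psi q = 0 -> Phi q != 0 ->
  forall F : {poly A}, Phi (map_poly ev F).[q] = 0 -> F = 0.
Proof.
move=> PhiPsi ind Psiq Phiq; elim/poly_ind => // F c IH.
have -> : (map_poly ev (F * 'X + c%:P)).[q] = (map_poly ev F).[q] * q + ev c.
  by rewrite rmorphD hornerD rmorphM hornerM /= map_polyX hornerX map_polyC hornerC.
move=> h.
have c0 : c = 0.
  by apply: ind; have := PhiPsi _ h; rewrite rmorphD rmorphM Psiq mulr0 add0r.
move: h; rewrite c0 rmorph0 addr0 rmorphM => /eqP.
by rewrite mulf_eq0 (negPf Phiq) orbF => /eqP/IH->; rewrite mul0r polyC0 addr0.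
Qed.

Section Dimension.
Variables (K : fieldType) (n : nat).
Notation R := {mpoly K[n]}.
Implicit Types P Q : set R.

(* The fraction field of R / P contains e elements, written over the common
   denominator s, that are algebraically independent over K. *)
Definition has_indep P e := exists (Om : fieldType) (phi : {rmorphism R -> Om}) (s : R)
    (w : 'I_e -> {poly R}),
  [/\ forall a, phi a = 0 <-> P a, phi s != 0
    & alg_indep (phi \o @mpolyC n K) (fun i => locev phi s (w i))].

Lemma has_indep0 P : prime_ideal P -> has_indep P 0.
Proof.
move=> pP; have [Om [phi hphi]] := quotient_field_exists pP.
exists Om, phi, 1, (fun=> 0); split=> //; first by rewrite rmorph1 oner_neq0.
move=> f; have [c ->] := subpoly0 (subpoly_full f); rewrite mpevC.
by move/eqP; rewrite fmorph_eq0 => /eqP->; rewrite mpolyC0.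
Qed.

(** Elements independent modulo Q are independent modulo P, and remain so along with any element of
    Q outside P. *)
Lemma has_indep_sub P Q e : prime_ideal P -> (P `<=` Q)%classic -> ~ (Q `<=` P)%classic ->
  has_indep Q e -> has_indep P e.+1.
Proof.
move=> pP PQ QP [Om' [psi [s [w [hQ s0 ind]]]]].
have [Om [phi hP]] := quotient_field_exists pP.
have [q Qq Pq] : exists2 q, Q q & ~ P q.
  by apply: contrapT => /forall2NP h; apply: QP => f Qf; case: (h f) => // /contrapT.
pose w' j := oapp w q%:P (unlift ord_max j).
exists Om, phi, s, w'; split=> //; first by apply: contraNneq s0 => /hP/PQ/hQ ->.
pose kap : {rmorphism K -> {poly R}} := polyC \o @mpolyC n K.
have evphi f : locev phi s (mpev kap w' f) =
    mpev (phi \o @mpolyC n K) (fun i => locev phi s (w' i)) f.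
  by apply: mpev_rmorph => c; rewrite /= locevC.
have evpsi f : locev psi s (mpev kap w f) =
    mpev (psi \o @mpolyC n K) (fun i => locev psi s (w i)) f.
  by apply: mpev_rmorph => c; rewrite /= locevC.
have main (F : {poly {mpoly K[e]}}) :
    locev phi s (map_poly (mpev kap w) F).[q%:P] = 0 -> F = 0.
  apply: (indep_extend (Psi := locev psi s)) => [G|a||].
  - exact: locev_sub hP hQ PQ s0.
  - by rewrite evpsi; apply: ind.
  - by rewrite locevC; apply/hQ.
  - by rewrite locevC; apply/eqP => /hP.
move=> f; rewrite -evphi (mpev_sep ord_max) => h.
apply: (can_inj (@mpoly_sepK _ _ ord_max)); rewrite rmorph0; apply: main.
rewrite -h /w' unlift_none /=; congr (locev _ _ _.[_]).
apply: eq_map_poly => g; apply: mpev_unique => [c|j]; first exact: mpevC.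
by rewrite mpevX /= liftK.
Qed.

End Dimension.

(** * Bounding transcendence degree by counting dimensions *)

Lemma linear_dependency (K : fieldType) (A B : finType) (M : A -> B -> K) :
  (#|B| < #|A|)%N ->
  exists v : A -> K, (exists a, v a != 0) /\ forall b, \sum_a v a * M a b = 0.
Proof.
move=> BA; pose Mx := \matrix_(i < #|A|, j < #|B|) M (enum_val i) (enum_val j).
have : kermx Mx != 0.
  by rewrite kermx_eq0 -row_leq_rank -ltnNge; apply: leq_ltn_trans (rank_leq_col _) BA.
case/rowV0Pn=> u /sub_kermxP uM u0; exists (fun a => u 0 (enum_rank a)); split.
  apply: contrapT => /forallNP h; move/eqP: u0; apply; apply/rowP=> i.
  by have /negP := h (enum_val i); rewrite enum_valK negbK mxE => /eqP.
move=> b; have /rowP/(_ (enum_rank b)) := uM; rewrite !mxE => {2}<-.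
rewrite (reindex enum_rank) /=; last exact/onW_bij/enum_rank_bij.
by apply: eq_bigr => a _; rewrite mxE !enum_rankK.
Qed.

Section Box.
Variables (K : fieldType) (n : nat).

(** Exponents are bounded one by one rather than in total, so that exactly (N+1)^n monomials are
    allowed. *)
Definition in_box N (p : {mpoly K[n]}) := forall m (i : 'I_n), p@_m != 0 -> (m i <= N)%N.

Lemma in_boxW N N' p : (N <= N')%N -> in_box N p -> in_box N' p.
Proof. by move=> le h m i pm; apply: leq_trans (h m i pm) le. Qed.

Lemma in_box_sum (J : Type) (r : seq J) (P : pred J) (F : J -> {mpoly K[n]}) N :
  (forall j, P j -> in_box N (F j)) -> in_box N (\sum_(j <- r | P j) F j).
Proof.
move=> h; apply: big_ind => [m i|p q hp hq m i|//]; first by rewrite mcoeff0 eqxx.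
rewrite mcoeffD; have [pm|pm _] := eqVneq p@_m 0; last exact: hp.
by rewrite pm add0r; apply: hq.
Qed.

Lemma in_boxM N N' p q : in_box N p -> in_box N' q -> in_box (N + N') (p * q).
Proof.
move=> hp hq m i; rewrite -mcoeff_msupp => /msuppM_le/allpairsP[[m1 m2] /=].
rewrite !mcoeff_msupp => -[h1 h2 ->].
by rewrite mnmDE leq_add ?hp ?hq.
Qed.

Lemma in_box_exists (J : finType) (p : J -> {mpoly K[n]}) :
  exists N, forall j, in_box N (p j).
Proof.
exists (\sum_j msize (p j))%N => j; apply: (@in_boxW (msize (p j))).
  by rewrite (bigD1 j) //= leq_addr.
move=> m i; rewrite -mcoeff_msupp => /msize_mdeg_lt; rewrite mdegE (bigD1 i) //=.
by move=> h; apply: ltnW; apply: leq_ltn_trans h; apply: leq_addr.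
Qed.

Lemma in_box_eq0 N p : in_box N p ->
  (forall m : {ffun 'I_n -> 'I_N.+1}, p@_[multinom val (m i) | i < n] = 0) -> p = 0.
Proof.
move=> hp h; apply/mpolyP=> m; rewrite mcoeff0; apply/eqP; apply: contraT => pm.
have := h [ffun i => inord (m i)]; move/eqP; rewrite -(negPf pm).
suff -> : [multinom val ([ffun i => inord (m i)] i : 'I_N.+1) | i < n] = m by [].
by apply/mnmP=> i; rewrite mnmE ffunE /= inordK // ltnS; apply: hp.
Qed.

End Box.

Section FiniteModules.
Variables (K Om : fieldType) (kap : {rmorphism K -> Om}) (f : nat) (y : 'I_f -> Om).
Notation A := {mpoly K[f]}.
Let ev : {rmorphism A -> Om} := mpev kap y.

Definition in_span (J : finType) (b : J -> Om) N x := exists p : J -> A,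
  (forall j, in_box N (p j)) /\ x = \sum_j ev (p j) * b j.

Lemma in_spanW (J : finType) (b : J -> Om) N N' x :
  (N <= N')%N -> in_span b N x -> in_span b N' x.
Proof.
by move=> le [p [hp ->]]; exists p; split=> // j; apply: in_boxW (hp j).
Qed.

Lemma in_span_sum (J : finType) (b : J -> Om) N (I : finType) (F : I -> Om) :
  (forall i, in_span b N (F i)) -> in_span b N (\sum_i F i).
Proof.
move=> /choice[p hp]; exists (fun j => \sum_i p i j); split=> [j|].
  by apply: in_box_sum => i _; have [] := hp i.
rewrite (eq_bigr _ (fun i _ => (hp i).2)) exchange_big /=; apply: eq_bigr => j _.
by rewrite rmorph_sum mulr_suml.
Qed.

Lemma in_span_scale (J : finType) (b : J -> Om) N N' p x :
  in_box N p -> in_span b N' x -> in_span b (N + N') (ev p * x).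
Proof.
move=> hp [q [hq ->]]; exists (fun j => p * q j); split=> [j|]; first exact: in_boxM.
by rewrite mulr_sumr; apply: eq_bigr => j _; rewrite rmorphM mulrA.
Qed.

Lemma in_span_mul (J : finType) (b : J -> Om) C N z x :
  (forall j, in_span b C (z * b j)) -> in_span b N x -> in_span b (N + C) (z * x).
Proof.
move=> hz [p [hp ->]]; rewrite mulr_sumr; apply: in_span_sum => j.
by rewrite mulrCA; apply: in_span_scale.
Qed.

Lemma in_span_mul_iter (J : finType) (b : J -> Om) C N z x k :
  (forall j, in_span b C (z * b j)) -> in_span b N x ->
  in_span b (N + k * C) (z ^+ k * x).
Proof.
move=> hz hx; elim: k => [|k IH]; first by rewrite mul1r addn0.
by rewrite exprS -mulrA mulSn addnCA addnC; apply: in_span_mul.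
Qed.

(** The elements are adjoined one at a time: the family is multiplied by the powers of z below the
    degree of its monic equation, and C grows by a bound on the exponents in the coefficients of
    that equation. *)
Lemma integral_span (zs : seq Om) : (forall z, z \in zs -> integralOver ev z) ->
  exists (J : finType) (b : J -> Om) (C : nat), (exists j, b j != 0) /\
    forall z, z \in zs -> forall j, in_span b C (z * b j).
Proof.
elim: zs => [|z zs IH] hzs.
  exists unit, (fun=> 1), 0%N; split=> //; exists tt; exact: oner_neq0.
have [|J [b [C [[j0 bj0] hC]]]] := IH.
  by move=> x xs; apply: hzs; rewrite inE xs orbT.
have [p pm rp] := hzs z (mem_head _ _).
pose dl := (size p).-1.
have sp : size p = dl.+1 by rewrite /dl prednK // size_poly_gt0 monic_neq0.
have zdl : z ^+ dl = - \sum_(k < dl) ev p`_k * z ^+ k.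
  move: rp; rewrite /root (horner_coef_wide _ (n := dl.+1)); last first.
    by rewrite -sp; apply: size_poly.
  rewrite big_ord_recr /= !coef_map /=; have := monicP pm; rewrite lead_coefE sp /= => ->.
  rewrite rmorph1 mul1r addrC addr_eq0 => /eqP->; congr (- _).
  by apply: eq_bigr => k _; rewrite coef_map.
have dl0 : (0 < dl)%N.
  rewrite lt0n; apply/eqP => e; move: zdl; rewrite e big_ord0 oppr0 expr0.
  by move/eqP; rewrite oner_eq0.
pose b' (jk : J * 'I_dl) := b jk.1 * z ^+ jk.2.
have [B hB] := in_box_exists (fun k : 'I_dl => p`_k).
have one : in_box 0 (1 : A).
  by move=> m i; rewrite mcoeff1; have [->|] := eqVneq m 0%MM; rewrite ?mnm0E ?eqxx.
have box0 N : in_box N (0 : A) by move=> m i; rewrite mcoeff0 eqxx.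
have emb N x (k : 'I_dl) : in_span b N x -> in_span b' N (x * z ^+ k).
  move=> [q [hq ->]]; exists (fun jk => if jk.2 == k then q jk.1 else 0); split.
    by move=> [j l] /=; case: ifP.
  pose G j l := ev (if l == k then q j else 0) * b' (j, l).
  rewrite (eq_bigr (fun jk => G jk.1 jk.2)); last by case.
  rewrite -(pair_bigA _ G) /G /=.
  rewrite mulr_suml; apply: eq_bigr => j _.
  rewrite (bigD1 k) //= eqxx big1 ?addr0 /b' /=; last first.
    by move=> l /negPf->; rewrite rmorph0 mul0r.
  by rewrite mulrA.
have unit_span j : in_span b 0 (b j).
  exists (fun l => if l == j then 1 else 0); split=> [l|]; first by case: ifP.
  rewrite (bigD1 j) //= eqxx rmorph1 mul1r big1 ?addr0 // => l /negPf->.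
  by rewrite rmorph0 mul0r.
exists (J * 'I_dl)%type, b', (C + B)%N; split.
  by exists (j0, Ordinal dl0); rewrite /b' expr0 mulr1.
move=> x; rewrite inE => /predU1P[->|xs] [j k].
  have -> : z * b' (j, k) = b j * z ^+ k.+1 by rewrite /b' /= mulrCA exprS.
  have [kd|kd] := ltnP k.+1 dl.
    apply: (@in_spanW _ _ 0) => //; exact: emb (Ordinal kd) (unit_span j).
  have -> : k.+1 = dl by apply/eqP; rewrite eqn_leq kd ltn_ord.
  rewrite zdl mulrN mulr_sumr -sumrN; apply: in_span_sum => l.
  rewrite mulrCA -mulrN mulrN -mulNr -rmorphN; apply: (@in_spanW _ _ (B + 0)).
    by rewrite addn0 leq_addl.
  apply: in_span_scale; last exact: emb.
  by move=> m i; rewrite mcoeffN oppr_eq0; apply: hB.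
rewrite /b' mulrA /=; apply: (@in_spanW _ _ C); first exact: leq_addr.
by apply: emb; apply: hC.
Qed.

(* A dimension count: the monomials in w with all exponents below N number N^d,
   while c^(dN) times each of them lies in a space of dimension O(N^f). *)
Lemma alg_indep_leq d (w : 'I_d -> Om) c : alg_indep kap w -> c != 0 ->
  integralOver ev c -> (forall i, integralOver ev (c * w i)) -> (d <= f)%N.
Proof.
move=> ind c0 ic icw; rewrite leqNgt; apply/negP => fd.
pose zs := c :: codom (fun i => c * w i).
have [|J [b [C [[j0 bj0] hC]]]] := @integral_span zs.
  by move=> z; rewrite inE => /predU1P[->//|/codomP[i ->]].
have hc := hC c (mem_head _ _).
have hcw i : forall j, in_span b C (c * w i * b j).
  by apply: hC; rewrite inE codom_f orbT.
(* The target space has dimension at most #|J| (C d + 1)^f N^f; this N makes it smaller than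
   N^(f+1), hence than N^d when d > f. *)
pose N := (#|J| * (C * d).+1 ^ f).+1.
pose L := {ffun 'I_d -> 'I_N}.
have unit_span : in_span b 0 (b j0).
  exists (fun l => if l == j0 then 1 else 0); split=> [l m i|].
    case: ifP; last by rewrite mcoeff0 eqxx.
    by rewrite mcoeff1; have [->|] := eqVneq m 0%MM; rewrite ?mnm0E ?eqxx.
  rewrite (bigD1 j0) //= eqxx rmorph1 mul1r big1 ?addr0 // => l /negPf->.
  by rewrite rmorph0 mul0r.
have mono (a : L) : in_span b (C * (d * N)) (c ^+ (d * N) * \prod_i w i ^+ a i * b j0).
  have : forall (r : seq 'I_d), in_span b (C * (size r * N))
      (c ^+ (size r * N) * \prod_(i <- r) w i ^+ a i * b j0).
    elim=> [|i r IH]; first by rewrite mul0n muln0 big_nil expr0 !mul1r.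
    have lt := ltnW (ltn_ord (a i)).
    have := in_span_mul_iter (a i) (hcw i) IH.
    move/(in_span_mul_iter (N - a i) hc); rewrite big_cons /=.
    have -> : (C * (size r * N) + a i * C + (N - a i) * C = C * ((size r).+1 * N))%N.
      by rewrite -addnA -mulnDl subnKC // mulSn mulnDr addnC [(N * C)%N]mulnC.
    move=> h; have -> : c ^+ ((size r).+1 * N) * (w i ^+ a i * \prod_(j <- r) w j ^+ a j) * b j0 =
      c ^+ (N - a i) * ((c * w i) ^+ a i *
        (c ^+ (size r * N) * \prod_(j <- r) w j ^+ a j * b j0)); last exact: h.
    have eN : c ^+ N = c ^+ (N - a i) * c ^+ a i by rewrite -exprD subnK.
    by rewrite exprMn mulSn exprD eN; ring_over Om.
  by move=> /(_ (index_enum _)); rewrite -[index_enum _]enumT size_enum_ord.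
have /choice[p hp] := mono.
pose M (a : L) (jm : J * {ffun 'I_f -> 'I_(C * (d * N)).+1}) :=
  (p a jm.1)@_[multinom val (jm.2 i) | i < f].
have card : (#|{: J * {ffun 'I_f -> 'I_(C * (d * N)).+1}}| < #|{: L}|)%N.
  rewrite card_prod !card_ffun !card_ord.
  have h1 : (#|J| * (C * (d * N)).+1 ^ f <= #|J| * (C * d).+1 ^ f * N ^ f)%N.
    rewrite -mulnA leq_mul2l -expnMn; apply/orP; right.
    case: (posnP f) => [->//|f0]; rewrite leq_exp2r //.
    by rewrite mulSn mulnA addnC -addn1 leq_add2l.
  apply: leq_ltn_trans h1 _; apply: (@leq_trans (N ^ f.+1)).
    by rewrite expnS ltn_pmul2r // expn_gt0.
  by rewrite leq_pexp2l.
have [v [[a0 va0] hv]] := linear_dependency M card.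
have vp j : \sum_a v a *: p a j = 0.
  apply: (@in_box_eq0 _ _ (C * (d * N))).
    apply: in_box_sum => a _ m i; rewrite mcoeffZ mulf_eq0 negb_or => /andP[_].
    exact: (hp a).1.
  move=> m; rewrite raddf_sum -[RHS](hv (j, m)); apply: eq_bigr => a _.
  by rewrite /= mcoeffZ.
have : \sum_a kap (v a) * \prod_i w i ^+ a i = 0.
  apply: (mulfI (expf_neq0 (d * N) c0)); apply: (mulIf bj0).
  rewrite mulr0 mul0r mulr_sumr mulr_suml.
  transitivity (\sum_j ev (\sum_a v a *: p a j) * b j); last first.
    by rewrite big1 // => j _; rewrite vp rmorph0 mul0r.
  under [RHS]eq_bigr => j _ do rewrite rmorph_sum mulr_suml.
  rewrite exchange_big /=; apply: eq_bigr => a _.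
  rewrite [c ^+ _ * _]mulrCA -mulrA (hp a).2 mulr_sumr; apply: eq_bigr => j _.
  by rewrite -mul_mpolyC rmorphM /ev mpevC mulrA.
move=> sum0; pose F : {mpoly K[d]} := \sum_a v a *: 'X_[[multinom val (a i) | i < d]].
have F0 : F = 0.
  apply: ind; rewrite rmorph_sum -[RHS]sum0 /=; apply: eq_bigr => a _.
  rewrite -mul_mpolyC rmorphM mpevC; congr (_ * _).
  rewrite mpolyXE_id rmorph_prod; apply: eq_bigr => i _.
  by rewrite rmorphXn mpevX mnmE.
have := congr1 (mcoeff [multinom val (a0 i) | i < d]) F0.
rewrite mcoeff0 raddf_sum (bigD1 a0) //= big1 => [|a aa0].
  by rewrite mcoeffZ mcoeffX eqxx mulr1 addr0 => /eqP; rewrite (negPf va0).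
rewrite mcoeffZ mcoeffX; case: eqP => [e|]; last by rewrite mulr0.
case/eqP: aa0; apply/ffunP=> i; apply: val_inj.
by have /mnmP/(_ i) := e; rewrite !mnmE.
Qed.

End FiniteModules.

Lemma base_expansion_inj r m (g h : 'I_m -> nat) :
  (forall i, (g i < r)%N) -> (forall i, (h i < r)%N) ->
  \sum_i (g i * r ^ i)%N = \sum_i (h i * r ^ i)%N -> g =1 h.
Proof.
elim: m g h => [|m IH] g h hg hh; first by move=> _ [].
have split0 (k : 'I_m.+1 -> nat) :
    \sum_i (k i * r ^ i)%N = ((\sum_i k (lift ord0 i) * r ^ i) * r + k ord0)%N.
  rewrite big_ord_recl expn0 muln1 addnC; congr (_ + _)%N.
  by rewrite big_distrl /=; apply: eq_bigr => i _; rewrite /bump add1n expnSr mulnA.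
rewrite !split0 => e; have r0 : (0 < r)%N by apply: leq_ltn_trans (hg ord0).
have e0 : g ord0 = h ord0.
  by have := congr1 (modn^~ r) e; rewrite /= !modnMDl !modn_small.
move=> i; case: (unliftP ord0 i) => [j ->|->] //.
apply: (IH (g \o lift ord0) (h \o lift ord0)) => [k|k|] /=; [exact: hg|exact: hh|].
by have := congr1 (divn^~ r) e; rewrite /= !divnMDl // !divn_small // !addn0.
Qed.

Lemma exists_maximum (T : eqType) (wt : T -> nat) (s : seq T) : s != [::] ->
  exists2 x, x \in s & forall z, z \in s -> (wt z <= wt x)%N.
Proof.
elim: s => // a [|b s] IH _; first by exists a => [|z]; rewrite inE // => /eqP->.
have [x xs hx] := IH isT; have [ax|xa] := leqP (wt a) (wt x).
  by exists x => [|z]; rewrite inE ?xs ?orbT // => /predU1P[->|/hx].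
exists a => [|z]; rewrite inE ?eqxx // => /predU1P[->//|/hx zx].
exact: leq_trans zx (ltnW xa).
Qed.

(** * Noether normalization *)

Section NoetherNormalization.
Variables (K Om : fieldType) (kap : {rmorphism K -> Om}) (B : set Om).
Hypothesis Bkap : forall c, B (kap c).
Hypothesis BD : forall a b, B a -> B b -> B (a + b).
Hypothesis BM : forall a b, B a -> B b -> B (a * b).

Lemma mpev_integral d (y : 'I_d -> Om) m (kap' : {rmorphism K -> {poly Om}})
    (t : 'I_m -> {poly Om}) (f : {mpoly K[m]}) :
  (forall c j, integralOver (mpev kap y) (kap' c)`_j) ->
  (forall i j, integralOver (mpev kap y) (t i)`_j) ->
  forall j, integralOver (mpev kap y) (mpev kap' t f)`_j.
Proof.
move=> hk ht; elim/mpoly_ring_ind: f => [c|i|f g hf hg|f g hf hg] j.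
- by rewrite mpevC.
- by rewrite mpevX.
- by rewrite rmorphD coefD; apply: integral_add.
- rewrite rmorphM coefM; apply: big_ind => [||k _].
  + exact: integral0.
  + exact: integral_add.
  + exact: integral_mul.
Qed.

(* Substituting w_i = t_i + X^(r^i), with r larger than all exponents of f,
   gives the monomials of f distinct degrees in X. *)
Lemma substitution_lead_coef m (t : 'I_m -> Om) (f : {mpoly K[m]}) r :
  f != 0 -> (0 < r)%N -> (forall e i, e \in msupp f -> (e i < r)%N) ->
  exists2 c, c != 0 &
    lead_coef (mpev (polyC \o kap) (fun i : 'I_m => 'X^(r ^ i) + (t i)%:P) f) = kap c.
Proof.
move=> f0 r0 hr; set tX := fun i : 'I_m => _; pose wt (e : 'X_{1..m}) := (\sum_i e i * r ^ i)%N.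
have [|e0 e0f max_e0] := exists_maximum wt (s := msupp f).
  by rewrite msupp_eq0.
pose H (e : 'X_{1..m}) := \prod_i tX i ^+ e i.
have HM e : H e \is monic /\ size (H e) = (wt e).+1.
  pose MD (p : {poly Om}) d := p \is monic /\ size p = d.+1.
  have MDM p d q d' : MD p d -> MD q d' -> MD (p * q) (d + d')%N.
    move=> [pm sp] [qm sq]; split; first exact: rpredM.
    by rewrite size_monicM ?monic_neq0 // sp sq addSn /= addnS.
  apply: (@big_ind2 _ _ MD 1 *%R 0%N addn) => [|//|i _].
    by split; [exact: rpred1 | rewrite size_poly1].
  have ti : MD (tX i) (r ^ i)%N.
    by split; [apply: monicXnaddC | apply: size_XnaddC]; rewrite expn_gt0 r0.
  elim: (e i) => [|k IH]; first by split; [exact: rpred1 | rewrite expr0 size_poly1].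
  by rewrite exprS mulSn; apply: MDM.
have HMm e := (HM e).1; have HMs e := (HM e).2.
have fE : mpev (polyC \o kap) tX f = \sum_(e <- msupp f) (kap f@_e)%:P * H e.
  rewrite {1}[f]mpolyE rmorph_sum; apply: eq_bigr => e _.
  rewrite -mul_mpolyC rmorphM mpevC; congr (_ * _).
  by rewrite mpolyXE_id rmorph_prod; apply: eq_bigr => i _; rewrite rmorphXn mpevX.
set G := mpev _ _ _ in fE *; have coefG : G`_(wt e0) = kap f@_e0.
  rewrite fE coef_sum (bigD1_seq e0) //= ?msupp_uniq // coefCM.
  have := monicP (HMm e0); rewrite lead_coefE HMs /= => ->; rewrite mulr1.
  rewrite big1_seq ?addr0 // => e /andP[ee0 ef]; rewrite coefCM nth_default ?mulr0 //.
  rewrite HMs ltn_neqAle max_e0 // andbT; apply: contra ee0 => /eqP ew.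
  by apply/eqP/mnmP; apply: (@base_expansion_inj r) => // i; apply: hr.
have fe0 : f@_e0 != 0 by rewrite -mcoeff_msupp.
exists f@_e0 => //; rewrite -coefG lead_coefE; congr (_`_ _).
have szG : (size G <= (wt e0).+1)%N.
  rewrite fE; apply: (leq_trans (size_sum _ _ _)).
  apply/bigmax_leqP_seq => e ef _; rewrite mul_polyC.
  by apply: leq_trans (size_scale_leq _ _) _; rewrite HMs ltnS max_e0.
suff : (wt e0 < size G)%N by move: szG; lia.
by rewrite ltnNge; apply: contra fe0 => /(nth_default 0)/eqP; rewrite coefG fmorph_eq0.
Qed.

(** The set B will be the image of R[1/g]. The new variables must lie in it, so that they can also
    be evaluated in the residue field of Q. *)
Theorem noether_normalization m (w : 'I_m -> Om) : (forall i, B (w i)) ->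
  exists d (y : 'I_d -> Om), [/\ forall i, B (y i), alg_indep kap y
    & forall i, integralOver (mpev kap y) (w i)].
Proof.
elim: m w => [|m IH] w Bw.
  exists 0%N, w; split=> [//|f|[//]]; have [c ->] := subpoly0 (subpoly_full f).
  by rewrite mpevC => /eqP; rewrite fmorph_eq0 => /eqP->; rewrite mpolyC0.
have [ind|/existsNP[f /not_implyP[fw f0]]] := pselect (alg_indep kap w).
  exists m.+1, w; split=> // i; rewrite -(mpevX kap w i); exact: integral_id.
have [r hr] : exists r, forall e i, e \in msupp f -> (e i < r)%N.
  have [N hN] := in_box_exists (fun _ : unit => f); exists N.+1 => e i.
  by rewrite mcoeff_msupp ltnS => /(hN tt).
have fn0 : f != 0 by apply/eqP.
have r0 : (0 < r)%N.
  have : msupp f != [::] by rewrite msupp_eq0.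
  case E: (msupp f) => [|e s] // _; apply: leq_ltn_trans (hr e ord0 _) => //.
  by rewrite E mem_head.
(* Nagata's change of variables. As r^0 = 1, the element of index 0 becomes zero, and only m
   elements remain for the induction. *)
pose t i := w i - w ord0 ^+ (r ^ i).
have Bt i : B (t i).
  apply: BD => //; rewrite -mulN1r -(rmorph1 kap) -rmorphN; apply: BM => //.
  elim: (r ^ i)%N => [|k IHk]; first by rewrite expr0 -(rmorph1 kap).
  by rewrite exprS; apply: BM.
have [d [y [By indy inty]]] := IH (t \o lift ord0) (fun i => Bt _).
exists d, y; split=> //.
have tint i : integralOver (mpev kap y) (t i).
  case: (unliftP ord0 i) => [j ->|->]; first exact: inty.
  by rewrite /t expn0 expr1 subrr; apply: integral0.
pose tX (i : 'I_m.+1) : {poly Om} := 'X^(r ^ i) + (t i)%:P.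
pose G := mpev (polyC \o kap) tX f.
have [c c0 lG] := substitution_lead_coef t fn0 r0 hr; rewrite -/tX -/G in lG.
have constint p j : integralOver (mpev kap y) (kap p)%:P`_j.
  rewrite coefC; case: eqP => _; last exact: integral0.
  by rewrite -(mpevC kap y); apply: integral_id.
have Gint j : integralOver (mpev kap y) G`_j.
  apply: mpev_integral => [p k|i k]; first exact: constint.
  rewrite coefD coefXn coefC; apply: integral_add; first exact: integral_nat.
  by case: eqP => _; [apply: tint | apply: integral0].
have w0int : integralOver (mpev kap y) (w ord0).
  apply: (@integral_root_monic _ _ _ _ ((kap c)^-1 *: G)).
  - by rewrite monicE lead_coefZ lG mulVf // fmorph_eq0.
  - rewrite /root hornerZ; have -> : G.[w ord0] = mpev kap w f.
      pose ho : {rmorphism {poly Om} -> Om} := horner_eval (w ord0).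
      apply: (mpev_unique (G := ho \o mpev (polyC \o kap) tX)) => [p|i].
        by rewrite /= mpevC /= /horner_eval hornerC.
      by rewrite /= mpevX /= /horner_eval /tX hornerD hornerXn hornerC /t addrC subrK.
    by rewrite fw mulr0.
  - apply/integral_poly => j; rewrite coefZ; apply: integral_mul => //.
    by rewrite -fmorphV -(mpevC kap y); apply: integral_id.
move=> i; have -> : w i = t i + w ord0 ^+ (r ^ i) by rewrite /t subrK.
apply: integral_add => //; elim: (r ^ i)%N => [|k IHk].
  by rewrite expr0; apply: integral1.
by rewrite exprS; apply: integral_mul.
Qed.

End NoetherNormalization.

(** * Minimal polynomials over completely integrally closed domains *)

Definition divides (A : comNzRingType) (a b : A) := exists c, b = a * c.

(** A condition on the fraction a / l, stated without fractions: if all its powers admit the common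
    denominator [dl], it lies in A. *)
Definition completely_integrally_closed (A : idomainType) := forall l dl a : A,
  l != 0 -> dl != 0 -> (forall s, divides (l ^+ s) (dl * a ^+ s)) -> divides l a.

(* The leading monomial of l divides that of a, and subtracting the
   corresponding multiple of l from a preserves the hypothesis. *)
Lemma mpoly_completely_integrally_closed (K : fieldType) n :
  completely_integrally_closed {mpoly K[n]}.
Proof.
move=> l dl a l0 dl0; elim/mleadrect: a => a IH ha.
have [->|a0] := eqVneq a 0; first by exists 0; rewrite mulr0.
have la i : (mlead l i <= mlead a i)%N.
  rewrite leqNgt; apply/negP => lt; pose s := (mlead dl i).+1.
  have [c hc] := ha s; have c0 : c != 0.
    apply/eqP => c0; move/eqP: hc.
    by rewrite c0 mulr0 mulf_eq0 expf_eq0 (negPf dl0) (negPf a0) andbF.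
  have := congr1 (fun p => mlead p i) hc.
  rewrite !mleadM ?expf_neq0 // !mleadX // !mnmDE !mulmnE /s => e.
  suff : (mlead dl i + mlead a i * s < mlead l i * s + mlead c i)%N by rewrite e ltnn.
  by rewrite /s; nia.
pose t := (mleadc a / mleadc l) *: 'X_[mlead a - mlead l].
have lc0 : mleadc l != 0 by rewrite mleadc_eq0.
have ac0 : mleadc a != 0 by rewrite mleadc_eq0.
have t0 : mleadc a / mleadc l != 0 by rewrite mulf_neq0 // invr_eq0.
have tn0 : t != 0 by rewrite scaler_eq0 (negPf t0) /= -msupp_eq0 msuppX.
have lt : (mlead l + mlead t)%MM = mlead a.
  by rewrite mleadZ // mleadXm; apply/mnmP=> i; rewrite mnmDE mnmBE subnKC.
have mt : mlead (l * t) = mlead a by rewrite mleadM.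
have ct : (l * t)@_(mlead a) = mleadc a.
  rewrite -{1}lt mleadcM mleadcZE mleadXm mcoeffX eqxx mulr1.
  by rewrite mulrCA divff // mulr1.
pose a' := a - l * t.
have ha' : forall s, divides (l ^+ s) (dl * a' ^+ s).
  move=> s; rewrite /a' exprBn mulr_sumr.
  apply: (big_ind (divides (l ^+ s))) => [|x y [p ->] [q ->]|i _].
  - by exists 0; rewrite mulr0.
  - by exists (p + q); rewrite mulrDr.
  - have [c hc] := ha (s - i)%N.
    exists (c * ((-1) ^+ i * t ^+ i) *+ 'C(s, i)).
    rewrite !mulrnAr; congr (_ *+ _).
    have e : l ^+ s = l ^+ (s - i) * l ^+ i by rewrite -exprD subnK // -ltnS.
    have -> : dl * ((-1) ^+ i * a ^+ (s - i) * (l * t) ^+ i) =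
      (dl * a ^+ (s - i)) * ((-1) ^+ i * (l * t) ^+ i) by ring_over {mpoly K[n]}.
    by rewrite hc e exprMn; ring_over {mpoly K[n]}.
have [c hc] : divides l a'; last first.
  by exists (c + t); rewrite mulrDr -hc /a' subrK.
have [->|a'0] := eqVneq a' 0; first by exists 0; rewrite mulr0.
apply: IH => //; rewrite lt_neqAle; apply/andP; split.
  apply: contra a'0 => /eqP e; rewrite -mleadc_eq0 e /a' mcoeffB ct subrr //.
by have := mleadB_le a (l * t); rewrite mt joinxx.
Qed.

Lemma dividesD (A : comNzRingType) (l a b : A) :
  divides l a -> divides l b -> divides l (a + b).
Proof. by move=> [c ->] [d ->]; exists (c + d); rewrite mulrDr. Qed.

Lemma dividesM (A : comNzRingType) (l a b : A) : divides l a -> divides l (a * b).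
Proof. by move=> [c ->]; exists (c * b); rewrite mulrA. Qed.

(** The coefficients are recovered from the values at 0, 1, 2, ... by inverting a Vandermonde
    matrix, whose determinant is a product of positive integers. *)
Lemma divides_coefs (A : idomainType) (l : A) (q : {poly A}) :
  (forall k, exists c : A, c * k.+1%:R = 1) ->
  (forall k : nat, divides l q.[k%:R]) -> forall j, divides l q`_j.
Proof.
move=> nat_inv hq j; have [sj|js] := leqP (size q) j.
  by rewrite nth_default //; exists 0; rewrite mulr0.
pose N := size q; pose a : 'rV[A]_N := \row_j (j : nat)%:R.
pose V := Vandermonde N a; pose qv : 'rV[A]_N := \row_i q`_i.
have Vu : V \in unitmx.
  rewrite unitmxE det_Vandermonde; apply: rpred_prod => i _; apply: rpred_prod => k ik.
  rewrite !mxE -natrB ?(ltnW ik) //.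
  have : (0 < k - i)%N by rewrite subn_gt0.
  case: (k - i)%N => // d _; have [c hc] := nat_inv d.
  by apply/unitrPr; exists c; rewrite mulrC.
have : qv = qv *m V *m invmx V by rewrite mulmxK.
move/rowP/(_ (Ordinal js)); rewrite mxE /= => ->.
rewrite mxE; apply: (big_ind (divides l)) => [||k _].
- by exists 0; rewrite mulr0.
- by move=> x y; apply: dividesD.
apply: dividesM; have -> : (qv *m V) 0 k = q.[k%:R]; last exact: hq.
rewrite mxE horner_coef; apply: eq_bigr => i _.
by rewrite !mxE.
Qed.

Section MinimalPolynomial.
Variables (A : idomainType) (Om : fieldType) (ev : {rmorphism A -> Om}).
Hypothesis ev_inj : forall a, ev a = 0 -> a = 0.
Hypothesis nat_inv : forall k, exists c : A, c * k.+1%:R = 1.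
Hypothesis closedA : completely_integrally_closed A.
Local Notation "p ^ev" := (map_poly ev p) (at level 2).

Definition minimal_annihilator (q : {poly A}) x := [/\ q != 0, q^ev.[x] = 0
  & forall r : {poly A}, r^ev.[x] = 0 -> (size r < size q)%N -> r = 0].

(** Pseudo-division that remembers only the value at x; the power of the leading coefficient depends
    on the size bound k alone. *)
Lemma pseudo_reduce (q : {poly A}) t x : size q = t.+1 -> q^ev.[x] = 0 ->
  forall k (F : {poly A}), (size F <= k)%N -> exists B : {poly A},
    (size B <= t)%N /\ B^ev.[x] = ev (lead_coef q) ^+ k * F^ev.[x].
Proof.
move=> sq qx; set l := lead_coef q; elim=> [|k IH] F sF.
  exists 0; rewrite size_poly0; split=> //; move: sF; rewrite leqn0 size_poly_eq0 => /eqP->.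
  by rewrite rmorph0 horner0 mulr0.
have [Ft|tF] := leqP (size F) t.
  exists (l ^+ k.+1 *: F); split; first exact: leq_trans (size_scale_leq _ _) Ft.
  by rewrite -mul_polyC rmorphM /= map_polyC hornerM hornerC /= rmorphXn.
have tk : (t <= k)%N by rewrite -ltnS; apply: leq_trans tF sF.
pose F' := l *: F - F`_k *: (q * 'X^(k - t)).
have sF' : (size F' <= k)%N.
  apply/leq_sizeP => j; rewrite leq_eqVlt => /predU1P[<-|kj].
    rewrite coefB !coefZ coefMXn ltnNge leq_subr /= subKn // mulrC.
    by rewrite /l lead_coefE sq subrr.
  rewrite coefB !coefZ coefMXn [F`_j]nth_default; last exact: leq_trans sF kj.
  rewrite [q`_ _]nth_default; first by rewrite if_same !mulr0 subrr.
  by rewrite sq; move: kj tk; lia.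
have [B [sB hB]] := IH F' sF'; exists B; split=> //; rewrite hB.
rewrite /F' -!mul_polyC rmorphB !rmorphM /= !map_polyC hornerD hornerN !hornerM qx !hornerC.
by rewrite mul0r mulr0 subr0 exprSr mulrA.
Qed.

Lemma minimal_annihilator_exists x : integralOver ev x ->
  exists q, minimal_annihilator q x.
Proof.
move=> [p pm /rootP px].
have ex : exists k, `[< exists q : {poly A}, [/\ q != 0, q^ev.[x] = 0 & size q = k] >].
  by exists (size p); apply/asboolP; exists p; split=> //; apply: monic_neq0.
case: (ex_minnP ex) => k /asboolP[q [q0 qx sq]] mink; exists q; split=> // r rx rq.
apply/eqP; apply: contraT => r0; have : (k <= size r)%N.
  by apply: mink; apply/asboolP; exists r.
by rewrite leqNgt -sq rq.
Qed.

Lemma det_scaled_companion t (l : A) (c : nat -> A) :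
  \det (\matrix_(i < t.+1, j < t.+1)
    (if (i < t)%N then l * (j == i.+1 :> nat)%:R else c j)) =
  c 0%N * ((-1) ^+ t * l ^+ t).
Proof.
set M := \matrix_(_, _) _; rewrite (expand_det_col _ ord0) (bigD1 ord_max) //=.
rewrite big1 ?addr0 => [|i ne]; last first.
  rewrite mxE; have -> : (i < t)%N.
    rewrite ltn_neqAle -ltnS ltn_ord andbT; apply: contra ne => /eqP e.
    by apply/eqP/val_inj.
  by rewrite mulr0 mul0r.
rewrite mxE /= ltnn; congr (_ * _); rewrite /cofactor /= addn0; congr (_ * _).
rewrite -det_scalar; congr (\det _); apply/matrixP=> i j.
have bi : bump t i = i by rewrite /bump leqNgt ltn_ord.
by rewrite !mxE /= bi ltn_ord /bump /= add1n eqSS eq_sym mulr_natr.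
Qed.

(* Multiplication by x on the powers 1, x, ..., x^(t-1) has determinant
   q_0 / l up to sign.  As x is integral, the powers of its matrix have bounded
   denominators, hence so have the powers of q_0 / l. *)
Lemma lead_divides_const q x : minimal_annihilator q x -> integralOver ev x ->
  divides (lead_coef q) q`_0.
Proof.
move=> [q0 qx minq] [p pm /rootP px]; set l := lead_coef q.
have l0 : l != 0 by rewrite lead_coef_eq0.
have [t sq] : exists t, size q = t.+2.
  case E: (size q) => [|[|t]]; last by exists t.
    by move/eqP: E; rewrite size_poly_eq0 (negPf q0).
  have /size1_polyC e : (size q <= 1)%N by rewrite E.
  by move: qx q0; rewrite e map_polyC hornerC => /ev_inj->; rewrite polyC0 eqxx.
pose dl := (size p).-1.
have sp : size p = dl.+1 by rewrite /dl prednK // size_poly_gt0 monic_neq0.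
have evl0 : ev l != 0 by apply: contra_neq l0; apply: ev_inj.
(* Reduction by the monic p costs nothing and leaves size at most [dl]; reduction by q then costs
   l^dl, a denominator independent of s. *)
have /choice[B hB] (s : nat) : exists B : {poly A},
    (size B <= t.+1)%N /\ B^ev.[x] = ev l ^+ dl * x ^+ s.
  have [B1 [sB1 hB1]] := pseudo_reduce sp px (leqnn (size ('X^s : {poly A}))).
  have [B [sB hB]] := pseudo_reduce sq qx sB1; exists B; split=> //.
  rewrite hB hB1 (monicP pm) rmorph1 expr1n mul1r map_polyXn hornerXn //.
pose Bm s := \matrix_(i < t.+1, j < t.+1) (B (s + i)%N)`_j.
pose C := \matrix_(i < t.+1, j < t.+1)
  (if (i < t)%N then l * (j == i.+1 :> nat)%:R else - q`_j).
have rowB s i : \sum_j ev (Bm s i j) * x ^+ j = ev l ^+ dl * x ^+ (s + i).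
  have [sB <-] := hB (s + i)%N; rewrite (horner_coef_wide _ (n := t.+1)).
    by apply: eq_bigr => j _; rewrite mxE coef_map.
  exact: leq_trans (size_poly _ _) sB.
have rowC i : \sum_j ev (C i j) * x ^+ j = ev l * x ^+ i.+1.
  have [it|ti] := ltnP i t.
    rewrite (bigD1 (inord i.+1)) //= mxE it inordK // eqxx mulr1.
    rewrite big1 ?addr0 // => j ji; rewrite mxE it.
    case: eqP => [e|_]; last by rewrite mulr0 rmorph0 mul0r.
    by case/eqP: ji; apply: val_inj; rewrite /= inordK.
  have e : i = t :> nat by apply/eqP; rewrite eqn_leq ti -ltnS ltn_ord.
  have : \sum_(j < t.+2) ev q`_j * x ^+ j = 0.
    rewrite -[RHS]qx (horner_coef_wide _ (n := t.+2)); last by rewrite -sq; apply: size_poly.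
    by apply: eq_bigr => j _; rewrite coef_map.
  rewrite big_ord_recr /= e /l lead_coefE sq /= => /eqP; rewrite addrC addr_eq0 => /eqP->.
  rewrite -sumrN; apply: eq_bigr => j _.
  by rewrite mxE e ltnn rmorphN mulNr.
have rowCX s i : \sum_j ev ((C ^+ s) i j) * x ^+ j = ev l ^+ s * x ^+ (s + i).
  elim: s i => [|s IH] i.
    rewrite (bigD1 i) //= mxE eqxx rmorph1 !mul1r ?expr0 ?mul1r ?add0n big1 ?addr0 // => j ji.
    by rewrite mxE eq_sym (negPf ji) rmorph0 mul0r.
  transitivity (\sum_k ev (C i k) * \sum_j ev ((C ^+ s) k j) * x ^+ j).
    under [RHS]eq_bigr => k _ do rewrite mulr_sumr.
    rewrite exchange_big /=; apply: eq_bigr => j _.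
    rewrite exprS mxE rmorph_sum mulr_suml; apply: eq_bigr => k _.
    by rewrite rmorphM mulrA.
  transitivity (ev l ^+ s * x ^+ s * \sum_k ev (C i k) * x ^+ k).
    rewrite mulr_sumr; apply: eq_bigr => k _; rewrite IH exprD.
    by ring_over Om.
  by rewrite rowC addSnnS exprD [ev l ^+ s.+1]exprSr; ring_over Om.
have eqm s : l ^+ s *: Bm s = l ^+ dl *: C ^+ s.
  apply/matrixP=> i j; rewrite !mxE.
  pose r : {poly A} := \poly_(j < t.+1) (l ^+ s * Bm s i (inord j) -
    l ^+ dl * (C ^+ s) i (inord j)).
  have r0 : r = 0.
    apply: minq; last by rewrite sq ltnS; apply: size_poly.
    rewrite (horner_coef_wide _ (n := t.+1)); last first.
      by apply: leq_trans (size_poly _ _) _; apply: size_poly.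
    transitivity (ev l ^+ s * (\sum_j ev (Bm s i j) * x ^+ j) -
        ev l ^+ dl * (\sum_j ev ((C ^+ s) i j) * x ^+ j)).
      rewrite !mulr_sumr -sumrB; apply: eq_bigr => k _.
      rewrite coef_map /= coef_poly ltn_ord inord_val rmorphB !rmorphM !rmorphXn.
      by rewrite mulrBl !mulrA.
    by rewrite rowB rowCX mulrCA subrr.
  have := congr1 (fun p : {poly A} => p`_j) r0.
  rewrite coef_poly ltn_ord coef0 inord_val !mxE => /eqP; rewrite subr_eq0 => /eqP.
  by move=> e; rewrite e.
have detX s : \det (C ^+ s) = \det C ^+ s.
  by elim: s => [|s IH]; rewrite ?expr0 ?det1 // !exprS detM IH.
(* C has determinant q_0 l^t up to sign. Taking determinants in [eqm] and cancelling l^(ts) leaves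
   l^s dividing l^(dl (t+1)) q_0^s. *)
apply: (closedA (dl := l ^+ (dl * t.+1))); rewrite ?expf_neq0 // => s.
have := congr1 determinant (eqm s); rewrite !detZ detX.
rewrite (det_scaled_companion t l (fun j => - q`_j)) => e.
exists ((-1) ^+ (t.+1 * s) * \det (Bm s)).
apply: (mulfI (expf_neq0 (t * s) l0)).
have sg : (-1) ^+ (t.+1 * s) * (-1) ^+ (t.+1 * s) = 1 :> A.
  by rewrite -expr2 -exprM mulnC exprM sqrrN expr1n expr1n.
have L1 : l ^+ s ^+ t.+1 = l ^+ (t * s) * l ^+ s.
  by rewrite -exprM -exprD; congr (_ ^+ _); rewrite mulnS mulnC addnC.
have L2 : (- q`_0 * ((-1) ^+ t * l ^+ t)) ^+ s =
    (-1) ^+ (t.+1 * s) * (l ^+ (t * s) * q`_0 ^+ s).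
  rewrite -[- _]mulN1r !exprMn -!exprM mulSn exprD. ring_over A.
rewrite L1 L2 -exprM in e; set eps := (-1) ^+ (t.+1 * s) in sg e *.
transitivity (eps * (l ^+ (t * s) * l ^+ s * \det (Bm s))); last by ring_over A.
rewrite e; set lD := l ^+ (dl * t.+1); set lts := l ^+ (t * s).
transitivity (eps * eps * (lD * (lts * q`_0 ^+ s))); last by ring_over A.
by rewrite sg mul1r; ring_over A.
Qed.

Lemma minimal_annihilator_shift q x (c : A) : minimal_annihilator q x ->
  minimal_annihilator (q \Po ('X + c%:P)) (x - ev c).
Proof.
have ev_shift (p : {poly A}) d z : (p \Po ('X + d%:P))^ev.[z] = p^ev.[z + ev d].
  rewrite map_comp_poly horner_comp rmorphD /= map_polyX map_polyC.
  by rewrite hornerD hornerX hornerC.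
have sz (p : {poly A}) d : size (p \Po ('X + d%:P)) = size p.
  by apply: size_comp_poly2; rewrite size_XaddC.
move=> [q0 qx minq]; split.
- by rewrite -size_poly_eq0 sz size_poly_eq0.
- by rewrite ev_shift subrK.
- move=> r rx; rewrite sz => rq.
  have e : r \Po ('X + (- c)%:P) = 0.
    by apply: minq; rewrite ?sz // ev_shift rmorphN.
  by apply/eqP; rewrite -size_poly_eq0 -(sz r (- c)) e size_poly0.
Qed.

(** Applied to x - k, [lead_divides_const] shows that the leading coefficient divides q(k) for every
    natural number k, hence every coefficient of q, and it can be divided out. *)
Lemma monic_minimal_annihilator x : integralOver ev x ->
  exists2 q, minimal_annihilator q x & q \is monic.
Proof.
move=> ix; have [q mq] := minimal_annihilator_exists ix; have [q0 qx minq] := mq.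
set l := lead_coef q; have l0 : l != 0 by rewrite lead_coef_eq0.
have lq : forall j, divides l q`_j.
  apply: divides_coefs => // k.
  have ixk : integralOver ev (x - ev k%:R) by apply: integral_sub => //; apply: integral_id.
  have := lead_divides_const (minimal_annihilator_shift k%:R mq) ixk.
  rewrite lead_coef_comp ?size_XaddC // lead_coefDl ?size_polyX ?size_polyC; last first.
    by case: (_ != 0).
  rewrite lead_coefX expr1n mulr1 -horner_coef0 horner_comp.
  by rewrite hornerD hornerX hornerC add0r.
have /choice[c hc] := lq.
pose p := \poly_(j < size q) c j.
have qE : q = l *: p.
  apply/polyP=> j; rewrite coefZ coef_poly; case: ltnP => [_|h]; first exact: hc.
  by rewrite mulr0 nth_default.
have sp : size p = size q by rewrite [in RHS]qE size_scale.
exists p; last first.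
  by rewrite monicE; apply/eqP/(mulfI l0); rewrite -lead_coefZ -qE mulr1.
split; last by move=> r rx; rewrite sp; apply: minq.
  by apply: contra_neq q0 => p0; rewrite qE p0 scaler0.
move: qx; rewrite qE -mul_polyC rmorphM /= map_polyC hornerM hornerC => /eqP.
by rewrite mulf_eq0 => /orP[/eqP/ev_inj/eqP|/eqP//]; rewrite (negPf l0).
Qed.

(** As a polynomial in z this is z^t q(v / z). *)
Definition twisted_reverse t (q : {poly A}) (v : A) : {poly A} :=
  \poly_(i < t.+1) (q`_(t - i) * v ^+ (t - i)).

Lemma horner_twisted_reverse t (q : {poly A}) v x z : (size q <= t.+1)%N -> ev v = x * z ->
  (twisted_reverse t q v)^ev.[z] = z ^+ t * q^ev.[x].
Proof.
move=> sq vxz; rewrite (horner_coef_wide _ (n := t.+1)); last first.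
  by apply: leq_trans (size_poly _ _) _; apply: size_poly.
rewrite [in RHS](horner_coef_wide _ (n := t.+1)); last exact: leq_trans (size_poly _ _) sq.
rewrite mulr_sumr (reindex_inj rev_ord_inj) /=; apply: eq_bigr => i _.
rewrite !coef_map /= coef_poly subSS ltnS leq_subr rmorphM subKn -1?ltnS // rmorphXn vxz.
have -> : z ^+ t = z ^+ (t - i) * z ^+ i by rewrite -exprD subnK // -ltnS.
by rewrite exprMn; ring_over Om.
Qed.

(* The monic minimal polynomial of w = v / x is x^t q(v/x) / q_0. *)
Lemma const_coef_divides q x v w : q \is monic -> minimal_annihilator q x ->
  x != 0 -> v != 0 -> ev v = x * w -> integralOver ev w ->
  q`_0 != 0 /\ divides q`_0 (v ^+ (size q).-1).
Proof.
move=> qm [q0 qx minq] x0 v0 vxw iw.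
have sq : size q = (size q).-1.+1 by rewrite prednK // size_poly_gt0.
set t := (size q).-1 in sq *.
have ev0 : ev v != 0 by apply: contra_neq v0; apply: ev_inj.
have w0 : w != 0 by apply: contra_neq ev0 => w0; rewrite vxw w0 mulr0.
have c0 : q`_0 != 0.
  apply/negP => /eqP c0; case: (t) sq => [|t' sq].
    move=> s1; have := monicP qm; rewrite lead_coefE s1 /= c0 => /eqP.
    by rewrite eq_sym oner_eq0.
  pose r := \poly_(i < t'.+1) q`_i.+1.
  have qE : q = r * 'X.
    apply/polyP=> -[|i]; rewrite coefMX //= coef_poly.
    by case: ltnP => // ti; rewrite nth_default // sq.
  have r0 : r = 0.
    apply: minq; last by rewrite sq ltnS; apply: size_poly.
    move: qx; rewrite qE rmorphM /= map_polyX hornerM hornerX => /eqP.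
    by rewrite mulf_eq0 (negPf x0) orbF => /eqP.
  by move/eqP: q0; rewrite qE r0 mul0r.
split=> //; set p := twisted_reverse t q v.
have pt : p`_t = q`_0 by rewrite coef_poly ltnSn subnn expr0 mulr1.
have sp : size p = t.+1.
  apply/eqP; rewrite eqn_leq size_poly ltnNge; apply: contra c0 => h.
  by rewrite -pt nth_default.
have mp : minimal_annihilator p w.
  split; first by rewrite -size_poly_eq0 sp.
    by rewrite (horner_twisted_reverse (x := x)) ?sq // qx mulr0.
  (* Twisting a smaller annihilator of w back would produce a smaller annihilator of x. *)
  move=> r rw; rewrite sp ltnS => sr.
  case: (posnP t) sr => [->|]; first by rewrite leqn0 size_poly_eq0 => /eqP.
  case: (t) sq => // t' sq _ sr.
  have rr : twisted_reverse t' r v = 0.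
    apply: minq; last by rewrite sq ltnS; apply: size_poly.
    by rewrite (horner_twisted_reverse (x := w)) ?rw ?mulr0 // vxw mulrC.
  apply/polyP=> i; rewrite coef0; have [it|ti] := leqP i t'; last first.
    by rewrite nth_default //; apply: leq_trans sr ti.
  have := congr1 (fun p : {poly A} => p`_(t' - i)) rr.
  rewrite coef_poly ltnS leq_subr coef0 subKn // => /eqP.
  by rewrite mulf_eq0 expf_eq0 (negPf v0) andbF orbF => /eqP.
have := lead_divides_const mp iw; rewrite lead_coefE sp /= pt.
rewrite coef_poly subn0; have := monicP qm; rewrite lead_coefE => -> //.
by rewrite mul1r.
Qed.

End MinimalPolynomial.

Lemma mpoly_lift_supp (K : fieldType) e (i : 'I_e.+1) (a : {mpoly K[e]}) m :
  (mpoly_lift K i a)@_m != 0 -> m i = 0%N.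
Proof.
elim/mpoly_ring_ind: a m => [c|k|a b ha hb|a b ha hb] m.
- rewrite mpoly_liftC mcoeffC; have [->|] := eqVneq m 0%MM; first by rewrite mnm0E.
  by rewrite mulr0 eqxx.
- rewrite mpoly_liftX mcoeffX; have [<-|] := eqVneq U_(lift i k)%MM m.
    by rewrite mnm1E [lift i k == i]eq_sym (negPf (neq_lift i k)).
  by rewrite eqxx.
- rewrite (rmorphD (mpoly_lift K i)) mcoeffD; have [h|h _] := eqVneq (mpoly_lift K i a)@_m 0.
    by rewrite h add0r; apply: hb.
  exact: ha.
- rewrite (rmorphM (mpoly_lift K i)) -mcoeff_msupp => /msuppM_le/allpairsP[[m1 m2] /=].
  by rewrite !mcoeff_msupp => -[/ha h1 /hb h2 ->]; rewrite mnmDE h1 h2.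
Qed.

Lemma mpoly_nonconstant_sep (K : fieldType) e (f : {mpoly K[e.+1]}) :
  (forall i, (size (mpoly_sep K i f) <= 1)%N) -> exists c, f = c%:MP.
Proof.
move=> hf; exists f@_0; apply/mpolyP=> m; rewrite mcoeffC.
have [->|m0] := eqVneq m 0%MM; first by rewrite mulr1.
rewrite mulr0; apply/eqP; apply: contraNT m0 => fm; apply/eqP/mnmP=> i; rewrite mnm0E.
apply: (@mpoly_lift_supp _ _ i (mpoly_sep K i f)`_0).
by rewrite -mpoly_joinC -(size1_polyC (hf i)) mpoly_sepK.
Qed.

Lemma mpoly_nat_inv (K : fieldType) n : (forall k, k.+1%:R != 0 :> K) ->
  forall k, exists c : {mpoly K[n]}, c * k.+1%:R = 1.
Proof.
move=> natK k; exists (k.+1%:R^-1)%:MP.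
by rewrite -(rmorph_nat (@mpolyC n K)) -rmorphM mulVf.
Qed.

Lemma size_factor_polyC (A : idomainType) (a : A) (p q : {poly A}) :
  a != 0 -> a%:P = p * q -> (size p <= 1)%N.
Proof.
move=> a0 e; have : p * q != 0 by rewrite -e polyC_eq0.
rewrite mulf_eq0 negb_or => /andP[p0 q0]; have := size_polyC_leq1 a.
by rewrite e size_mul //; move: q0; rewrite -size_poly_gt0; lia.
Qed.

(** * The drop of the transcendence degree between adjacent primes *)

Section DimensionDrop.
Variables (K : fieldType) (n : nat).
Notation R := {mpoly K[n]}.
Implicit Types P Q : set R.

Lemma has_indep_leq P e : has_indep P e -> (e <= n)%N.
Proof.
move=> [Om [phi [s [w [hP s0 ind]]]]].
have [N [h hN]] := clear_denominators_family s w.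
pose y i := phi 'X_i; pose kap : {rmorphism K -> Om} := phi \o @mpolyC n K.
have phiE a : phi a = mpev kap y a by apply: mpev_unique.
have int a : integralOver (mpev kap y) (phi a) by rewrite phiE; apply: integral_id.
apply: (@alg_indep_leq _ _ kap n y _ _ (phi s ^+ N) ind).
- exact: expf_neq0.
- by rewrite -rmorphXn.
- by move=> i; rewrite hN.
Qed.

Lemma has_indep_minimal P Q u g e : (forall k, k.+1%:R != 0 :> K) ->
  prime_ideal P -> prime_ideal Q -> (P `<=` Q)%classic ->
  Q u -> ~ P u -> ~ Q g -> (forall v, Q v -> exists k b, P ((g * v) ^+ k - u * b)) ->
  has_indep P e.+1 -> exists2 f, (e <= f)%N & has_indep Q f.
Proof.
move=> natK pP pQ PQ Qu Pu Qg min [Om [phi [s [w [hP s0 ind]]]]].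
have [Om' [psi hQ]] := quotient_field_exists pQ.
have psig : psi g != 0 by apply/eqP => /hQ.
have phig : phi g != 0 by apply/eqP => /hP/PQ.
have phiu : phi u != 0 by apply/eqP => /hP.
have psiu : psi u = 0 by apply/hQ.
pose kap : {rmorphism K -> Om} := phi \o @mpolyC n K.
pose kap' : {rmorphism K -> Om'} := psi \o @mpolyC n K.
pose kapP : {rmorphism K -> {poly R}} := polyC \o @mpolyC n K.
have kapE c : locev phi g (kapP c) = kap c by rewrite /= locevC.
have kapE' c : locev psi g (kapP c) = kap' c by rewrite /= locevC.
pose B : set Om := [set x | exists F, locev phi g F = x]%classic.
have Bk c : B (kap c) by exists (kapP c).
have BD a b : B a -> B b -> B (a + b).
  by move=> [F <-] [G <-]; exists (F + G); rewrite rmorphD.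
have BM a b : B a -> B b -> B (a * b).
  by move=> [F <-] [G <-]; exists (F * G); rewrite rmorphM.
pose om (i : 'I_n.+1) := oapp (fun j => phi 'X_j) (phi g)^-1 (unlift ord_max i).
have Bom i : B (om i).
  rewrite /om; case: (unliftP ord_max i) => [j _|_] /=.
    by exists ('X_j)%:P; rewrite locevC.
  by exists 'X; rewrite locevX.
have [d [y [By indy inty]]] := noether_normalization Bk BD BM Bom.
have intphi a : integralOver (mpev kap y) (phi a).
  elim/mpoly_ring_ind: a => [c|i|a b ha hb|a b ha hb].
  - by rewrite -[phi _]/(kap c) -(mpevC kap y); apply: integral_id.
  - by have := inty (lift ord_max i); rewrite /om liftK.
  - by rewrite rmorphD; apply: integral_add.
  - by rewrite rmorphM; apply: integral_mul.
have intB F : integralOver (mpev kap y) (locev phi g F).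
  elim/poly_ind: F => [|F c IH]; first by rewrite rmorph0; apply: integral0.
  rewrite rmorphD rmorphM locevC locevX; apply: integral_add => //.
  by apply: integral_mul => //; have := inty ord_max; rewrite /om unlift_none.
have [N [h hN]] := clear_denominators_family s w.
have ed : (e.+1 <= d)%N.
  apply: (@alg_indep_leq _ _ kap d y _ _ (phi s ^+ N) ind).
  - exact: expf_neq0.
  - by rewrite -rmorphXn.
  - by move=> i; rewrite hN.
have /choice[Y hY] := By.
pose ev := mpev kap y.
(* The same representatives evaluated modulo Q: the kernel of [chi] is the trace of Q on the
   polynomial ring A. *)
pose chi := mpev kap' (locev psi g \o Y).
have evE f : locev phi g (mpev kapP Y f) = ev f.
  rewrite (mpev_rmorph _ _ kapE); apply/esym/mpev_unique => [c|i].
    exact: mpevC.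
  by rewrite [LHS]mpevX /= hY.
have chiE f : locev psi g (mpev kapP Y f) = chi f := mpev_rmorph _ _ kapE'.
have [[v0 v00 chiv0]|noker] := pselect (exists2 v, v != 0 & chi v = 0); last first.
  exists d; first exact: ltnW.
  exists Om', psi, g, Y; split=> // f hf; apply/eqP; apply: contraT => f0.
  by case: noker; exists f.
case: d => [|d] in y By indy inty intphi intB ed Y hY @ev @chi evE chiE v0 v00 chiv0 *.
  by [].
have nat_inv := mpoly_nat_inv d.+1 natK.
have [q mq qm] := monic_minimal_annihilator indy nat_inv
  (@mpoly_completely_integrally_closed K d.+1) (intphi u).
have [q0 qu minq] := mq.
(* Up to a power of g, v is represented by an element of Q. Nilpotency of g Q modulo u R + P writes
   v^k as u times an element of R[1/g], which is integral over A. *)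
have div v : v != 0 -> chi v = 0 -> q`_0 != 0 /\ exists M, divides q`_0 (v ^+ M).
  move=> vn0 chiv; have [L [a ha]] := clear_denominators g (mpev kapP Y v).
  have Qa : Q a.
    apply/hQ; have := ha _ psi psig 0%N.
    by rewrite chiE chiv mulr0 expr0 mul1r.
  have [k [b hb]] := min a Qa.
  have eqa : phi g ^+ L * ev v = phi a.
    by rewrite -evE; have := ha _ phi phig 0%N; rewrite addn0 expr0 mul1r.
  have evk : ev (v ^+ k) = phi u * locev phi g (b%:P * 'X^(L.+1 * k)).
    rewrite rmorphM locevC [locev phi g _]rmorphXn locevX exprVn mulrA.
    have e1 : (phi g * phi a) ^+ k = phi u * phi b.
      apply/eqP; rewrite -subr_eq0 -!rmorphM -rmorphXn -rmorphB; apply/eqP.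
      exact/hP.
    apply: (canRL (mulfK _)); first by rewrite expf_neq0.
    by rewrite -e1 -eqa exprM rmorphXn -exprMn exprS; congr (_ ^+ _); ring_over Om.
  have [|c0 hc] := const_coef_divides indy
    (@mpoly_completely_integrally_closed K d.+1) qm mq phiu _ evk (intB _).
    exact: expf_neq0.
  by split=> //; exists (k * (size q).-1)%N; rewrite exprM.
have [c0 _] := div _ v00 chiv0.
(* The relation q(u) = 0 holds modulo P, hence modulo Q, where u vanishes. *)
have chic : chi q`_0 = 0.
  pose F := (map_poly (mpev kapP Y) q).[u%:P].
  have F0 : locev phi g F = 0.
    rewrite /F -horner_map /= locevC -map_poly_comp -[RHS]qu; congr (_.[_]).
    by apply: eq_map_poly => f /=; apply: evE.
  have := locev_sub hP hQ PQ psig F0.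
  rewrite /F -horner_map /= locevC psiu -map_poly_comp horner_coef0 coef_map /=.
  by rewrite chiE.
have [i hi] : exists i, (1 < size (mpoly_sep K i q`_0)%R)%N.
  apply: contrapT => /forallNP hno.
  have [|c qc] := @mpoly_nonconstant_sep K d q`_0.
    by move=> i; rewrite leqNgt; apply/negP/hno.
  move: chic c0; rewrite qc /chi mpevC => /eqP; rewrite fmorph_eq0 => /eqP->.
  by rewrite mpolyC0 eqxx.
(* A nonzero relation f among the other variables would have a power divisible by c, although f has
   degree zero in X_i and c does not. *)
exists d => //; exists Om', psi, g, (Y \o lift i); split=> // f hf.
have chil : chi (mpoly_lift K i f) = 0.
  rewrite -[RHS]hf; apply: (mpev_unique (G := chi \o mpoly_lift K i)) => [c|j] /=.
    by rewrite mpoly_liftC; apply: mpevC.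
  by rewrite mpoly_liftX; apply: mpevX.
apply/eqP; apply: contraT => f0.
have lf0 : mpoly_lift K i f != 0.
  apply: contra_neq f0 => lf0; have := mpoly_sep_of_lift i f.
  by rewrite lf0 rmorph0 => /esym/eqP; rewrite polyC_eq0 => /eqP.
have [_ [M [c hc]]] := div _ lf0 chil.
have := congr1 (mpoly_sep K i) hc.
rewrite rmorphXn rmorphM mpoly_sep_of_lift -rmorphXn => e1.
have := size_factor_polyC (expf_neq0 M f0) e1.
by rewrite leqNgt hi.
Qed.

End DimensionDrop.

(** * Catenarity *)

Lemma PSpecP (K : fieldType) (A : comAlgType K) (br : A -> A -> A) P :
  PSpec br P <-> prime_ideal P /\ poisson_stable br P.
Proof.
have mem a : a \in [pred a | a \in P] <-> P a.
  by rewrite inE.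
split=> [[[P0 P1 PZ] pP sP]|[pP sP]].
  split=> //; split; first split.
  - exact/mem.
  - by move=> a b /mem Pa /mem Pb; apply/mem; rewrite -[a]mul1r; apply: PZ.
  - by move=> a b /mem Pb; apply/mem; rewrite -[a * b]addr0; apply: PZ.
  - by move=> /mem; apply/negP.
  - by move=> a b /mem/pP/orP[] /mem; [left | right].
have iP := prime_ideal_ideal pP; split=> //.
- split; [apply/mem; exact: ideal0 | apply/negP => /mem; exact: prime_ideal1 |].
  by move=> a x y /mem Px /mem Py; apply/mem; apply: idealD => //; apply: idealM.
- by move=> a b /mem/(prime_idealP pP)[] h; apply/orP; [left | right]; apply/mem.
Qed.

Section Catenary.
Variables (K : fieldType) (n : nat) (br : {mpoly K[n]} -> {mpoly K[n]} -> {mpoly K[n]}).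

Definition max_indep (P : set {mpoly K[n]}) e :=
  has_indep P e /\ forall f, has_indep P f -> (f <= e)%N.

Lemma max_indep_exists P : prime_ideal P -> exists e, max_indep P e.
Proof.
move=> pP; have ex : exists e, `[< has_indep P e >].
  by exists 0%N; apply/asboolP; apply: has_indep0.
have bd e : `[< has_indep P e >] -> (e <= n)%N by move/asboolP/has_indep_leq.
case: (ex_maxnP ex bd) => e /asboolP he max; exists e; split=> // f hf.
by apply: max; apply/asboolP.
Qed.

Lemma max_indep_unique P e f : max_indep P e -> max_indep P f -> e = f.
Proof. by move=> [he e_max] [hf f_max]; apply/eqP; rewrite eqn_leq e_max ?f_max. Qed.

Hypothesis drop : forall P Q e f, PSpec br P -> PSpec br Q -> (P `<` Q)%classic ->
  ~ (exists2 X, PSpec br X & (P `<` X)%classic /\ (X `<` Q)%classic) ->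
  max_indep P e -> max_indep Q f -> e = f.+1.

(** The length of a saturated chain is the difference of the transcendence degrees at its ends,
    whatever the chain. *)
Lemma catenary_of_drop : catenary (PSpec br).
Proof.
have chain P Q m c : saturated_chain (PSpec br) P Q m c -> forall e f,
    max_indep P e -> max_indep Q f -> e = (f + m)%N.
  move=> [c0 cm cX cS cN] e f; rewrite -{1}c0 -{1}cm => he.
  elim: {cm}m cX cS cN f => [|m IH] cX cS cN f hf.
    by rewrite addn0; apply: max_indep_unique he hf.
  have [g hg] : exists g, max_indep (c m) g.
    by apply: max_indep_exists; have /PSpecP[] := cX m (leqnSn m).
  rewrite (IH _ _ _ g hg).
  - by rewrite (drop _ _ (cS m _) (cN m _) hg hf) ?addSnnS //; apply: cX.
  - by move=> i im; apply: cX; apply: leqW.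
  - by move=> i im; apply: cS; apply: leqW.
  - by move=> i im; apply: cN; apply: leqW.
move=> P Q XP XQ PQ m l c d hc hd.
have [e he] := max_indep_exists (iffLR (PSpecP br P) XP).1.
have [f hf] := max_indep_exists (iffLR (PSpecP br Q) XQ).1.
by apply: (@addnI f); rewrite -(chain _ _ _ _ hc e f he hf) -(chain _ _ _ _ hd e f he hf).
Qed.

End Catenary.

Theorem theorem1p2 (K : fieldType) (charK : [pchar K] =i pred0) (n r : nat)
    (br : {mpoly K[n]} -> {mpoly K[n]} -> {mpoly K[n]})
    (sigma delta : 'I_n -> {mpoly K[n]} -> {mpoly K[n]})
    (act : torus K r -> {mpoly K[n]} -> {mpoly K[n]})
    (nilp : poisson_nilpotent br sigma delta act) :
  catenary (PSpec br).
Proof.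
have [D [om [hR DX NS]]] := nilpotent_normal_separation nilp charK.
have natK k : k.+1%:R != 0 :> K.
  by rewrite natf_neq0_pchar; apply/pnatP => // p pp _; rewrite inE charK.
have nat_inv := mpoly_nat_inv n natK.
apply: catenary_of_drop => P Q e f /PSpecP[pP sP] /PSpecP[pQ sQ] [PQ QP] adj.
move=> [he e_max] [hf f_max].
have fe : (f.+1 <= e)%N by apply: e_max; apply: has_indep_sub hf.
have homog_span := mpoly_homog_span hR DX.
have ln := locally_normal nat_inv hR NS homog_span pP pQ sQ PQ QP.
have [|u [g [Qu Pu Qg min]]] := adjacent_minimal nat_inv (@noetherian_mpoly K n)
  (pr_der hR) (pr_anti hR) pP pQ sP sQ PQ _ ln.
  move=> X pX sX PX XQ XP; apply/seteqP; split=> //; apply: contrapT => QX.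
  by case: adj; exists X; [apply/PSpecP | split; split].
case: e he e_max fe => // e he e_max fe.
(* The drop is at least one by [fe]; this bounds it above by one. *)
have [f' ef' hf'] := has_indep_minimal natK pP pQ PQ Qu Pu Qg min he.
by have := f_max f' hf'; lia.
Qed.
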